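(* Let $n\ge 1$, let $m_1,\dots,m_n$ be nonnegative integers, $|m|=m_1+\dots+m_n$, and let $a,b,c,d,e,z_1,\dots,z_n$ be nonzero complex numbers with $a^2q^{1+|m|}=bcde$. Then $$\sum_{y_1=0}^{m_1}\cdots\sum_{y_n=0}^{m_n} \Bigg(\frac{\Delta(zq^y)}{\Delta(z)}\prod_{1\leq j\leq k\leq n} \frac{\theta(az_jz_kq^{y_j+y_k})}{\theta(az_jz_k)} \prod_{j,k=1}^n\frac{(q^{-m_j}z_k/z_j,az_jz_k)_{y_k}}{(qz_k/z_j, aq^{1+m_j}z_jz_k)_{y_k}}$$ $$\times\prod_{k=1}^n\frac {(bz_k,cz_k,dz_k,ez_k)_{y_k}}{(aqz_k/b,aqz_k/c,aqz_k/d,aqz_k/e)_{y_k}} \,q^{|y|}\Bigg)$$ $$=\frac{\prod_{j,k=1}^n(aqz_jz_k)_{m_k}} {\prod_{1\leq j<k\leq n}(aqz_jz_k)_{m_j+m_k}}\cdot \frac{(aq/bc,aq/bd,aq/cd)_{|m|}} {\prod_{k=1}^n(aqz_k/b,aqz_k/c,aqz_k/d,q^{-m_k}e/az_k)_{m_k}}.$$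
   Context: Fix $p\in\mathbb C$ with $|p|<1$ and $q\in\mathbb C\setminus\{0\}$. For $x\neq 0$ put $\theta(x)=\prod_{j=0}^\infty(1-p^jx)(1-p^{j+1}/x)$ (so $\theta(x)=1-x$ when $p=0$). The elliptic Pochhammer symbol is $(a)_k=\theta(a)\theta(aq)\cdots\theta(aq^{k-1})$ for integers $k\ge 0$, with $(a)_0=1$, and $(a_1,\dots,a_r)_k=(a_1)_k\cdots(a_r)_k$. In arguments, everything after the slash is in the denominator, e.g. $q^{-m_k}e/az_k$ means $q^{-m_k}e/(az_k)$. For $z=(z_1,\dots,z_n)$, the elliptic Vandermonde determinant is $\Delta(z)=\prod_{1\le j<k\le n}z_j\,\theta(z_k/z_j)$, and $zq^y=(z_1q^{y_1},\dots,z_nq^{y_n})$, $|y|=y_1+\dots+y_n$. Standing assumption: all expressions are well-defined, i.e. the parameters are such that no denominator occurring on either side vanishes. *)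

(* Defs.v *)
From mathcomp Require Import all_boot all_order all_algebra.
From mathcomp Require Import all_classical all_reals topology normedtype sequences.

Set Implicit Arguments.
Unset Strict Implicit.
Unset Printing Implicit Defensive.

Import Order.TTheory GRing.Theory Num.Theory numFieldNormedType.Exports.

Local Open Scope ring_scope.

(* The base field is kept generic: it supplies the norm topology in which the
   limit is taken, and the complex numbers are the instance K = R[i] with
   R : realType, where the limit exists whenever `|p| < 1. *)

Definition theta (K : numFieldType) (p x : K) : K :=
  limn (fun N : nat =>
    \prod_(0 <= j < N) ((1 - p ^+ j * x) * (1 - p ^+ j.+1 / x))).

Definition epoch (K : numFieldType) (p q a : K) (k : nat) : K :=
  \prod_(0 <= i < k) theta p (a * q ^+ i).

(* (a_1, ..., a_r)_k *)
Definition epochs (K : numFieldType) (p q : K) (s : seq K) (k : nat) : K :=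
  \prod_(a <- s) epoch p q a k.

Definition evandermonde (K : numFieldType) (p : K) (n : nat) (z : 'I_n -> K)
    : K :=
  \prod_(j < n) \prod_(k < n | (j < k)%N) (z j * theta p (z k / z j)).

(* Main.v *)
Require Import Defs.
From mathcomp Require Import all_boot all_order all_algebra.
From mathcomp Require Import complex.
From mathcomp Require Import all_classical all_reals topology normedtype sequences.
From mathcomp Require Import ring zify.

(* Put r_j = q^-m_j / z_j.  Up to factors free of b, c, d, e and of the m_j, the
   summand is the product over k and over r in {r_1, ..., r_n, b, c, d, e} of
   (r z_k)_{y_k} / (a q z_k / r)_{y_k}, so that all these r play the same role.
   Fix b c = sigma, d and e.  Once the denominators are cleared, b enters both
   sides only through products of |m| factors theta(b X) theta(sigma X / b), and
   by the addition formula these factors span a space of dimension two.  Both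
   sides are therefore binary forms of degree |m| and it suffices to compare them
   at |m| + 1 points.  At b = q^-i / z_k with i < m_k, exchanging b with r_k gives
   the sum with m_k replaced by i; at b = a q^m_k z_k only the terms with
   y_k = m_k survive and they form the sum with m_k replaced by 0.  Induction on
   |m| concludes for generic parameters.  In general, perturb (a, b, e) into
   (a u, b u^3, e / u) with u -> 1: theta is continuous and its zeros are isolated,
   so the perturbed parameters are generic and both sides converge.

   The addition formula follows from the Jacobi triple product, obtained as a
   limit of the q-binomial theorem, by splitting the double Laurent series of
   theta(x y) theta(x / y) according to the parity of the exponents. *)

Set Implicit Arguments.
Unset Strict Implicit.
Unset Printing Implicit Defensive.

Import Order.TTheory GRing.Theory Num.Theory numFieldNormedType.Exports.

Local Open Scope ring_scope.

(** Moving b with b c = sigma fixed preserves the balancing condition and the factor (a q / b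
    c)_{|m|}. The nodes q^-i / z_k number |m|, one too few. The extra node a q^m_k z_k is a zero of
    the denominator (a q z_k / b)_{m_k}, so both sides can only be compared there after
    multiplication by the denominators in b and c.

    An exchange at a node changes b and divides sigma by a power of q. Hence the induction keeps a
    and z fixed, quantifies over b, c, d, e, and asks that sigma be generic over a range of powers
    of q. Genericity also separates the nodes: two of them give distinct points (E b : O b) of the
    projective line when neither their ratio nor sigma over their product is a zero of theta. The
    conditions on q and on the ratios z_j / z_k follow from the nonvanishing denominators of the
    statement, so it is enough to perturb a, b and e.

    Square roots enter through p = rho^2 and sigma = s^2, which bring theta(b X) theta(sigma X / b)
    to the shape theta(x y) theta(x / y). *)

Section BigPairs.
Variables (K : comPzRingType) (n : nat).
Implicit Types (F C : 'I_n -> 'I_n -> K).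

Lemma prod_square_triangle F :
  \prod_(j < n) \prod_(l < n) F j l =
  \prod_(j < n) F j j * \prod_(j < n) \prod_(l < n | (j < l)%N) (F j l * F l j).
Proof.
have E j : \prod_(l < n) F j l =
    F j j * (\prod_(l < n | (j < l)%N) F j l * \prod_(l < n | (l < j)%N) F j l).
  rewrite (bigD1 j) //= (bigID (fun l : 'I_n => (j < l)%N)) /=.
  congr (_ * (_ * _)); apply: eq_bigl => l; rewrite -val_eqE /=; lia.
rewrite (eq_bigr _ (fun j _ => E j)) !big_split /=; congr (_ * _).
under [in RHS]eq_bigr do rewrite big_split /=.
rewrite big_split /=; congr (_ * _).
by rewrite (exchange_big_dep predT).
Qed.

Lemma prod_triangle_diag F :
  \prod_(j < n) \prod_(l < n | (j <= l)%N) F j l =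
  \prod_(j < n) F j j * \prod_(j < n) \prod_(l < n | (j < l)%N) F j l.
Proof.
rewrite -big_split /=; apply: eq_bigr => j _.
rewrite (bigD1 j) //=; congr (_ * _); apply: eq_bigl => l.
by rewrite -val_eqE /=; lia.
Qed.

(** Symmetry makes it irrelevant on which side of k the other index lies. This is what isolates one
    string, both in the summand and in the closed form. *)
Lemma prod_triangle_split C (k : 'I_n) :
  (forall j l, j != l -> C j l = C l j) ->
  \prod_(j < n) \prod_(l < n | (j < l)%N) C j l =
  (\prod_(j < n | j != k) C j k) *
  \prod_(j < n | j != k) \prod_(l < n | (l != k) && (j < l)%N) C j l.
Proof.
move=> Csym.
rewrite (bigD1 k) //=.
have E j : j != k -> \prod_(l < n | (j < l)%N) C j l =
    (if (j < k)%N then C j k else 1) * \prod_(l < n | (l != k) && (j < l)%N) C j l.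
  move=> jk; rewrite big_mkcond (bigD1 k) //=; congr (_ * _).
  by rewrite -big_mkcondr.
rewrite (eq_bigr _ E) big_split /= mulrA; congr (_ * _).
have -> : \prod_(l < n | (k < l)%N) C k l =
   \prod_(l < n | l != k) (if (k < l)%N then C k l else 1).
  rewrite -big_mkcondr /=; apply: eq_bigl => l.
  by rewrite -val_eqE /=; lia.
rewrite -big_split /=; apply: eq_bigr => l lk.
move: (lk); rewrite -val_eqE /= => lk'.
case: (ltngtP k l) => H; rewrite ?mul1r ?mulr1 ?(Csym k l) 1?eq_sym //.
by move/eqP: lk'; rewrite H.
Qed.

End BigPairs.

(** * Binary forms *)

Section Forms.
Variables (K : fieldType) (E O : K -> K).

(* The restriction to b != 0 reflects that theta functions live on the
   multiplicative group. *)
Fixpoint form (n : nat) (F : K -> K) : Prop :=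
  match n with
  | 0 => exists c, forall b, b != 0 -> F b = c
  | n'.+1 => exists F1 F2, [/\ form n' F1, form n' F2 &
      forall b, b != 0 -> F b = E b * F1 b + O b * F2 b]
  end.

Definition linear_form (f : K -> K) :=
  exists u v, forall b, b != 0 -> f b = u * E b + v * O b.

Lemma form_ext n F G : (forall b, b != 0 -> F b = G b) -> form n F -> form n G.
Proof.
case: n => [|n] FG /=.
  by case=> c Fc; exists c => b b0; rewrite -FG // Fc.
case=> F1 [F2 [h1 h2 h]]; exists F1, F2; split=> // b b0.
by rewrite -FG // h.
Qed.

Lemma form_scale n c F : form n F -> form n (fun b => c * F b).
Proof.
elim: n F => [|n IH] F /=.
  by case=> d Fd; exists (c * d) => b b0; rewrite Fd.
case=> F1 [F2 [/IH h1 /IH h2 h]]; exists (fun b => c * F1 b), (fun b => c * F2 b).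
by split=> // b b0; rewrite h //; ring.
Qed.

Lemma form_add n F G : form n F -> form n G -> form n (fun b => F b + G b).
Proof.
elim: n F G => [|n IH] F G /=.
  by case=> c Fc [d Gd]; exists (c + d) => b b0; rewrite Fc // Gd.
case=> F1 [F2 [h1 h2 h]] [G1 [G2 [k1 k2 k]]].
exists (fun b => F1 b + G1 b), (fun b => F2 b + G2 b).
by split; [exact: IH|exact: IH|move=> b b0; rewrite h // k //; ring].
Qed.

Lemma form_const0 n : form n (fun _ => 0).
Proof.
elim: n => [|n IH] /=; first by exists 0.
by exists (fun _ => 0), (fun _ => 0); split=> // b _; rewrite !mulr0 addr0.
Qed.

Lemma form_sum n (I : Type) (r : seq I) (P : pred I) (F : I -> K -> K) :
  (forall i, P i -> form n (F i)) -> form n (fun b => \sum_(i <- r | P i) F i b).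
Proof.
move=> hF; elim: r => [|i r IH].
  by apply: form_ext (form_const0 n) => b _; rewrite big_nil.
have [Pi|Pi] := boolP (P i); last first.
  by apply: form_ext IH => b _; rewrite big_cons (negbTE Pi).
apply: form_ext (form_add (hF i Pi) IH) => b _.
by rewrite big_cons Pi.
Qed.

Lemma form_mul_linear n f F :
  linear_form f -> form n F -> form n.+1 (fun b => f b * F b).
Proof.
case=> u [v fuv] hF.
exists (fun b => u * F b), (fun b => v * F b).
split; [exact: form_scale|exact: form_scale|].
by move=> b b0; rewrite fuv //; ring.
Qed.

Lemma form_prod (I : Type) (r : seq I) (f : I -> K -> K) :
  (forall i, linear_form (f i)) -> form (size r) (fun b => \prod_(i <- r) f i b).
Proof.
move=> hf; elim: r => [|i r IH].
  by exists 1 => b _; rewrite big_nil.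
apply: form_ext (form_mul_linear (hf i) IH) => b _.
by rewrite big_cons.
Qed.

Lemma form_mul n m F G :
  form n F -> form m G -> form (n + m) (fun b => F b * G b).
Proof.
elim: n F => [|n IH] F /=.
  case=> c Fc hG; apply: form_ext (form_scale c hG) => b b0.
  by rewrite Fc.
case=> F1 [F2 [h1 h2 h]] hG.
exists (fun b => F1 b * G b), (fun b => F2 b * G b).
by split; [exact: IH|exact: IH|move=> b b0; rewrite h //; ring].
Qed.

Lemma form_bigprod (I : Type) (r : seq I) (d : I -> nat) (F : I -> K -> K) :
  (forall i, form (d i) (F i)) ->
  form (\sum_(i <- r) d i) (fun b => \prod_(i <- r) F i b).
Proof.
move=> hF; elim: r => [|i r IH].
  by rewrite big_nil; exists 1 => b _; rewrite big_nil.
rewrite big_cons.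
by apply: form_ext (form_mul (hF i) IH) => b _; rewrite big_cons.
Qed.

Definition cross b1 b2 := E b1 * O b2 - E b2 * O b1.

Lemma form_exp n f : linear_form f -> form n (fun b => f b ^+ n).
Proof.
move=> hf; elim: n => [|n IH]; first by exists 1 => b _; rewrite expr0.
by apply: form_ext (form_mul_linear hf IH) => b _; rewrite exprS.
Qed.

(* Euclidean division of a binary form by the linear form vanishing at b0. *)
Lemma form_div n F b0 u v : u * E b0 + v * O b0 = 1 -> b0 != 0 ->
  form n.+1 F -> exists2 G, form n G & forall b, b != 0 ->
    F b = F b0 * (u * E b + v * O b) ^+ n.+1 + cross b b0 * G b.
Proof.
move=> uv b0N.
(* The normalisation of u, v makes u E + v O and [cross _ b0] a basis of the linear forms; E and O
   are expanded in this basis. *)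
have eE b : E b = (u * E b + v * O b) * E b0 + v * cross b b0.
  by rewrite -[LHS]mulr1 -uv /cross; ring.
have eO b : O b = (u * E b + v * O b) * O b0 - u * cross b b0.
  by rewrite -[LHS]mulr1 -uv /cross; ring.
elim: n F => [|n IH] F.
  case=> F1 [F2 [[c1 h1] [c2 h2] h]].
  exists (fun _ => v * c1 - u * c2); first by exists (v * c1 - u * c2).
  move=> b bN; rewrite !h // !h1 // !h2 // expr1.
  by rewrite [in LHS]eE [X in _ + X * c2]eO; ring.
case=> F1 [F2 [/IH[G1 hG1 e1] /IH[G2 hG2 e2] h]].
exists (fun b => E b * G1 b + O b * G2 b +
   (v * F1 b0 - u * F2 b0) * (u * E b + v * O b) ^+ n.+1).
  apply: form_add; first by exists G1, G2.
  by apply: form_scale; apply: form_exp; exists u, v.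
move=> b bN; rewrite !h // (e1 b) // (e2 b) //.
set L := u * E b + v * O b; rewrite [L ^+ n.+2]exprS; set P := L ^+ n.+1.
transitivity (P * (E b * F1 b0 + O b * F2 b0) +
   cross b b0 * (E b * G1 b + O b * G2 b)); first by ring.
have -> : E b * F1 b0 + O b * F2 b0 =
    L * (E b0 * F1 b0 + O b0 * F2 b0) + cross b b0 * (v * F1 b0 - u * F2 b0).
  by rewrite [X in X * F1 b0]eE [X in X * F2 b0]eO -/L; ring.
by ring.
Qed.

(** A nonzero binary form of degree n has at most n zeros on the projective line, and
    [cross b1 b2 != 0] says that (E : O) takes different values at b1 and b2. Each node is divided
    out in turn by [form_div]. *)
Lemma form_eq0 n F (s : seq K) :
  form n F -> size s = n.+1 -> all (fun b => b != 0) s ->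
  pairwise (fun b1 b2 => cross b1 b2 != 0) s ->
  (forall b, b \in s -> F b = 0) -> forall b, b != 0 -> F b = 0.
Proof.
elim: n F s => [|n IH] F [|b0 s] //=.
  case=> c Fc _ /andP[b0N _] _ F0 b bN.
  by rewrite Fc // -(Fc b0) // F0 ?mem_head.
move=> hF [sz] /andP[b0N sN] /andP[b0s ps] F0 b bN.
(* E and O cannot both vanish at b0: [cross] with the next node, which exists because the degree is
   positive, would be 0. *)
have [u [v uv]] : exists u v, u * E b0 + v * O b0 = 1.
  have [E0|E0] := eqVneq (E b0) 0; last first.
    by exists (E b0)^-1, 0; rewrite mul0r addr0 mulVf.
  have [O0|O0] := eqVneq (O b0) 0; last first.
    by exists 0, (O b0)^-1; rewrite mul0r add0r mulVf.
  case: s sz b0s {ps sN F0} => // b1 s _ /= /andP[].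
  by rewrite /cross E0 O0 mul0r mulr0 subrr eqxx.
have [G hG FG] := form_div uv b0N hF.
have Fb0 : F b0 = 0 by rewrite F0 ?mem_head.
rewrite FG // Fb0 mul0r add0r (IH G s) ?mulr0 // => b1 b1s.
have b1N := allP sN _ b1s.
have /eqP := F0 b1 (mem_behead (s := b0 :: s) b1s).
rewrite FG // Fb0 mul0r add0r mulf_eq0 => /orP[|/eqP //].
have := allP b0s _ b1s; rewrite /cross -oppr_eq0 opprB.
by move/negbTE->.
Qed.

End Forms.

(** * Elliptic shifted factorials *)

Ltac nz := repeat first [ done | assumption | exact: oner_neq0
  | apply/andP; split | rewrite oppr_eq0
  | apply: mulf_neq0 | apply: invr_neq0 | apply: expf_neq0 ].

Section ThetaSymbols.
Variables (K : fieldType) (th : K -> K) (q : K).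
Hypothesis th1 : th 1 = 0.
Hypothesis thV : forall x : K, x != 0 -> th x^-1 = - (x^-1 * th x).
Hypothesis q0 : q != 0.

Definition ep (a : K) (k : nat) : K := \prod_(0 <= i < k) th (a * q ^+ i).

Lemma qX0 k : q ^+ k != 0. Proof. exact: expf_neq0. Qed.

Lemma thV_eq0 x : x != 0 -> (th x^-1 == 0) = (th x == 0).
Proof. by move=> x0; rewrite thV // oppr_eq0 mulf_eq0 invr_eq0 (negbTE x0). Qed.

Lemma ep0 a : ep a 0 = 1. Proof. by rewrite /ep big_geq. Qed.

Lemma epSr a k : ep a k.+1 = ep a k * th (a * q ^+ k).
Proof. by rewrite /ep big_nat_recr. Qed.

Lemma epD a k l : ep a (k + l) = ep a k * ep (a * q ^+ k) l.
Proof.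
elim: l => [|l IH]; first by rewrite addn0 ep0 mulr1.
by rewrite addnS !epSr IH -!mulrA -exprD.
Qed.

Lemma epDC a k l : ep a (k + l) = ep a l * ep (a * q ^+ l) k.
Proof. by rewrite addnC epD. Qed.

Lemma epSl a k : ep a k.+1 = th a * ep (a * q) k.
Proof. by rewrite -add1n epD epSr ep0 mul1r expr0 mulr1 expr1. Qed.

Lemma ep_shift a k : ep (a * q) k * th a = ep a k * th (a * q ^+ k).
Proof. by rewrite mulrC -epSl epSr. Qed.

Lemma ep_neq0P a k :
  reflect (forall i, (i < k)%N -> th (a * q ^+ i) != 0) (ep a k != 0).
Proof.
apply: (iffP idP) => [|H].
  elim: k => [|k IH] // ; rewrite epSr mulf_eq0 negb_or => /andP[h1 h2] i.
  by rewrite ltnS leq_eqVlt => /predU1P[->|/(IH h1)].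
elim: k H => [|k IH] H; first by rewrite ep0 oner_eq0.
by rewrite epSr mulf_neq0 ?H ?IH // => i ik; apply: H; rewrite ltnW.
Qed.

Lemma ep_neq0_le a k l : (l <= k)%N -> ep a k != 0 -> ep a l != 0.
Proof.
move=> lk /ep_neq0P h; apply/ep_neq0P => i il.
by apply: h; apply: leq_trans lk.
Qed.

Lemma ep_eq0 a k i : (i < k)%N -> a * q ^+ i = 1 -> ep a k = 0.
Proof.
move=> ik ai; apply/eqP; apply: contraTT isT => /ep_neq0P /(_ i ik).
by rewrite ai th1 eqxx.
Qed.

(* The monomial produced by reversing a shifted factorial with the inversion
   formula for th. *)
Definition rev_monomial (x : K) (k : nat) : K := \prod_(0 <= i < k) - (x * q ^+ i)^-1.

Lemma rev_monomial_neq0 x k : x != 0 -> rev_monomial x k != 0.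
Proof.
move=> x0; rewrite /rev_monomial big_nat; elim/big_ind: _ => //.
- exact: oner_neq0.
- by move=> *; rewrite mulf_neq0.
- by move=> i _; rewrite oppr_eq0 invr_eq0 mulf_neq0 ?qX0.
Qed.

Lemma rev_monomial_scale x t k : rev_monomial (x * t) k = rev_monomial x k / t ^+ k.
Proof.
elim: k => [|k IH]; first by rewrite /rev_monomial !big_geq // expr0 divr1.
move: IH; rewrite /rev_monomial !big_nat_recr //= => ->.
rewrite exprS [x * t * _]mulrAC !invfM; ring.
Qed.

(** A product of two reversal monomials depends on x y alone, so the balancing condition, which only
    controls products of parameters, is enough to compare them. *)
Lemma rev_monomial_mul x y k : rev_monomial x k * rev_monomial y k = rev_monomial (x * y) k * rev_monomial 1 k.
Proof.
rewrite /rev_monomial -!big_split /=; apply: eq_bigr => i _.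
rewrite mul1r !invfM; ring.
Qed.

Lemma ep_rev x k : x != 0 -> ep (q / (q ^+ k * x)) k = rev_monomial x k * ep x k.
Proof.
move=> x0; rewrite /ep /rev_monomial big_nat_rev -big_split /= !big_nat.
apply: eq_bigr => i /andP[_ ik]; rewrite add0n.
have -> : q / (q ^+ k * x) * q ^+ (k - i.+1) = (x * q ^+ i)^-1.
  have -> : q ^+ k = q ^+ (k - i.+1) * q ^+ i * q.
    by rewrite -exprD -exprSr; congr (_ ^+ _); lia.
  by field; nz.
by rewrite thV ?mulf_neq0 ?qX0 // mulNr.
Qed.

(** * Factors attached to one string z_k, ..., z_k q^m_k or to a pair of strings *)

Section Strings.
Variables (a : K).
Hypothesis a0 : a != 0.

Definition poch_ratio (r x : K) (y : nat) : K := ep (r * x) y / ep (a * q * x / r) y.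

Lemma poch_ratio0 r x : poch_ratio r x 0 = 1. Proof. by rewrite /poch_ratio !ep0 divr1. Qed.

(** All that couples two different strings: the Vandermonde quotient, the quotient of theta(a z_j
    z_k), and both entries (j, k) and (k, j) of the square product. Taking both entries together
    makes the factor symmetric. *)
Definition pair_factor (mj mk : nat) (zj zk : K) (yj yk : nat) : K :=
  (zj * q ^+ yj * th (zk * q ^+ yk / (zj * q ^+ yj)) / (zj * th (zk / zj))) *
  (th (a * zj * zk * q ^+ (yj + yk)) / th (a * zj * zk)) *
  (poch_ratio (q ^- mj / zj) zk yk * (ep (a * zj * zk) yk / ep (q * zk / zj) yk)) *
  (poch_ratio (q ^- mk / zk) zj yj * (ep (a * zk * zj) yj / ep (q * zj / zk) yj)).

Lemma pair_factor_sym mj mk zj zk yj yk : zj != 0 -> zk != 0 ->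
  pair_factor mj mk zj zk yj yk = pair_factor mk mj zk zj yk yj.
Proof.
move=> zj0 zk0; rewrite /pair_factor.
rewrite [(yk + yj)%N]addnC [a * zk * zj]mulrAC.
have -> : zj / zk = (zk / zj)^-1 by rewrite invf_div.
have -> : zj * q ^+ yj / (zk * q ^+ yk) = (zk * q ^+ yk / (zj * q ^+ yj))^-1.
  by rewrite invf_div.
rewrite !thV ?mulf_neq0 ?invr_eq0 ?mulf_neq0 ?qX0 //.
set A := th (_ / _); set B := th (_ / _).
have -> : zk * q ^+ yk * - ((zk * q ^+ yk / (zj * q ^+ yj))^-1 * A) /
    (zk * - ((zk / zj)^-1 * B)) = zj * q ^+ yj * A / (zj * B).
  (* If B = 0 both sides are 0, since the inverse of 0 is 0. *)
  have [->|B0] := eqVneq B 0; first by rewrite !(mulr0, oppr0, invr0).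
  by field; nz.
by ring.
Qed.

Definition string_factor (m : nat) (c d e z : K) (y : nat) : K :=
  th (a * z * z * q ^+ (y + y)) / th (a * z * z) *
  (poch_ratio (q ^- m / z) z y * (ep (a * z * z) y / ep (q * z / z) y)) *
  poch_ratio c z y * poch_ratio d z y * poch_ratio e z y * q ^+ y.

Lemma string_factor_y0 m c d e z : th (a * z * z) != 0 -> string_factor m c d e z 0 = 1.
Proof.
by move=> h; rewrite /string_factor /poch_ratio addn0 !ep0 !expr0 !mulr1 !invr1 !mulr1 divff.
Qed.

(** A string of length 0 decouples from the others: by [ep_shift] the theta quotients cancel the
    shifts by q between the numerator and denominator factorials. *)
Lemma pair_factor_y0 mj zj zk yj : zj != 0 -> zk != 0 ->
  th (zk / zj) != 0 -> th (a * zj * zk) != 0 ->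
  ep (a * q * zj * zk) yj != 0 -> ep (q * zj / zk) yj != 0 ->
  pair_factor mj 0 zj zk yj 0 = 1.
Proof.
move=> zj0 zk0 h1 h2 h3 h4; rewrite /pair_factor /poch_ratio !expr0 !ep0 !(invr1, mulr1, addn0, div1r).
have -> : a * q * zj / zk^-1 = a * zj * zk * q by rewrite invrK; ring.
have e1 := ep_shift (a * zj * zk) yj.
have e2 := ep_shift (zj / zk) yj.
have -> : zk^-1 * zj = zj / zk by rewrite mulrC.
have -> : a * zk * zj = a * zj * zk by ring.
have E1 : a * q * zj * zk = a * zj * zk * q by ring.
have E2 : q * zj / zk = zj / zk * q by field; nz.
rewrite E1 in h3; rewrite E2 in h4 *.
have h1' : th (zj / zk) != 0.
  by rewrite -[zj / zk]invrK invf_div thV_eq0 //; nz.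
have -> : zk / (zj * q ^+ yj) = (zj / zk * q ^+ yj)^-1.
  by field; nz.
have E3 : zk / zj = (zj / zk)^-1 by rewrite invf_div.
rewrite E3 !thV //; [|nz..].
have e1' : ep (a * zj * zk) yj * th (a * zj * zk * q ^+ yj) /
   (ep (a * zj * zk * q) yj * th (a * zj * zk)) = 1.
  by rewrite e1 divff // -e1; nz.
have e2' : ep (zj / zk) yj * th (zj / zk * q ^+ yj) /
   (ep (zj / zk * q) yj * th (zj / zk)) = 1.
  by rewrite e2 divff // -e2; nz.
rewrite -[RHS](mulr1 1) -{1}e1' -e2'.
by field; nz.
Qed.

Definition flip_pair (mj mu : nat) (zj zk : K) : K :=
  th (zk / zj * q ^+ mu) / th (zk / zj) *
  (th (a * zj * zk * q ^+ mu) / th (a * zj * zk)) *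
  (poch_ratio (q ^- mj / zj) zk mu * (ep (a * zj * zk) mu / ep (q * zk / zj) mu)).

(** With y_k frozen at m_k = mu, the factor of b = a q^mu z_k on string j cancels against the
    coupling with string k, by [ep_shift] for Y and W. There remains (a z_j z_k)_y / (q z_j /
    z_k)_y, the factor of the new parameter b = a z_k, up to the constant [flip_pair]. *)
Lemma pair_factor_flip mj mu zj zk y : zj != 0 -> zk != 0 ->
  th (zk / zj) != 0 -> th (a * zj * zk) != 0 ->
  th (a * zj * zk * q ^+ (mu + y)) != 0 -> th (zj / zk * q ^+ y / q ^+ mu) != 0 ->
  ep (a * q * zj * zk * q ^+ mu) y != 0 -> ep (q * zj / zk / q ^+ mu) y != 0 ->
  poch_ratio (a * q ^+ mu * zk) zj y * pair_factor mj mu zj zk y mu =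
  flip_pair mj mu zj zk * poch_ratio (a * zk) zj y.
Proof.
move=> zj0 zk0 h1 h2 h3 h4 h5 h6; rewrite /pair_factor /flip_pair.
set P := poch_ratio (q ^- mj / zj) zk mu * _; rewrite [(y + mu)%N]addnC exprD.
rewrite /poch_ratio.
pose Y := a * zj * zk * q ^+ mu; pose W := zj / zk / q ^+ mu.
have e1 := ep_shift Y y; have e2 := ep_shift W y.
have -> : a * q * zj / (q ^- mu / zk) = Y * q by rewrite /Y; field; nz.
have -> : a * q ^+ mu * zk * zj = Y by rewrite /Y; ring.
have -> : a * q * zj / (a * q ^+ mu * zk) = W * q by rewrite /W; field; nz.
have -> : q ^- mu / zk * zj = W by rewrite /W; field; nz.
have -> : a * q * zj / (a * zk) = q * zj / zk by field; nz.
have -> : a * zj * zk * (q ^+ mu * q ^+ y) = Y * q ^+ y by rewrite /Y; ring.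
have -> : a * zj * zk * q ^+ mu = Y by [].
have -> : zk * q ^+ mu / (zj * q ^+ y) = (W * q ^+ y)^-1 by rewrite /W; field; nz.
have -> : zk / zj * q ^+ mu = W^-1 by rewrite /W; field; nz.
have W0 : W != 0 by rewrite /W; nz.
rewrite !thV //; [|nz..].
have eY : a * zj * zk * q ^+ (mu + y) = Y * q ^+ y by rewrite /Y exprD; ring.
have eW : zj / zk * q ^+ y / q ^+ mu = W * q ^+ y by rewrite /W; ring.
rewrite eY in h3; rewrite eW in h4.
have eYq : a * q * zj * zk * q ^+ mu = Y * q by rewrite /Y; ring.
have eWq : q * zj / zk / q ^+ mu = W * q by rewrite /W; ring.
rewrite eYq in h5; rewrite eWq in h6.
have -> : ep Y y = ep (Y * q) y * th Y / th (Y * q ^+ y).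
  by rewrite e1; field; nz.
have -> : ep W y = ep (W * q) y * th W / th (W * q ^+ y).
  by rewrite e2; field; nz.
move: (ep (a * zk * zj) y / _) h3 h4 h5 h6 => S.
by move: P W Y W0 {e1 e2 eY eW eYq eWq} => P W Y W0 h3 h4 h5 h6; field; nz.
Qed.

Lemma poch_ratio_out m z y : z != 0 -> (m < y)%N -> poch_ratio (q ^- m / z) z y = 0.
Proof.
move=> z0 my; rewrite /poch_ratio (@ep_eq0 _ _ m) ?mul0r //.
by rewrite mulrVK ?unitfE // mulVf ?qX0.
Qed.

Definition closed_string (m : nat) (b c d e z : K) : K :=
  ep (a * q * z * z) m /
  (ep (a * q * z / b) m * ep (a * q * z / c) m * ep (a * q * z / d) m *
   ep (q ^- m * e / (a * z)) m).

Definition closed_pair (mj mk : nat) (zj zk : K) : K :=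
  ep (a * q * zj * zk) mj * ep (a * q * zj * zk) mk /
  ep (a * q * zj * zk) (mj + mk).

Definition closed_total (M : nat) (b c d : K) : K :=
  ep (a * q / (b * c)) M * ep (a * q / (b * d)) M * ep (a * q / (c * d)) M.

Lemma closed_pair_sym mj mk zj zk : closed_pair mj mk zj zk = closed_pair mk mj zk zj.
Proof. by rewrite /closed_pair [a * q * zk * zj]mulrAC addnC [ep _ mk * _]mulrC. Qed.

(* The closed form is unchanged when (m_k, b) = (mu, q^-i / zk) is replaced by
   (i, q^-mu / zk): the part that involves a string j other than k. *)
Lemma closed_swap_off mj mu i zj zk c d e : zj != 0 -> zk != 0 -> 
  (i <= mu)%N -> ep (a * q * zj * zk) (mu + mj) != 0 ->
  closed_string mj (q ^- i / zk) c d e zj * closed_pair mj mu zj zk =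
  closed_string mj (q ^- mu / zk) c d e zj * closed_pair mj i zj zk.
Proof.
move=> zj0 zk0 imu h; rewrite /closed_string /closed_pair ![(mj + _)%N]addnC.
have hi : ep (a * q * zj * zk) (i + mj) != 0.
  by apply: ep_neq0_le h; rewrite leq_add2r.
have -> : a * q * zj / (q ^- i / zk) = a * q * zj * zk * q ^+ i by field; nz.
have -> : a * q * zj / (q ^- mu / zk) = a * q * zj * zk * q ^+ mu by field; nz.
move: h hi; rewrite !epD !mulf_eq0 !negb_or => /andP[h1 h2] /andP[h3 h4].
move: (ep (a * q * zj / c) mj) (ep (a * q * zj / d) mj)
  (ep (q ^- mj * e / (a * zj)) mj) => C D E.
rewrite !invfM; move: C^-1 D^-1 E^-1 => iC iD iE.
by field; nz.
Qed.

(** By the balancing condition a q / (c d) = q^-i e / (q^M a z). Hence the last mu - i factors of (a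
    q / c d)_M are the first mu - i factors of (q^-mu e / a z)_mu; after cancellation the factorial
    belonging to m_k = i is left. *)
Lemma closed_swap_diag M M' mu i z c d e : z != 0 -> c != 0 -> d != 0 -> e != 0 ->
  (i <= mu)%N -> (M' + mu = M + i)%N ->
  a ^+ 2 * q ^+ M.+1 = q ^- i / z * c * d * e ->
  ep (a * q * z * z) (i + mu) != 0 ->
  ep (a * q * z / c) mu != 0 -> ep (a * q * z / d) mu != 0 ->
  ep (q ^- mu * e / (a * z)) mu != 0 ->
  closed_string mu (q ^- i / z) c d e z * closed_total M (q ^- i / z) c d =
  closed_string i (q ^- mu / z) c d e z * closed_total M' (q ^- mu / z) c d.
Proof.
move=> z0 c0 d0 e0 imu MM bal h hc hd he; rewrite /closed_string /closed_total.
have -> : a * q * z / (q ^- i / z) = a * q * z * z * q ^+ i by field; nz.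
have -> : a * q * z / (q ^- mu / z) = a * q * z * z * q ^+ mu by field; nz.
have -> : a * q / (q ^- i / z * c) = a * q * z / c * q ^+ i by field; nz.
have -> : a * q / (q ^- i / z * d) = a * q * z / d * q ^+ i by field; nz.
have -> : a * q / (q ^- mu / z * c) = a * q * z / c * q ^+ mu by field; nz.
have -> : a * q / (q ^- mu / z * d) = a * q * z / d * q ^+ mu by field; nz.
have hcd X : ep X i * ep (X * q ^+ i) M = ep X mu * ep (X * q ^+ mu) M'.
  by rewrite -!epD addnC -MM addnC.
have h' := h; rewrite addnC in h'; move: h h'; rewrite !epD !mulf_eq0 !negb_or.
move=> /andP[h1 h2] /andP[h3 h4].
have hh' : ep (a * q * z * z) i * ep (a * q * z * z * q ^+ i) mu =
   ep (a * q * z * z) mu * ep (a * q * z * z * q ^+ mu) i.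
  by rewrite -!epD addnC.
have hci := ep_neq0_le imu hc; have hdi := ep_neq0_le imu hd.
have eV : a * q / (c * d) = q ^- i * e / (q ^+ M * (a * z)).
  have -> : e = a ^+ 2 * q ^+ M.+1 / (q ^- i / z * c * d).
    by rewrite bal; field; nz.
  by rewrite [q ^+ _.+1]exprS; field; nz.
set V := a * q / (c * d) in eV *.
have M'E : (M = M' + (mu - i))%N by clear -MM imu; lia.
have muE : (mu = (mu - i) + i)%N by rewrite subnK.
have -> : ep V M = ep V M' * ep (q ^- mu * e / (a * z)) (mu - i).
  rewrite {1}M'E epD; congr (_ * ep _ _); rewrite eV.
  have qE : q ^+ M * q ^+ i = q ^+ M' * q ^+ mu by rewrite -!exprD MM.
  have -> : q ^- i * e / (q ^+ M * (a * z)) * q ^+ M' =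
     e * q ^+ M' / (q ^+ M * q ^+ i * (a * z)) by field; nz.
  by rewrite qE; field; nz.
have eW : ep (q ^- mu * e / (a * z)) mu =
    ep (q ^- mu * e / (a * z)) (mu - i) * ep (q ^- i * e / (a * z)) i.
  rewrite {2}muE epD; congr (_ * ep _ _).
  by rewrite {1}muE exprD; field; nz.
rewrite eW in he *; move: he; rewrite mulf_eq0 negb_or => /andP[he1 he2].
have := hcd (a * q * z / d); have := hcd (a * q * z / c).
move: (ep (a * q * z / c * q ^+ i) M) (ep (a * q * z / d * q ^+ i) M)
  (ep (a * q * z / c * q ^+ mu) M') (ep (a * q * z / d * q ^+ mu) M') => x1 x2 x3 x4.
move=> /(canRL (mulKf hci)) -> /(canRL (mulKf hdi)) ->.
move: hh' => /(canRL (mulKf h1)) ->.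
by field; nz.
Qed.

(* Replacing (m_k, b) = (mu, a q^mu zk) by (0, a zk) in the closed form: the part
   that involves a string j other than k. *)
Lemma closed_flip_off mj mu zj zk c d e : zj != 0 -> zk != 0 ->
  th (zk / zj) != 0 -> th (a * zj * zk) != 0 ->
  ep (a * q * zj * zk) (mj + mu) != 0 -> ep (q * zk / zj) mu != 0 ->
  ep (q * zj / zk) mj != 0 -> ep (q * zj / zk / q ^+ mu) mj != 0 ->
  flip_pair mj mu zj zk * (closed_string mj (a * zk) c d e zj * closed_pair mj 0 zj zk) =
  q ^- (mu * mj) *
    (closed_string mj (a * q ^+ mu * zk) c d e zj * closed_pair mj mu zj zk).
Proof.
move=> zj0 zk0; rewrite /flip_pair /closed_string /closed_pair /poch_ratio addn0 ep0 mulr1.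
set X := zk / zj; set Y := a * zj * zk => hX hY.
have X0 : X != 0 by rewrite /X; nz.
have -> : a * q * zj / (a * zk) = q / X by rewrite /X; field; nz.
have -> : a * q * zj / (a * q ^+ mu * zk) = q / X / q ^+ mu by rewrite /X; field; nz.
have -> : q * zj / zk / q ^+ mu = q / X / q ^+ mu by rewrite /X; field; nz.
have -> : q ^- mj / zj * zk = X / q ^+ mj by rewrite /X; field; nz.
have -> : a * q * zj * zk = Y * q by rewrite /Y; ring.
have -> : a * q * zk / (q ^- mj / zj) = Y * q * q ^+ mj by rewrite /Y; field; nz.
have -> : q * zk / zj = X * q by rewrite /X; ring.
have -> : q * zj / zk = q / X by rewrite /X; field; nz.
rewrite epD mulf_eq0 negb_or => /andP[h1 h2] h3.
have e1 := ep_shift X mu; have e2 := ep_shift Y mu.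
have -> : q / X = q / (q ^+ mj * (X / q ^+ mj)) by field; nz.
have -> : q / (q ^+ mj * (X / q ^+ mj)) / q ^+ mu =
   q / (q ^+ mj * (X / q ^+ mj * q ^+ mu)) by field; nz.
rewrite !ep_rev; [|nz..].
have W0 : X / q ^+ mj != 0 by nz.
rewrite [rev_monomial (_ * q ^+ mu) _]rev_monomial_scale -exprM.
have e3 : ep (X / q ^+ mj) mj * ep X mu =
    ep (X / q ^+ mj) mu * ep (X / q ^+ mj * q ^+ mu) mj.
  by rewrite -epD addnC epD; congr (_ * ep _ _); field; nz.
have m0 := rev_monomial_neq0 mj W0.
rewrite !mulf_eq0 !negb_or invr_eq0 => /andP[_ h4] /andP[_ h5].
have : ep X mu * th (X * q ^+ mu) != 0 by rewrite -e1; nz.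
rewrite mulf_eq0 negb_or => /andP[h6 h7].
have -> : th (X * q ^+ mu) = ep (X * q) mu * th X / ep X mu by rewrite e1; field; nz.
have -> : ep (Y * q) mu = ep Y mu * th (Y * q ^+ mu) / th Y by rewrite -e2; field; nz.
have -> : ep X mu = ep (X / q ^+ mj) mu * ep (X / q ^+ mj * q ^+ mu) mj /
    ep (X / q ^+ mj) mj by rewrite -e3; field; nz.
have h8 : ep (X / q ^+ mj) mu != 0.
  have : ep (X / q ^+ mj) mj * ep X mu != 0 by nz.
  by rewrite e3 mulf_eq0 negb_or => /andP[].
rewrite [(mu * mj)%N]mulnC.
move: (ep (X / q ^+ mj) mu) (ep (X / q ^+ mj * q ^+ mu) mj) (ep (X / q ^+ mj) mj)
  (rev_monomial _ _) (ep (X * q) mu) (ep Y mu) (ep (Y * q) mj) (ep (Y * q * q ^+ mj) mu)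
  (th (Y * _)) (q ^+ (mj * mu)) (qX0 (mj * mu)) h1 h2 h3 h4 h5 h8 m0.
move=> x1 x2 x3 x4 x5 x6 x7 x8 x9 x10 k1 k2 k3 k4 k5 k6 k7 k8.
move: (ep (a * q * zj / c) mj) (ep (a * q * zj / d) mj)
  (ep (q ^- mj * e / (a * zj)) mj) => C D E.
rewrite !invfM; move: C^-1 D^-1 E^-1 => iC iD iE.
by field; nz.
Qed.

(** Here [M] stands for |m| - m_k, and the hypothesis on a q^(M+1) is the balancing condition at b =
    a q^mu z divided by a q^mu. Reversing the factorials leaves monomials that this condition
    reduces to q^(mu M), which cancels the powers q^-(mu m_j) contributed by the other strings in
    [closed_flip_off]. *)
Lemma closed_flip_diag M mu z c d e : z != 0 -> c != 0 -> d != 0 -> e != 0 ->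
  a * q ^+ M.+1 = z * c * d * e ->
  th (a * z * z) != 0 -> ep (a * q * z * z) (mu + mu) != 0 -> ep q mu != 0 ->
  ep (a * q * z / c) mu != 0 -> ep (a * q * z / d) mu != 0 ->
  ep (a * q * z / e) mu != 0 ->
  string_factor mu c d e z mu * ep (a * q ^+ mu * z * z) mu * closed_total M (a * z) c d =
  q ^+ (mu * M) * (ep (a * q * z * z) mu / (ep (a * q * z / c) mu *
    ep (a * q * z / d) mu * ep (q ^- mu * e / (a * z)) mu) *
  closed_total (mu + M) (a * q ^+ mu * z) c d).
Proof.
move=> z0 c0 d0 e0 bal hZ; rewrite /string_factor /closed_total /poch_ratio.
set Z := a * z * z in hZ *.
have -> : a * q * z * z = Z * q by rewrite /Z; ring.
have -> : a * q ^+ mu * z * z = Z * q ^+ mu by rewrite /Z; ring.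
have -> : a * q * z / (q ^- mu / z) = Z * q * q ^+ mu by rewrite /Z; field; nz.
have -> : q ^- mu / z * z = q / (q ^+ mu * q) by field; nz.
have -> : q * z / z = q by field; nz.
have -> : q ^- mu * e / (a * z) = q / (q ^+ mu * (a * q * z / e)) by field; nz.
have -> : a * q / (a * z * c) = q / (z * c) by field; nz.
have -> : a * q / (a * z * d) = q / (z * d) by field; nz.
have -> : a * q / (a * q ^+ mu * z * c) = q / (q ^+ mu * (c * z)) by field; nz.
have -> : a * q / (a * q ^+ mu * z * d) = q / (q ^+ mu * (d * z)) by field; nz.
rewrite [ep (a * q / (c * d)) (mu + M)]epDC.
have -> : a * q / (c * d) * q ^+ M = e * z.
  have -> : e = a * q ^+ M.+1 / (z * c * d) by rewrite bal; field; nz.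
  by rewrite exprS; field; nz.
rewrite [ep (q / (_ * (c * z))) (mu + M)]epD [ep (q / (_ * (d * z))) (mu + M)]epD.
have -> : q / (q ^+ mu * (c * z)) * q ^+ mu = q / (z * c) by field; nz.
have -> : q / (q ^+ mu * (d * z)) * q ^+ mu = q / (z * d) by field; nz.
rewrite !ep_rev; [|nz..].
rewrite [ep (Z * q) (mu + mu)]epD mulf_eq0 negb_or => /andP[h1 h2] h3 h4 h5 h6.
have eZ : ep Z mu * ep (Z * q ^+ mu) mu * th (Z * q ^+ (mu + mu)) =
    ep (Z * q) mu * ep (Z * q * q ^+ mu) mu * th Z.
  by rewrite -!epD ep_shift.
have eM : rev_monomial q mu * rev_monomial (a * q * z / e) mu * q ^+ mu =
    q ^+ (mu * M) * (rev_monomial (c * z) mu * rev_monomial (d * z) mu).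
  rewrite [rev_monomial q mu * _]rev_monomial_mul [rev_monomial (c * z) mu * _]rev_monomial_mul.
  have -> : c * z * (d * z) = q * (a * q * z / e) * (q ^+ M / q).
    transitivity (z * (a * q ^+ M.+1) / e); first by rewrite bal; field; nz.
    by rewrite exprS; field; nz.
  by rewrite [rev_monomial (_ * (q ^+ M / q)) _]rev_monomial_scale expr_div_n -exprM mulnC; field; nz.
have m1 : rev_monomial (a * q * z / e) mu != 0 by apply: rev_monomial_neq0; nz.
have -> : rev_monomial q mu = q ^+ (mu * M) * (rev_monomial (c * z) mu * rev_monomial (d * z) mu) /
   (rev_monomial (a * q * z / e) mu * q ^+ mu) by rewrite -eM; field; nz.
transitivity (ep Z mu * ep (Z * q ^+ mu) mu * th (Z * q ^+ (mu + mu)) /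
  (th Z * ep (Z * q * q ^+ mu) mu) *
  (q ^+ (mu * M) * (rev_monomial (c * z) mu * rev_monomial (d * z) mu) /
    rev_monomial (a * q * z / e) mu * (ep (c * z) mu / ep (a * q * z / c) mu) *
    (ep (d * z) mu / ep (a * q * z / d) mu) *
    (ep (e * z) mu / ep (a * q * z / e) mu)) *
  (ep (q / (z * c)) M * ep (q / (z * d)) M * ep (a * q / (c * d)) M)).
  by field; nz.
by rewrite eZ; field; nz.
Qed.

(** * The sum and its closed form *)

Section Sums.
Variables (n : nat) (z : 'I_n -> K).
Hypothesis z0 : forall k, z k != 0.
Implicit Types (m y : 'I_n -> nat).

Definition poch_ratios (r : K) y : K := \prod_(k < n) poch_ratio r (z k) (y k).

Definition base_term y : K :=
  (\prod_(j < n) \prod_(k < n | (j < k)%N)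
     (z j * q ^+ y j * th (z k * q ^+ y k / (z j * q ^+ y j)) /
        (z j * th (z k / z j)))) *
  (\prod_(j < n) \prod_(k < n | (j <= k)%N)
     (th (a * z j * z k * q ^+ (y j + y k)) / th (a * z j * z k))) *
  (\prod_(j < n) \prod_(k < n)
     (ep (a * z j * z k) (y k) / ep (q * z k / z j) (y k))) *
  q ^+ (\sum_(k < n) y k).

(** The factors of b are left arbitrary because at b = a q^m_k z_k the factor on string k is a
    cleared numerator and no longer a [poch_ratio]. *)
Definition term_with m (B : 'I_n -> K) (c d e : K) y : K :=
  base_term y * (\prod_(j < n) poch_ratios (q ^- m j / z j) y) *
  (\prod_(k < n) B k) * poch_ratios c y * poch_ratios d y * poch_ratios e y.

Definition term m (b c d e : K) y : K :=
  base_term y * (\prod_(j < n) poch_ratios (q ^- m j / z j) y) *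
  poch_ratios b y * poch_ratios c y * poch_ratios d y * poch_ratios e y.

Lemma term_withE m b c d e y :
  term m b c d e y = term_with m (fun k => poch_ratio b (z k) (y k)) c d e y.
Proof. by []. Qed.

Lemma term_with_pairs m B c d e y :
  term_with m B c d e y =
  (\prod_(k < n) (string_factor (m k) c d e (z k) (y k) * B k)) *
  \prod_(j < n) \prod_(k < n | (j < k)%N)
     pair_factor (m j) (m k) (z j) (z k) (y j) (y k).
Proof.
rewrite /term_with /base_term /poch_ratios -prodrXr /string_factor /pair_factor.
rewrite prod_triangle_diag !prod_square_triangle.
have sp2 F G : \prod_(j < n) \prod_(k < n | (j < k)%N) (F j k * G j k) =
   (\prod_(j < n) \prod_(k < n | (j < k)%N) F j k) *
   \prod_(j < n) \prod_(k < n | (j < k)%N) (G j k) :> K.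
  by rewrite -big_split /=; apply: eq_bigr => j _; rewrite big_split.
rewrite !sp2 !big_split /=.
ring.
Qed.

Lemma term_with_split m B c d e y k :
  term_with m B c d e y =
  (string_factor (m k) c d e (z k) (y k) * B k) *
  (\prod_(j < n | j != k) (string_factor (m j) c d e (z j) (y j) *
     (B j * pair_factor (m j) (m k) (z j) (z k) (y j) (y k)))) *
  \prod_(j < n | j != k) \prod_(l < n | (l != k) && (j < l)%N)
     pair_factor (m j) (m l) (z j) (z l) (y j) (y l).
Proof.
rewrite term_with_pairs (prod_triangle_split k); last first.
  by move=> j l _; apply: pair_factor_sym.
under [X in _ = _ * X * _]eq_bigr do rewrite mulrA.
rewrite (bigD1 k) //= [X in _ = _ * X * _]big_split /=; ring.
Qed.

Definition upd m (k : 'I_n) (i : nat) : 'I_n -> nat := fun j => if j == k then i else m j.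

Lemma updE m k i : upd m k i k = i. Proof. by rewrite /upd eqxx. Qed.

Lemma updN m k i j : j != k -> upd m k i j = m j.
Proof. by rewrite /upd => /negbTE->. Qed.

Lemma sum_upd m k i : (\sum_(j < n) upd m k i j + m k = \sum_(j < n) m j + i)%N.
Proof.
rewrite (bigD1 k) //= updE [X in (_ = X + _)%N](bigD1 k) //=.
rewrite (eq_bigr m); first by lia.
by move=> j; apply: updN.
Qed.

Lemma term_swap m k i c d e y :
  term m (q ^- i / z k) c d e y = term (upd m k i) (q ^- m k / z k) c d e y.
Proof.
rewrite /term (bigD1 k) //= [in RHS](bigD1 k) //= updE.
rewrite [in RHS](eq_bigr (fun j => poch_ratios (q ^- m j / z j) y)); first by ring.
by move=> j jk; rewrite updN.
Qed.

Lemma term_out m b c d e y k : (m k < y k)%N -> term m b c d e y = 0.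
Proof.
move=> mk; rewrite /term [\prod_(j < n) _](bigD1 k) //= {1}/poch_ratios (bigD1 k) //=.
by rewrite poch_ratio_out // !(mul0r, mulr0).
Qed.

Definition closed_form m (b c d e : K) : K :=
  (\prod_(k < n) closed_string (m k) b c d e (z k)) *
  (\prod_(j < n) \prod_(k < n | (j < k)%N) closed_pair (m j) (m k) (z j) (z k)) *
  closed_total (\sum_(k < n) m k) b c d.

Lemma closed_pair_split m k :
  \prod_(j < n) \prod_(l < n | (j < l)%N) closed_pair (m j) (m l) (z j) (z l) =
  (\prod_(j < n | j != k) closed_pair (m j) (m k) (z j) (z k)) *
  \prod_(j < n | j != k) \prod_(l < n | (l != k) && (j < l)%N)
     closed_pair (m j) (m l) (z j) (z l).
Proof. by rewrite (prod_triangle_split k) // => j l _; apply: closed_pair_sym. Qed.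

Lemma closed_pair_rest_upd m k i :
  \prod_(j < n | j != k) \prod_(l < n | (l != k) && (j < l)%N)
     closed_pair (upd m k i j) (upd m k i l) (z j) (z l) =
  \prod_(j < n | j != k) \prod_(l < n | (l != k) && (j < l)%N)
     closed_pair (m j) (m l) (z j) (z l).
Proof.
apply: eq_bigr => j jk; apply: eq_bigr => l /andP[lk _].
by rewrite !updN.
Qed.

Lemma closed_form_split m k b c d e :
  closed_form m b c d e =
  (closed_string (m k) b c d e (z k) * closed_total (\sum_(j < n) m j) b c d) *
  (\prod_(j < n | j != k)
     (closed_string (m j) b c d e (z j) * closed_pair (m j) (m k) (z j) (z k))) *
  \prod_(j < n | j != k) \prod_(l < n | (l != k) && (j < l)%N)
     closed_pair (m j) (m l) (z j) (z l).
Proof.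
rewrite /closed_form (closed_pair_split m k) (bigD1 k) //= [in RHS]big_split /=.
ring.
Qed.

Lemma closed_form_swap m k i c d e :
  c != 0 -> d != 0 -> e != 0 -> (i <= m k)%N ->
  a ^+ 2 * q ^+ (\sum_(j < n) m j).+1 = q ^- i / z k * c * d * e ->
  (forall j l, ep (a * q * z j * z l) (m j + m l) != 0) ->
  ep (a * q * z k / c) (m k) != 0 -> ep (a * q * z k / d) (m k) != 0 ->
  ep (q ^- m k * e / (a * z k)) (m k) != 0 ->
  closed_form m (q ^- i / z k) c d e =
  closed_form (upd m k i) (q ^- m k / z k) c d e.
Proof.
move=> c0 d0 e0 im bal hA hc hd he.
rewrite !(@closed_form_split _ k) closed_pair_rest_upd updE; congr (_ * _ * _).
  apply: closed_swap_diag => //; first exact: sum_upd.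
  by apply: ep_neq0_le (hA k k); rewrite leq_add2r.
apply: eq_bigr => j jk; rewrite updN //.
apply: closed_swap_off => //.
by rewrite addnC.
Qed.

(** The conditions free of b, c, d, e. They pass to smaller m, keep the denominators in a and z
    nonzero, and separate the nodes q^-i / z_k from each other and their inverses from a q^m_k z_k
    up to zeros of theta. *)
Definition strings_generic m := [/\
  forall j k s t, j != k -> (s <= m j)%N -> (t <= m k)%N ->
    th (z j / z k * q ^+ s / q ^+ t) != 0,
  forall k, ep q (m k) != 0,
  forall j k, th (a * z j * z k) != 0 &
  forall j k, ep (a * q * z j * z k) (m j + m k) != 0].

Lemma strings_generic_le m m' : (forall k, (m' k <= m k)%N) ->
  strings_generic m -> strings_generic m'.
Proof.
move=> mm [h1 h2 h3 h4]; split=> //.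
- by move=> j k s t jk sj tk; apply: h1 => //; apply: leq_trans (mm _).
- by move=> k; apply: ep_neq0_le (h2 k).
- by move=> j k; apply: ep_neq0_le (h4 j k); apply: leq_add.
Qed.

Lemma upd_le m k i : (i <= m k)%N -> forall j, (upd m k i j <= m j)%N.
Proof.
by move=> im j; rewrite /upd; case: eqP => [->|].
Qed.

Lemma strings_epz m j k s : strings_generic m -> j != k -> (s <= m k)%N ->
  ep (q * z j / z k / q ^+ s) (m j) != 0.
Proof.
case=> h1 _ _ _ jk sk; apply/ep_neq0P => i im.
have -> : q * z j / z k / q ^+ s * q ^+ i = z j / z k * q ^+ i.+1 / q ^+ s.
  by rewrite exprS; field; nz.
exact: h1.
Qed.

Lemma pair_factor_rest_upd m y k i i' :
  \prod_(j < n | j != k) \prod_(l < n | (l != k) && (j < l)%N)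
     pair_factor (upd m k i j) (upd m k i l) (z j) (z l) (upd y k i' j) (upd y k i' l) =
  \prod_(j < n | j != k) \prod_(l < n | (l != k) && (j < l)%N)
     pair_factor (m j) (m l) (z j) (z l) (y j) (y l).
Proof.
apply: eq_bigr => j jk; apply: eq_bigr => l /andP[lk _].
by rewrite !updN.
Qed.

Definition flip_factor m k c d e : K :=
  string_factor (m k) c d e (z k) (m k) * ep (a * q ^+ m k * z k * z k) (m k) *
  \prod_(j < n | j != k) flip_pair (m j) (m k) (z j) (z k).

(** On string k only the numerator (b z_k)_{m_k} of b is present: its vanishing denominator has been
    cleared. The other strings then see a string k of length 0 and the parameter b = a z_k. *)
Lemma term_flip m k c d e y : strings_generic m -> (0 < m k)%N -> y k = m k ->
  (forall j, (y j <= m j)%N) ->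
  term_with m (fun j => if j == k then ep (a * q ^+ m k * z k * z k) (m k)
                        else poch_ratio (a * q ^+ m k * z k) (z j) (y j)) c d e y =
  flip_factor m k c d e * term (upd m k 0) (a * z k) c d e (upd y k 0).
Proof.
move=> sg mk0 yk ym; have [h1 h2 h3 h4] := sg.
rewrite term_withE !(@term_with_split _ _ _ _ _ _ k) !updE eqxx yk.
rewrite string_factor_y0 // mul1r poch_ratio0 mul1r /flip_factor.
rewrite pair_factor_rest_upd.
rewrite mulrA; congr (_ * _); rewrite -[RHS]mulrA; congr (_ * _).
rewrite -big_split /=; apply: eq_bigr => j jk.
rewrite !updN // (negbTE jk).
have kj : k != j by rewrite eq_sym.
have thkj : th (z k / z j) != 0.
  by have := h1 k j 0%N 0%N kj isT isT; rewrite expr0 mulr1 divr1.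
have epjk : ep (a * q * z j * z k) (m k + y j) != 0.
  by apply: ep_neq0_le (h4 j k); rewrite addnC leq_add2r.
have epq : ep (q * z j / z k) (y j) != 0.
  have := @strings_epz m j k 0 sg jk isT; rewrite expr0 divr1.
  exact: ep_neq0_le.
rewrite pair_factor_y0 //; last by apply: ep_neq0_le epjk; rewrite leq_addl.
rewrite mulr1 pair_factor_flip //.
- ring.
(* Since m k > 0 the exponent is positive, and this theta is the factor of index m k + y j - 1 of a
   factorial that starts at a q z_j z_k. *)
- have -> : a * z j * z k * q ^+ (m k + y j) =
     a * q * z j * z k * q ^+ (m k + y j).-1.
    by rewrite -[(m k + y j)%N]prednK ?addn_gt0 ?mk0 // exprS; ring.
  move/ep_neq0P: epjk; apply.
  by rewrite prednK ?addn_gt0 ?mk0.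
- exact: h1.
- by move: epjk; rewrite epD mulf_eq0 negb_or => /andP[].
- by apply: ep_neq0_le (ym j) _; apply: strings_epz.
Qed.

(** The right-hand side is [closed_form m] at b = a q^m_k z_k with the factor (a q z_k / b)_{m_k},
    which contains theta(1), removed from the denominator. *)
Lemma closed_form_flip m k c d e : strings_generic m -> 
  c != 0 -> d != 0 -> e != 0 ->
  a ^+ 2 * q ^+ (\sum_(j < n) m j).+1 = a * q ^+ m k * z k * c * d * e ->
  ep (a * q * z k / c) (m k) != 0 -> ep (a * q * z k / d) (m k) != 0 ->
  ep (a * q * z k / e) (m k) != 0 ->
  flip_factor m k c d e * closed_form (upd m k 0) (a * z k) c d e =
  (ep (a * q * z k * z k) (m k) / (ep (a * q * z k / c) (m k) *
     ep (a * q * z k / d) (m k) * ep (q ^- m k * e / (a * z k)) (m k)) *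
   closed_total (\sum_(j < n) m j) (a * q ^+ m k * z k) c d) *
  (\prod_(j < n | j != k) (closed_string (m j) (a * q ^+ m k * z k) c d e (z j) *
     closed_pair (m j) (m k) (z j) (z k))) *
  \prod_(j < n | j != k) \prod_(l < n | (l != k) && (j < l)%N)
     closed_pair (m j) (m l) (z j) (z l).
Proof.
move=> sg c0 d0 e0 bal hc hd he; have [h1 h2 h3 h4] := sg.
rewrite (@closed_form_split _ k) closed_pair_rest_upd updE /flip_factor.
pose M' := (\sum_(j < n | j != k) m j)%N.
have ME : (\sum_(j < n) m j = m k + M')%N by rewrite (bigD1 k).
have -> : (\sum_(j < n) upd m k 0 j = M')%N.
  rewrite (bigD1 k) //= updE; apply: eq_bigr => j; exact: updN.
have offE : (\prod_(j < n | j != k) flip_pair (m j) (m k) (z j) (z k)) *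
    (\prod_(j < n | j != k) (closed_string (upd m k 0 j) (a * z k) c d e (z j) *
       closed_pair (upd m k 0 j) 0 (z j) (z k))) =
    q ^- (m k * M') *
    \prod_(j < n | j != k) (closed_string (m j) (a * q ^+ m k * z k) c d e (z j) *
     closed_pair (m j) (m k) (z j) (z k)).
  rewrite big_distrr /= -prodrXr -prodfV -!big_split /=.
  apply: eq_bigr => j jk; rewrite updN // closed_flip_off //.
  - have kj : k != j by rewrite eq_sym.
    by have := h1 k j 0%N 0%N kj isT isT; rewrite expr0 mulr1 divr1.
  - have := @strings_epz m k j 0 sg _ isT.
    by rewrite expr0 divr1; apply; rewrite eq_sym.
  - have := @strings_epz m j k 0 sg jk isT.
    by rewrite expr0 divr1.
  - exact: strings_epz.
have bal' : a * q ^+ M'.+1 = z k * c * d * e.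
  apply: (mulfI (mulf_neq0 a0 (qX0 (m k)))).
  transitivity (a ^+ 2 * q ^+ (m k + M').+1); last by rewrite -ME bal; ring.
  by rewrite -addnS exprD; ring.
have := @closed_flip_diag M' (m k) (z k) c d e (z0 k) c0 d0 e0 bal'
  (h3 k k) (h4 k k) (h2 k) hc hd he.
rewrite ME => diagE.
have qn : q ^+ (m k * M') != 0 by apply: qX0.
have -> : closed_string 0 (a * z k) c d e (z k) = 1.
  by rewrite /closed_string !ep0 !mulr1 divr1.
move: diagE offE.
set D := string_factor _ _ _ _ _ _; set F := ep (a * q ^+ m k * z k * z k) _.
set F1 := \prod_(j < n | _) flip_pair _ _ _ _; set F2 := \prod_(j < n | j != k) _.
set F3 := \prod_(j < n | j != k) (_ * _).
set F4 := \prod_(j < n | j != k) _.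
set T1 := closed_total _ _ _ _; set T2 := closed_total _ _ _ _.
move=> dE oE.
transitivity (D * F * T1 * (F1 * F2) * F4); first by ring.
rewrite dE oE; move: (ep _ _ / _) => Z.
by field; exact: qn.
Qed.

(** * The sum over a box and its version without denominators in b and c *)

Section BoundedSums.
Variable L : nat.
Local Notation Y := {ffun 'I_n -> 'I_L.+1}.

Definition bounded m (u : Y) : bool := [forall k, (u k <= m k)%N].

(* The summation range is a fixed box: the numerator factors make the terms
   outside of the box of m vanish. *)
Definition jackson_sum m (b c d e : K) : K :=
  \sum_(u : Y) term m b c d e (fun k => u k).

Lemma jackson_sum_bounded m b c d e :
  jackson_sum m b c d e = \sum_(u : Y | bounded m u) term m b c d e (fun k => u k).
Proof.
rewrite /jackson_sum (bigID (bounded m)) /= [X in _ + X]big1 ?addr0 //.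
by move=> u /forallPn[k]; rewrite -ltnNge => h; exact: term_out h.
Qed.

Lemma jackson_sum_swap m k i c d e :
  jackson_sum m (q ^- i / z k) c d e =
  jackson_sum (upd m k i) (q ^- m k / z k) c d e.
Proof. by apply: eq_bigr => u _; apply: term_swap. Qed.

Definition ffun_upd (u : Y) (k : 'I_n) (v : 'I_L.+1) : Y :=
  [ffun j => if j == k then v else u j].

Lemma ffun_updE u k v :
  (fun j => ffun_upd u k v j : nat) = upd (fun j => u j : nat) k v.
Proof. by apply: funext => j; rewrite ffunE /upd; case: eqP. Qed.

Lemma jackson_sum_flip m k c d e : strings_generic m -> (0 < m k)%N ->
  (forall j, (m j <= L)%N) ->
  \sum_(u : Y | bounded m u && (u k == m k :> nat))
    term_with m (fun j => if j == k then ep (a * q ^+ m k * z k * z k) (m k)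
                          else poch_ratio (a * q ^+ m k * z k) (z j) (u j)) c d e
      (fun j => u j) =
  flip_factor m k c d e * jackson_sum (upd m k 0) (a * z k) c d e.
Proof.
move=> sg mk0 mL; rewrite jackson_sum_bounded big_distrr /=.
have inordE : (inord (m k) : 'I_L.+1) = m k :> nat by rewrite inordK // ltnS.
(* The points with y_k = m_k correspond to the points of the box of [upd m k 0], by resetting
   coordinate k. *)
rewrite (reindex_onto (fun u => ffun_upd u k (inord (m k))) (fun u => ffun_upd u k ord0)) /=;
  last first.
  move=> u /andP[_ /eqP uk]; apply/ffunP => j; rewrite !ffunE.
  by case: eqP => // ->; apply: val_inj; rewrite /= inordE.
apply: eq_big => u.
  apply/idP/idP => [/andP[/andP[/forallP bu _] /eqP uE]|/forallP bu].
    apply/forallP => j; have := bu j; rewrite -uE !ffunE /upd.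
    by case: eqP.
  have uk : u k = ord0.
    by apply: val_inj; have := bu k; rewrite updE leqn0 => /eqP.
  apply/andP; split.
    rewrite ffunE eqxx inordE eqxx andbT; apply/forallP => j.
    rewrite ffunE; case: eqP => [->|/eqP jk]; first by rewrite inordE.
    by have := bu j; rewrite updN.
  apply/eqP/ffunP => j; rewrite !ffunE.
  by case: eqP => // ->.
move=> /andP[/andP[/forallP bu _] /eqP uE].
rewrite (_ : (fun j => u j : nat) =
  upd (fun j => ffun_upd u k (inord (m k)) j : nat) k 0); last first.
  by rewrite -[in LHS]uE ffun_updE.
apply: term_flip => //; by rewrite ffunE eqxx inordE.
Qed.

(** The factor of r multiplied by its largest denominator: the part (a q z_k / r)_{y_k} cancels and
    the remaining m_k - y_k factors move upstairs, so nothing is divided. *)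
Definition cleared m (r : K) y : K :=
  \prod_(k < n) (ep (r * z k) (y k) * ep (a * q * z k / r * q ^+ y k) (m k - y k)).

Definition denom m (r : K) : K := \prod_(k < n) ep (a * q * z k / r) (m k).

Lemma clearedE m r (u : Y) : bounded m u -> denom m r != 0 ->
  cleared m r (fun k => u k) = poch_ratios r (fun k => u k) * denom m r.
Proof.
move=> /forallP bu; rewrite /denom => /prodf_neq0 h.
rewrite /cleared /poch_ratios -big_split /=; apply: eq_bigr => k _.
have := h k isT; rewrite -{1 3}(subnKC (bu k)) !epD mulf_eq0 negb_or => /andP[h1 h2].
by rewrite /poch_ratio; field.
Qed.

(** With c = sg / b, this agrees with the sum times its denominators in b and c where these are
    nonzero, and keeps a meaning at the node where they vanish. *)
Definition sum_form m (sg d e b : K) : K :=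
  \sum_(u : Y | bounded m u)
    base_term (fun k => u k) * (\prod_(j < n) poch_ratios (q ^- m j / z j) (fun k => u k)) *
    poch_ratios d (fun k => u k) * poch_ratios e (fun k => u k) *
    (cleared m b (fun k => u k) * cleared m (sg / b) (fun k => u k)).

Lemma sum_formE m sg d e b : denom m b != 0 -> denom m (sg / b) != 0 ->
  sum_form m sg d e b =
  jackson_sum m b (sg / b) d e * (denom m b * denom m (sg / b)).
Proof.
move=> h1 h2; rewrite jackson_sum_bounded big_distrl /=.
apply: eq_bigr => u bu; rewrite !clearedE // /term; ring.
Qed.

Definition closed_const m (sg d e : K) : K :=
  (\prod_(k < n) (ep (a * q * z k * z k) (m k) /
     (ep (a * q * z k / d) (m k) * ep (q ^- m k * e / (a * z k)) (m k)))) *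
  (\prod_(j < n) \prod_(k < n | (j < k)%N) closed_pair (m j) (m k) (z j) (z k)) *
  ep (a * q / sg) (\sum_(k < n) m k).

(** Once the denominators are cleared, b remains only in (a q / b d)_{|m|} (a q / c d)_{|m|}: |m|
    pairs, the same degree as for the sum. *)
Definition closed_eval m (sg d e b : K) : K :=
  closed_const m sg d e *
  (ep (a * q / d / b) (\sum_(k < n) m k) *
   ep (a * q / d / (sg / b)) (\sum_(k < n) m k)).

Lemma closed_evalE m sg d e b : b != 0 -> sg != 0 -> d != 0 ->
  denom m b != 0 -> denom m (sg / b) != 0 ->
  closed_eval m sg d e b =
  closed_form m b (sg / b) d e * (denom m b * denom m (sg / b)).
Proof.
move=> b0 sg0 d0 h1 h2; rewrite /closed_eval /closed_const /closed_form /closed_total.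
have -> : b * (sg / b) = sg by field.
have -> : a * q / d / b = a * q / (b * d) by field; nz.
have -> : a * q / d / (sg / b) = a * q / (sg / b * d) by field; nz.
have -> : \prod_(k < n) closed_string (m k) b (sg / b) d e (z k) =
  (\prod_(k < n) (ep (a * q * z k * z k) (m k) /
     (ep (a * q * z k / d) (m k) * ep (q ^- m k * e / (a * z k)) (m k)))) /
  (denom m b * denom m (sg / b)).
  rewrite /denom -big_split /= -prodfV -big_split /=; apply: eq_bigr => k _.
  by rewrite /closed_string !invfM; ring.
by field; nz.
Qed.

(** * Both sides as binary forms in b *)

Section Interpolation.
Variables (sg : K) (E O al be : K -> K).
Hypothesis sg0 : sg != 0.
Hypothesis rank2 : forall X b, X != 0 -> b != 0 ->
  th (b * X) * th (sg * X / b) = al X * E b + be X * O b.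

Lemma form_epM x l : x != 0 ->
  form E O l (fun b => ep (b * x) l * ep (sg / b * x) l).
Proof.
move=> x0.
have hl i : linear_form E O
    (fun b => th (b * (x * q ^+ i)) * th (sg * (x * q ^+ i) / b)).
  by exists (al (x * q ^+ i)), (be (x * q ^+ i)) => b b0; apply: rank2 => //; nz.
have := form_prod (index_iota 0 l) hl; rewrite size_iota subn0.
apply: form_ext => b b0; rewrite /ep -big_split /=; apply: eq_bigr => i _.
by congr (th _ * th _); field.
Qed.

(** Writing x / b = (sg / b) (x / sg) and x / (sg / b) = b (x / sg) turns denominators into factors
    of the numerator shape. *)
Lemma form_epV x l : x != 0 ->
  form E O l (fun b => ep (x / b) l * ep (x / (sg / b)) l).
Proof.
move=> x0; have x0' : x / sg != 0 by nz.
apply: form_ext (form_epM l x0') => b b0; rewrite mulrC.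
by congr (ep _ _ * ep _ _); field; nz.
Qed.

(** Every term has the same degree: string k gives y_k pairs from the numerators and m_k - y_k pairs
    from the cleared denominators. *)
Lemma form_sum_form m d e : form E O (\sum_(k < n) m k) (sum_form m sg d e).
Proof.
apply: form_sum => u /forallP bu; apply: form_scale.
have hk k : form E O (m k) (fun b => (ep (b * z k) (u k) *
    ep (a * q * z k / b * q ^+ u k) (m k - u k)) * (ep (sg / b * z k) (u k) *
    ep (a * q * z k / (sg / b) * q ^+ u k) (m k - u k))).
  rewrite -[X in form _ _ X _](subnKC (bu k)).
  have hx : a * q * z k * q ^+ u k != 0 by nz.
  apply: form_ext (form_mul (form_epM (u k) (z0 k)) (form_epV (m k - u k) hx)) => b b0.
  rewrite [a * q * z k / b * _]mulrAC [a * q * z k / (sg / b) * _]mulrAC; ring.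
apply: form_ext (form_bigprod (index_enum 'I_n) hk) => b b0.
by rewrite /cleared -big_split.
Qed.

Lemma form_closed_eval m d e : d != 0 ->
  form E O (\sum_(k < n) m k) (closed_eval m sg d e).
Proof. by move=> d0; apply/form_scale/form_epV; nz. Qed.

(** Evaluating the rank 2 relation at X = 1 / b1, 1 / b2 and b = b1, b2 gives a 2 by 2 matrix whose
    diagonal vanishes because th 1 = 0. Its determinant has [cross] as a factor, while its other two
    entries are nonzero by the hypotheses and the inversion formula. *)
Lemma cross_neq0 b1 b2 : b1 != 0 -> b2 != 0 ->
  th (b1 / b2) != 0 -> th (sg / (b1 * b2)) != 0 -> cross E O b1 b2 != 0.
Proof.
move=> b10 b20 h1 h2; apply: contraTneq isT => c0; rewrite /cross in c0.
have h3 : th (b2 / b1) != 0 by rewrite -[b2 / b1]invrK invf_div thV_eq0 //; nz.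
have f1 : b1^-1 != 0 by nz. have f2 : b2^-1 != 0 by nz.
have e11 := rank2 f1 b10; have e12 := rank2 f1 b20.
have e21 := rank2 f2 b10; have e22 := rank2 f2 b20.
have : th (b2 * b1^-1) * th (sg * b1^-1 / b2) * (th (b1 * b2^-1) * th (sg * b2^-1 / b1)) = 0.
  transitivity (th (b1 * b1^-1) * th (sg * b1^-1 / b1) *
      (th (b2 * b2^-1) * th (sg * b2^-1 / b2)) +
     (be b1^-1 * al b2^-1 - al b1^-1 * be b2^-1) * (E b1 * O b2 - E b2 * O b1)).
    by rewrite e11 e12 e21 e22; ring.
  by rewrite c0 divff // th1; ring.
have -> : sg * b1^-1 / b2 = sg / (b1 * b2) by field; nz.
have -> : sg * b2^-1 / b1 = sg / (b1 * b2) by field; nz.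
move/eqP; rewrite !mulf_eq0 (negbTE h1) (negbTE h2) (negbTE h3); done.
Qed.

End Interpolation.
Hypothesis rank2 : forall sg, sg != 0 -> exists E O al be : K -> K,
  forall X b, X != 0 -> b != 0 ->
    th (b * X) * th (sg * X / b) = al X * E b + be X * O b.

(* These conditions keep the interpolation nodes apart and the denominators
   nonzero at the nodes. *)
Definition sigma_generic (B : nat) (sg : K) := forall j k s t,
  (s <= B)%N -> (t <= B)%N -> [/\ th (sg * z j * z k * q ^+ s / q ^+ t) != 0,
    th (sg * z j * q ^+ s / q ^+ t / (a * z k)) != 0 &
    th (a ^+ 2 * z j * z k * q ^+ s / q ^+ t / sg) != 0].

Lemma sigma_generic_shift B r sg : sg != 0 ->
  sigma_generic (B + r) sg -> sigma_generic B (sg / q ^+ r).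
Proof.
move=> sg0 h j k s t sB tB.
have [h1 h2 _] := h j k s (t + r)%N (leq_trans sB (leq_addr _ _)) (leq_add tB (leqnn _)).
have [_ _ h3] := h j k (s + r)%N t (leq_add sB (leqnn _)) (leq_trans tB (leq_addr _ _)).
rewrite !exprD in h1 h2 h3; split.
- suff -> : sg / q ^+ r * z j * z k * q ^+ s / q ^+ t =
    sg * z j * z k * q ^+ s / (q ^+ t * q ^+ r) by [].
  by field; nz.
- suff -> : sg / q ^+ r * z j * q ^+ s / q ^+ t / (a * z k) =
    sg * z j * q ^+ s / (q ^+ t * q ^+ r) / (a * z k) by [].
  by field; nz.
- suff -> : a ^+ 2 * z j * z k * q ^+ s / q ^+ t / (sg / q ^+ r) =
    a ^+ 2 * z j * z k * (q ^+ s * q ^+ r) / q ^+ t / sg by [].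
  by field; nz.
Qed.

Lemma denom_neq0P m r :
  reflect (forall k, ep (a * q * z k / r) (m k) != 0) (denom m r != 0).
Proof.
rewrite /denom; apply: (iffP (prodf_neq0 _ _)) => h k; first exact: h.
by move=> _; apply: h.
Qed.

Lemma denom_neq0_le m m' r : (forall k, (m' k <= m k)%N) ->
  denom m r != 0 -> denom m' r != 0.
Proof.
move=> mm /denom_neq0P h; apply/denom_neq0P => k.
exact: ep_neq0_le (h k).
Qed.

(** * Induction on |m|: base case, agreement at the nodes, interpolation *)

Lemma jackson_empty m b c d e : (forall k, m k = 0%N) -> strings_generic m ->
  jackson_sum m b c d e = closed_form m b c d e.
Proof.
move=> m0 sg; have [h1 _ h3 _] := sg.
have -> : closed_form m b c d e = 1.
  rewrite /closed_form big1 => [|k _]; last first.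
    by rewrite /closed_string m0 !ep0 !mulr1 divr1.
  rewrite big1 => [|j _]; last first.
    by apply: big1 => k _; rewrite /closed_pair !m0 !ep0 !mulr1 divr1.
  by rewrite /closed_total big1 ?ep0 ?mulr1.
rewrite jackson_sum_bounded (big_pred1 [ffun => ord0]) => [|u] /=; last first.
  apply/forallP/eqP => [h|-> k]; last by rewrite ffunE.
  apply/ffunP => k; apply: val_inj; rewrite ffunE /=.
  by apply/eqP; rewrite -leqn0 -(m0 k).
have -> : (fun k => ([ffun => ord0] : Y) k : nat) = (fun _ => 0%N).
  by apply: funext => k; rewrite ffunE.
rewrite term_withE term_with_pairs big1 => [|k _]; last first.
  by rewrite string_factor_y0 // poch_ratio0 mulr1.
rewrite mul1r big1 // => j _; apply: big1 => k jk; rewrite !m0.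
have kj : k != j by apply: contraTneq jk => ->; rewrite ltnn.
apply: pair_factor_y0; rewrite ?ep0 ?oner_neq0 //.
by have := h1 k j 0%N 0%N kj isT isT; rewrite expr0 mulr1 divr1.
Qed.

Lemma ep_rev_neq0 k l e : e != 0 -> ep (a * q * z k / e) l != 0 ->
  ep (q ^- l * e / (a * z k)) l != 0.
Proof.
move=> e0 h.
have -> : q ^- l * e / (a * z k) = q / (q ^+ l * (a * q * z k / e)) by field; nz.
rewrite ep_rev; last by nz.
by rewrite mulf_neq0 // rev_monomial_neq0 //; nz.
Qed.

Lemma leq_string m k : (m k <= \sum_(j < n) m j)%N.
Proof. by rewrite (bigD1 k) //= leq_addr. Qed.

(** Every exponent met at the nodes is at most 2 |m|. Passing to m_k = i divides b c by q^(m_k - i),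
    hence consumes m_k - i of the range, while the bound required for the smaller sum drops by twice
    as much. *)
Definition jackson_holds m := forall b c d e : K,
  b != 0 -> c != 0 -> d != 0 -> e != 0 ->
  a ^+ 2 * q ^+ (\sum_(j < n) m j).+1 = b * c * d * e ->
  denom m b != 0 -> denom m c != 0 -> denom m d != 0 -> denom m e != 0 ->
  sigma_generic (2 * \sum_(j < n) m j + 2) (b * c) ->
  jackson_sum m b c d e = closed_form m b c d e.

Lemma node_agree m k i b sg d e : strings_generic m -> (i < m k)%N ->
  jackson_holds (upd m k i) ->
  b = q ^- i / z k ->
  sg != 0 -> d != 0 -> e != 0 -> a ^+ 2 * q ^+ (\sum_(j < n) m j).+1 = sg * d * e ->
  denom m d != 0 -> denom m e != 0 ->
  sigma_generic (2 * \sum_(j < n) m j + 2) sg ->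
  sum_form m sg d e b = closed_eval m sg d e b.
Proof.
move=> gm im IH bE sg0 d0 e0 bal hd he gs; have [h1 h2 h3 h4] := gm.
have b0 : b != 0 by rewrite bE; nz.
have c0 : sg / b != 0 by nz.
have hb : denom m b != 0.
  apply/denom_neq0P => j; rewrite bE.
  have -> : a * q * z j / (q ^- i / z k) = a * q * z j * z k * q ^+ i by field; nz.
  have : ep (a * q * z j * z k) (i + m j) != 0.
    by apply: ep_neq0_le (h4 j k); rewrite addnC leq_add2l ltnW.
  by rewrite epD mulf_eq0 negb_or => /andP[].
have hc : denom m (sg / b) != 0.
  apply/denom_neq0P => j; apply/ep_neq0P => l lm.
  have -> : a * q * z j / (sg / b) * q ^+ l =
     (sg * z k * q ^+ i / q ^+ l.+1 / (a * z j))^-1.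
    by rewrite bE exprS; field; nz.
  have iB : (i <= 2 * \sum_(j < n) m j + 2)%N.
    have := leq_string m k; move: im; clear; lia.
  have lB : (l.+1 <= 2 * \sum_(j < n) m j + 2)%N.
    have := leq_string m j; move: lm; clear; lia.
  by rewrite thV_eq0; [have [] := gs k j i l.+1 iB lB|nz].
rewrite sum_formE // closed_evalE //; congr (_ * _).
have MM := sum_upd m k i.
have hb' : denom (upd m k i) (q ^- m k / z k) != 0.
  apply/denom_neq0P => j.
  have -> : a * q * z j / (q ^- m k / z k) = a * q * z j * z k * q ^+ m k by field; nz.
  have : ep (a * q * z j * z k) (m k + upd m k i j) != 0.
    by apply: ep_neq0_le (h4 j k); rewrite addnC leq_add2r upd_le // ltnW.
  by rewrite epD mulf_eq0 negb_or => /andP[].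
rewrite {1 3}bE jackson_sum_swap closed_form_swap //.
- apply: IH => //; [nz| | | | |].
  + have qE : q ^+ (\sum_(j < n) upd m k i j) * q ^+ m k =
        q ^+ (\sum_(j < n) m j) * q ^+ i by rewrite -!exprD MM.
    have -> : q ^- m k / z k * (sg / b) * d * e = (sg * d * e) * q ^+ i / q ^+ m k.
      by rewrite bE; field; nz.
    rewrite -bal !exprSr.
    transitivity (a ^+ 2 * (q ^+ (\sum_(j < n) upd m k i j) * q ^+ m k) * q / q ^+ m k).
      by field; nz.
    by rewrite qE; field; nz.
  + by apply: denom_neq0_le hc; apply: upd_le; rewrite ltnW.
  + by apply: denom_neq0_le hd; apply: upd_le; rewrite ltnW.
  + by apply: denom_neq0_le he; apply: upd_le; rewrite ltnW.
  + have -> : q ^- m k / z k * (sg / b) = sg / q ^+ (m k - i).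
      have -> : q ^+ m k = q ^+ (m k - i) * q ^+ i by rewrite -exprD subnK // ltnW.
      by rewrite bE; field; nz.
    apply: sigma_generic_shift => // j l s t sB tB.
    by apply: gs; move: MM im sB tB; clear; lia.
- by rewrite ltnW.
- by rewrite bal bE; field; nz.
- by move/denom_neq0P: hc.
- by move/denom_neq0P: hd.
- by apply: ep_rev_neq0 => //; move/denom_neq0P: he.
Qed.

(** Replaces [closed_evalE] at the node a q^m_k z_k: all denominators in b and c are restored except
    (a q z_k / b)_{m_k}, which is 0 there. *)
Lemma closed_eval_cut m k b sg d e : b != 0 -> sg != 0 -> d != 0 ->
  \prod_(j < n | j != k) ep (a * q * z j / b) (m j) != 0 ->
  denom m (sg / b) != 0 ->
  closed_eval m sg d e b =
  (ep (a * q * z k * z k) (m k) / (ep (a * q * z k / (sg / b)) (m k) *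
     ep (a * q * z k / d) (m k) * ep (q ^- m k * e / (a * z k)) (m k)) *
   closed_total (\sum_(j < n) m j) b (sg / b) d) *
  (\prod_(j < n | j != k) (closed_string (m j) b (sg / b) d e (z j) *
     closed_pair (m j) (m k) (z j) (z k))) *
  (\prod_(j < n | j != k) \prod_(l < n | (l != k) && (j < l)%N)
     closed_pair (m j) (m l) (z j) (z l)) *
  ((\prod_(j < n | j != k) ep (a * q * z j / b) (m j)) * denom m (sg / b)).
Proof.
move=> b0 sg0 d0; rewrite /closed_eval /closed_const (closed_pair_split m k) /closed_total.
have -> : b * (sg / b) = sg by field.
have -> : a * q / d / b = a * q / (b * d) by field; nz.
have -> : a * q / d / (sg / b) = a * q / (sg / b * d) by field; nz.
have -> : denom m (sg / b) = ep (a * q * z k / (sg / b)) (m k) *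
    \prod_(j < n | j != k) ep (a * q * z j / (sg / b)) (m j).
  by rewrite /denom (bigD1 k).
have -> : \prod_(j < n) (ep (a * q * z j * z j) (m j) /
    (ep (a * q * z j / d) (m j) * ep (q ^- m j * e / (a * z j)) (m j))) =
  ep (a * q * z k * z k) (m k) /
    (ep (a * q * z k / d) (m k) * ep (q ^- m k * e / (a * z k)) (m k)) *
  \prod_(j < n | j != k) (ep (a * q * z j * z j) (m j) /
    (ep (a * q * z j / d) (m j) * ep (q ^- m j * e / (a * z j)) (m j))).
  by rewrite (bigD1 k).
rewrite [X in _ = _ * X * _ * _]big_split /=.
have -> : \prod_(j < n | j != k) closed_string (m j) b (sg / b) d e (z j) =
  (\prod_(j < n | j != k) (ep (a * q * z j * z j) (m j) /
     (ep (a * q * z j / d) (m j) * ep (q ^- m j * e / (a * z j)) (m j)))) /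
  ((\prod_(j < n | j != k) ep (a * q * z j / b) (m j)) *
   (\prod_(j < n | j != k) ep (a * q * z j / (sg / b)) (m j))).
  rewrite -big_split /= -prodfV -big_split /=; apply: eq_bigr => j _.
  by rewrite /closed_string !invfM; ring.
move=> h1; rewrite mulf_eq0 negb_or => /andP[h2 h3].
move: h1 h2 h3; move: (ep (a * q * z k / (sg / b)) (m k)).
move: (\prod_(j < n | j != k) ep (a * q * z j / (sg / b)) (m j)).
move: (\prod_(j < n | j != k) ep (a * q * z j / b) (m j)).
move: (ep (a * q * z k / d) (m k)) (ep (q ^- m k * e / (a * z k)) (m k)).
move=> D E P1 P2 C h1 h2 h3.
rewrite [(D * E)^-1]invfM [(C * D * E)^-1]invfM [(C * D)^-1]invfM.
move: D^-1 E^-1 => iD iE.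
by field; nz.
Qed.

Lemma node_flip_agree m k b sg d e : strings_generic m -> (0 < m k)%N ->
  (forall j, (m j <= L)%N) ->
  jackson_holds (upd m k 0) ->
  b = a * q ^+ m k * z k ->
  sg != 0 -> d != 0 -> e != 0 -> a ^+ 2 * q ^+ (\sum_(j < n) m j).+1 = sg * d * e ->
  denom m d != 0 -> denom m e != 0 ->
  sigma_generic (2 * \sum_(j < n) m j + 2) sg ->
  sum_form m sg d e b = closed_eval m sg d e b.
Proof.
move=> gm mk0 mL IH bE sg0 d0 e0 bal hd he gs; have [h1 h2 h3 h4] := gm.
have b0 : b != 0 by rewrite bE; nz.
have c0 : sg / b != 0 by nz.
have hbj j : j != k -> ep (a * q * z j / b) (m j) != 0.
  move=> jk; rewrite bE.
  have -> : a * q * z j / (a * q ^+ m k * z k) = q * z j / z k / q ^+ m k by field; nz.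
  exact: strings_epz.
have hb : \prod_(j < n | j != k) ep (a * q * z j / b) (m j) != 0.
  by apply/prodf_neq0 => j; apply: hbj.
have hc : denom m (sg / b) != 0.
  apply/denom_neq0P => j; apply/ep_neq0P => l lm.
  have -> : a * q * z j / (sg / b) * q ^+ l =
     a ^+ 2 * z j * z k * q ^+ (l.+1 + m k) / q ^+ 0 / sg.
    by rewrite bE exprD [q ^+ l.+1]exprS expr0; field; nz.
  have lB : (l.+1 + m k <= 2 * \sum_(j < n) m j + 2)%N.
    have := leq_string m j; have := leq_string m k; move: lm; clear; lia.
  by have [] := gs j k _ _ lB (leq0n _).
have MM := sum_upd m k 0; rewrite addn0 in MM.
pose B (u : Y) j := if j == k then ep (a * q ^+ m k * z k * z k) (m k)
                    else poch_ratio (a * q ^+ m k * z k) (z j) (u j).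
have clE (u : Y) : bounded m u -> u k = m k :> nat ->
    cleared m b (fun j => u j) =
    (\prod_(j < n) B u j) * \prod_(j < n | j != k) ep (a * q * z j / b) (m j).
  move=> /forallP bu uk; rewrite /cleared (bigD1 k) //= [in RHS](bigD1 k) //=.
  rewrite /B eqxx uk subnn ep0 mulr1 -bE -mulrA; congr (_ * _).
  rewrite -big_split /=; apply: eq_bigr => j jk; rewrite (negbTE jk).
  have := hbj j jk; rewrite -{1 3}(subnKC (bu j)) !epD mulf_eq0 negb_or.
  by move=> /andP[k1 k2]; rewrite /poch_ratio; field.
(* For u k < m k the last factor of the cleared denominator on string k is theta(q^m_k / q^m_k) =
   theta(1) = 0. *)
have cl0 (u : Y) : bounded m u -> u k != m k :> nat -> cleared m b (fun j => u j) = 0.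
  move=> /forallP bu uk; rewrite /cleared (bigD1 k) //=.
  have lt : (u k < m k)%N by rewrite ltn_neqAle uk bu.
  rewrite (@ep_eq0 (a * q * z k / b * _) _ (m k - u k).-1) ?mulr0 ?mul0r //.
    by rewrite prednK // subn_gt0.
  rewrite bE.
  have -> : a * q * z k / (a * q ^+ m k * z k) * q ^+ u k * q ^+ (m k - u k).-1 =
    q * q ^+ u k * q ^+ (m k - u k).-1 / q ^+ m k by field; nz.
  rewrite -exprS -exprD addSn -addnS prednK ?subn_gt0 // subnKC ?bu //.
  by rewrite divff // qX0.
have bal' : a ^+ 2 * q ^+ (\sum_(j < n) m j).+1 =
    a * q ^+ m k * z k * (sg / b) * d * e.
  by rewrite bal bE; field; nz.
transitivity ((\prod_(j < n | j != k) ep (a * q * z j / b) (m j)) *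
  denom m (sg / b) * \sum_(u : Y | bounded m u && (u k == m k :> nat))
    term_with m (B u) (sg / b) d e (fun j => u j)).
  rewrite /sum_form (bigID (fun u : Y => u k == m k :> nat)) /=.
  rewrite [X in _ + X]big1 ?addr0; last first.
    by move=> u /andP[bu uk]; rewrite cl0 // mul0r mulr0.
  rewrite big_distrr /=; apply: eq_bigr => u /andP[bu /eqP uk].
  by rewrite clE // clearedE // /term_with; ring.
rewrite jackson_sum_flip // IH //.
- rewrite closed_form_flip //.
  + by rewrite (closed_eval_cut (k := k)) // -bE; ring.
  + by move/denom_neq0P: hc.
  + by move/denom_neq0P: hd.
  + by move/denom_neq0P: he.
- by nz.
- have qE : q ^+ (\sum_(j < n) upd m k 0 j) * q ^+ m k =
        q ^+ (\sum_(j < n) m j) by rewrite -!exprD MM.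
  have -> : a * z k * (sg / b) * d * e = (sg * d * e) / q ^+ m k.
    by rewrite bE; field; nz.
  rewrite -bal !exprSr -qE.
  by field; nz.
- apply/denom_neq0P => j.
  have -> : a * q * z j / (a * z k) = q * z j / z k by field; nz.
  have [->|jk] := eqVneq j k; first by rewrite updE ep0 oner_neq0.
  have := @strings_epz m j k 0 gm jk isT; rewrite expr0 divr1.
  by rewrite updN.
- by apply: denom_neq0_le hc; apply: upd_le.
- by apply: denom_neq0_le hd; apply: upd_le.
- by apply: denom_neq0_le he; apply: upd_le.
- have -> : a * z k * (sg / b) = sg / q ^+ m k by rewrite bE; field; nz.
  apply: sigma_generic_shift => // j l s t sB tB.
  by apply: gs; move: MM sB tB; clear; lia.
Qed.

Lemma strings_pow m k s : strings_generic m -> (0 < s <= m k)%N -> th (q ^+ s) != 0.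
Proof.
move=> [_ h _ _] /andP[s0 sm]; have /ep_neq0P := h k.
move/(_ s.-1); rewrite -exprS prednK //; apply.
by move: s0 sm; clear; lia.
Qed.

Lemma strings_ratio m j k s t : strings_generic m -> (j, s) != (k, t) ->
  (s <= m j)%N -> (t <= m k)%N -> th (z j / z k * q ^+ s / q ^+ t) != 0.
Proof.
move=> gm; have [h1 _ _ _] := gm; rewrite xpair_eqE negb_and.
have [->|jk _] := eqVneq j k; last exact: h1.
rewrite /= divff // mul1r => st sm tm.
case: (ltngtP s t) => lt; last by rewrite lt eqxx in st.
  have -> : q ^+ s / q ^+ t = (q ^+ (t - s))^-1.
    by rewrite -{1}(subnKC (ltnW lt)) exprD; field; nz.
  rewrite thV_eq0 ?qX0 //; apply: (@strings_pow m k) => //.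
  by move: lt tm; clear; lia.
have -> : q ^+ s / q ^+ t = q ^+ (s - t).
  by rewrite -{1}(subnKC (ltnW lt)) exprD; field; nz.
apply: (@strings_pow m k) => //.
by move: lt sm; clear; lia.
Qed.

Theorem jackson_generic m : (forall j, (m j <= L)%N) -> strings_generic m ->
  jackson_holds m.
Proof.
have [M] := ubnP (\sum_(j < n) m j); elim: M m => // M IHM m; rewrite ltnS => mM mL gm.
have IH k i : (i < m k)%N -> jackson_holds (upd m k i).
  move=> im; have le := upd_le (ltnW im); apply: IHM.
  - by have := sum_upd m k i; move: im mM; clear; lia.
  - by move=> j; apply: leq_trans (le j) (mL j).
  - exact: strings_generic_le gm.
have [/forallP m0|/forallPn[k0]] := boolP [forall k, m k == 0%N].
  move=> b c d e *; apply: jackson_empty => // k; exact/eqP.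
rewrite -lt0n => mk0 b c d e b0 c0 d0 e0 bal hb hc hd he gs.
have sg0 : b * c != 0 by nz.
have cE : c = b * c / b by field.
have [E [O [al [be rk]]]] := rank2 sg0.
pose F x := sum_form m (b * c) d e x + (-1) * closed_eval m (b * c) d e x.
have hF : form E O (\sum_(j < n) m j) F.
  apply: form_add; first exact: form_sum_form rk _ _ _.
  by apply: form_scale; apply: (form_closed_eval sg0 rk).
(* These |m| nodes and b' form the |m| + 1 points that [form_eq0] asks for; k0 is any index with a
   nonempty range. *)
pose nodes := [seq (k, i) | k <- enum 'I_n, i <- iota 0 (m k)].
pose node (x : 'I_n * nat) := q ^- x.2 / z x.1.
pose b' := a * q ^+ m k0 * z k0.
have nodesP x : x \in nodes -> (x.2 < m x.1)%N.
  by case/allpairsPdep => k [i [_ + ->]]; rewrite mem_iota.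
have node0 x : node x != 0 by rewrite /node; nz.
have b'0 : b' != 0 by rewrite /b'; nz.
have sB k : (m k <= \sum_(j < n) m j)%N := leq_string m k.
have [_ _ h3 h4] := gm.
suff F0 : F b = 0.
  have hc' : denom m (b * c / b) != 0 by rewrite -cE.
  have D0 : denom m b * denom m (b * c / b) != 0 by nz.
  apply: (mulIf D0); move/eqP: F0; rewrite /F mulN1r subr_eq0 => /eqP.
  by rewrite sum_formE // closed_evalE // -cE.
apply: (form_eq0 hF (s := b' :: map node nodes)) => //.
- rewrite /= size_map size_allpairs_dep sumnE big_map big_enum /=.
  by congr _.+1; apply: eq_bigr => k _; rewrite size_iota.
- by rewrite /= b'0; apply/allP => _ /mapP[x _ ->].
- rewrite /=; apply/andP; split.
    apply/allP => _ /mapP[[k i] /nodesP /= ik ->].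
    apply: (cross_neq0 rk) => //.
      have -> : b' / node (k, i) = a * q * z k0 * z k * q ^+ (m k0 + i).-1.
        transitivity (a * z k0 * z k * (q * q ^+ (m k0 + i).-1)); last by ring.
        rewrite -exprS prednK ?addn_gt0 ?mk0 // exprD /b' /node /=.
        by field; nz.
      have /ep_neq0P := h4 k0 k; apply.
      by rewrite prednK ?addn_gt0 ?mk0 // leq_add2l ltnW.
    have -> : b * c / (b' * node (k, i)) = b * c * z k * q ^+ i / q ^+ m k0 / (a * z k0).
      by rewrite /b' /node /=; field; nz.
    have iB : (i <= 2 * \sum_(j < n) m j + 2)%N.
      by have := sB k; move: ik; clear; lia.
    have tB : (m k0 <= 2 * \sum_(j < n) m j + 2)%N.
      by have := sB k0; clear; lia.
    by have [] := gs k k0 i _ iB tB.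
  have crossP : {in nodes &, subrel (fun x y : 'I_n * nat => x != y)
      (fun x y : 'I_n * nat => cross E O (node x) (node y) != 0)}.
    move=> [k i] [l j] /nodesP /= ik /nodesP /= jl ne.
    apply: (cross_neq0 rk) => //.
      have -> : node (k, i) / node (l, j) = z l / z k * q ^+ j / q ^+ i.
        by rewrite /node /=; field; nz.
      by apply: (@strings_ratio m) => //; rewrite 1?eq_sym // ltnW.
    have -> : b * c / (node (k, i) * node (l, j)) = b * c * z k * z l * q ^+ (i + j) / q ^+ 0.
      by rewrite /node /= exprD expr0; field; nz.
    have iB : (i + j <= 2 * \sum_(j < n) m j + 2)%N.
      by have := sB k; have := sB l; move: ik jl; clear; lia.
    by have [] := gs k l _ _ iB (leq0n _).
  rewrite pairwise_map; apply: (sub_in_pairwise crossP); first exact/allP.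
  rewrite -uniq_pairwise; apply: allpairs_uniq_dep.
  + exact: enum_uniq.
  + by move=> k _; apply: iota_uniq.
  + by case=> k i [l j] _ _ /= [-> ->].
- move=> x; rewrite inE => /orP[/eqP->|/mapP[[k i] /nodesP /= ik ->]].
  + rewrite /F (node_flip_agree (k := k0)) ?mulN1r ?subrr //.
    exact: IH.
  + rewrite /F (node_agree (k := k) (i := i)) ?mulN1r ?subrr //.
    exact: IH.
Qed.

End BoundedSums.

End Sums.
End Strings.
End ThetaSymbols.

(** * Analysis of theta functions *)

Local Open Scope classical_set_scope.
Local Open Scope ring_scope.

(** * Limits of complex sequences *)

Section ComplexLimits.
Local Open Scope complex_scope.
Variable R : realType.
(* The topology of the statement is the one of a generic numFieldType, which is
   not inferred from the bare carrier R[i]. *)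
Let K : numFieldType := R[i].
Implicit Types (r A : K) (u : nat -> K).

(** The order of [R[i]] is partial and 0 <= r forces r to be real, so every epsilon and every ratio
    reduces to one in [R]. *)
Lemma ge0_complexP r : 0 <= r -> exists2 x : R, 0 <= x & r = x%:C.
Proof.
move=> r0; have := r0; rewrite lecE /= => /andP[_ h].
by exists (complex.Re r) => //; rewrite RRe_real // ger0_real.
Qed.

Lemma cvg_expr_complex r : 0 <= r -> r < 1 ->
  (fun n => r ^+ n) @ \oo --> (0 : K).
Proof.
move=> /ge0_complexP[x x0 ->]; rewrite (_ : 1 = 1%:C) // ltcR => x1.
apply/cvgr0Pnorm_lt => e e0; have [y y0 eE] := ge0_complexP (ltW e0).
move: e0; rewrite eE (_ : 0 = 0%:C) // ltcR => {}y0.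
have h : (fun n => x ^+ n) @ \oo --> (0 : R).
  by apply: cvg_expr; rewrite ger0_norm.
have /cvgr0Pnorm_lt /(_ y y0) := h.
apply: filterS => n hn.
by rewrite -rmorphXn /= normc_def /= expr0n /= addr0 sqrtr_sqr ltcR.
Qed.

Lemma norm_complex_le (w : R[i]) : `|w| <= (`|complex.Re w| + `|complex.Im w|)%:C.
Proof.
rewrite {1}[w]complexE; apply: le_trans (ler_normD _ _) _.
rewrite normrM rmorphD /=.
have n1 (x : R) : `|x%:C| = (`|x|)%:C :> R[i].
  by rewrite normc_def /= expr0n /= addr0 sqrtr_sqr.
by rewrite !n1 normc_def /= expr0n /= add0r expr1n sqrtr1 mul1r.
Qed.

Lemma cvg_complex u (l : K) :
  (fun n => complex.Re (u n)) @ \oo --> complex.Re l ->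
  (fun n => complex.Im (u n)) @ \oo --> complex.Im l -> u @ \oo --> l.
Proof.
move=> hr hi; apply/cvgrPdist_lt => e e0.
have [y y0 eE] := ge0_complexP (ltW e0).
move: e0; rewrite eE (_ : 0 = 0%:C) // ltcR => {}y0.
have y2 : 0 < y / 2 by apply: divr_gt0.
move/cvgrPdist_lt : hr => /(_ _ y2) hr; move/cvgrPdist_lt : hi => /(_ _ y2) hi.
near=> n; apply: le_lt_trans (norm_complex_le _) _.
rewrite ltcR; rewrite !raddfB /= [y]splitr; apply: ltrD; near: n.
- exact: hr.
- exact: hi.
Unshelve. all: by end_near. Qed.

Lemma cvg_geometric_increments_real (u : nat -> R) (A r : R) : 0 <= r -> r < 1 ->
  (forall n, `|u n.+1 - u n| <= A * r ^+ n) -> exists l : R, u @ \oo --> l.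
Proof.
move=> r0 r1 h.
have cs : cvgn [series `|telescope u n|]_n.
  apply: (series_le_cvg (v_ := geometric A r)) => //.
  - by move=> n /=.
  - by move=> n /=; apply: le_trans (normr_ge0 _) (h n).
  - by apply: is_cvg_geometric_series; rewrite ger0_norm.
have := normed_cvg cs => /cvg_ex[l hl].
exists (u 0%N + l).
have hl' : (fun n => u 0%N + series (telescope u) n) @ \oo --> u 0%N + l.
  exact: (cvgD (cvg_cst (u 0%N)) hl).
have e : (fun n => u 0%N + series (telescope u) n) = u.
  by apply/funext => n; rewrite seriesEnat /= telescope_sumr // addrC subrK.
by rewrite e in hl'.
Qed.

Lemma cvg_geometric_increments u A r : 0 <= r -> r < 1 ->
  (forall n, `|u n.+1 - u n| <= A * r ^+ n) -> exists l : K, u @ \oo --> l.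
Proof.
move=> /ge0_complexP[x x0 ->]; rewrite (_ : 1 = 1%:C) // ltcR => x1 h.
have A0 : 0 <= A by have := le_trans (normr_ge0 _) (h 0%N); rewrite expr0 mulr1.
have [B B0 AE] := ge0_complexP A0.
have hRe (w : R[i]) : (`|complex.Re w|)%:C <= `|w| := normc_ge_Re w.
have hIm (w : R[i]) : (`|complex.Im w|)%:C <= `|w|.
  by rewrite normc_def lecR -sqrtr_sqr ler_wsqrtr // lerDr sqr_ge0.
have [lr hlr] : exists l : R, (fun n => complex.Re (u n)) @ \oo --> l.
  apply: (@cvg_geometric_increments_real _ B x x0 x1) => n.
  by rewrite -raddfB -lecR; apply: le_trans (hRe _) _; have := h n; rewrite AE -rmorphXn -rmorphM.
have [li hli] : exists l : R, (fun n => complex.Im (u n)) @ \oo --> l.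
  apply: (@cvg_geometric_increments_real _ B x x0 x1) => n.
  by rewrite -raddfB -lecR; apply: le_trans (hIm _) _; have := h n; rewrite AE -rmorphXn -rmorphM.
by exists (lr +i* li); apply: cvg_complex.
Qed.

End ComplexLimits.

(** * Infinite products with geometrically small deviations *)

Section InfiniteProducts.
Variable K : numFieldType.
(** These two hypotheses stand for the completeness of the field and let the whole analysis take
    place in the generic topology in which [theta] is defined; the previous section supplies them
    for [R[i]]. *)
Hypothesis cvg_geo : forall r : K, 0 <= r -> r < 1 ->
  (fun n => r ^+ n) @ \oo --> (0 : K).
Hypothesis cvg_increments : forall (u : nat -> K) (A r : K), 0 <= r -> r < 1 ->
  (forall n, `|u n.+1 - u n| <= A * r ^+ n) -> exists l : K, u @ \oo --> l.

Lemma geo_small (A r e : K) : 0 <= A -> 0 <= r -> r < 1 -> 0 < e ->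
  exists J, A * r ^+ J <= e.
Proof.
move=> A0 r0 r1 e0.
have h : (fun n => A * r ^+ n) @ \oo --> (0 : K).
  by rewrite -(mulr0 A); apply: cvgM; [exact: cvg_cst|exact: cvg_geo].
have /cvgr0Pnorm_lt /(_ e e0) [J _ hJ] := h.
exists J; have /= := hJ J (leqnn J).
by rewrite ger0_norm ?mulr_ge0 ?exprn_ge0 // => /ltW.
Qed.

Lemma sum_geo_le (r : K) N : 0 <= r -> r < 1 ->
  \sum_(0 <= j < N) r ^+ j <= (1 - r)^-1.
Proof.
move=> r0 r1; have r1' : 0 < 1 - r by rewrite subr_gt0.
rewrite -[leRHS]mul1r ler_pdivlMr //.
have -> : (\sum_(0 <= j < N) r ^+ j) * (1 - r) = 1 - r ^+ N.
  elim: N => [|N IH]; first by rewrite big_geq // mul0r expr0 subrr.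
  by rewrite big_nat_recr //= mulrDl IH exprS; ring.
by rewrite gerBl exprn_ge0.
Qed.

(** The Weierstrass product inequality; the bounds 0 and 1 are carried along to make the induction
    go through. *)
Lemma prod_ge_sub_sum (x : nat -> K) N : (forall j, 0 <= x j <= 1) ->
  0 <= \prod_(0 <= j < N) (1 - x j) <= 1 /\
  1 - \sum_(0 <= j < N) x j <= \prod_(0 <= j < N) (1 - x j).
Proof.
move=> x01; elim: N => [|N [/andP[p0 p1] IH]].
  by rewrite !big_geq // subr0 ler01 lexx.
have /andP[x0 x1] := x01 N.
rewrite !big_nat_recr //=; split.
  rewrite mulr_ge0 ?subr_ge0 //= mulr_ile1 ?subr_ge0 //.
  by rewrite gerBl.
apply: le_trans (_ : \prod_(0 <= j < N) (1 - x j) - x N <= _).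
  by rewrite opprD addrA lerD2r.
by rewrite mulrBr mulr1 lerD2l lerN2 ler_piMl.
Qed.

Section Tail.
Variables (A r : K).
Hypotheses (A0 : 0 <= A) (r0 : 0 <= r) (r1 : r < 1).

Lemma addr_half : (2%:R : K)^-1 + 2%:R^-1 = 1.
Proof. by have := splitr (1 : K); rewrite !mul1r. Qed.

Lemma geo_tail : exists J, forall N,
  (\sum_(0 <= j < N) A * r ^+ (J + j) <= 2%:R^-1) /\
  forall j, A * r ^+ (J + j) <= 1.
Proof.
have r1' : 0 < 1 - r by rewrite subr_gt0.
have [|J hJ] := @geo_small A r ((1 - r) / 2%:R) A0 r0 r1.
  by rewrite divr_gt0 // ltr0n.
exists J => N; split.
  have -> : \sum_(0 <= j < N) A * r ^+ (J + j) =
      (A * r ^+ J) * \sum_(0 <= j < N) r ^+ j.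
    by rewrite big_distrr /=; apply: eq_bigr => j _; rewrite exprD mulrA.
  apply: le_trans (ler_pM _ _ hJ (sum_geo_le N r0 r1)) _.
  - by rewrite mulr_ge0 ?exprn_ge0.
  - by apply: sumr_ge0 => j _; rewrite exprn_ge0.
  - suff -> : (1 - r) / 2%:R * (1 - r)^-1 = 2%:R^-1 by [].
    by rewrite mulrAC mulfV ?mul1r // gt_eqF.
move=> j; rewrite exprD mulrA.
apply: le_trans (_ : A * r ^+ J <= 1).
  by rewrite ler_piMr ?mulr_ge0 ?exprn_ge0 // exprn_ile1 // ltW.
apply: le_trans hJ _; rewrite ler_pdivrMr ?ltr0n // mul1r.
apply: le_trans (_ : 1 <= _); first by rewrite gerBl.
by rewrite ler1n.
Qed.

(** J is chosen so that the tail of the series is at most 1/2. The Weierstrass inequality then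
    bounds the product of the 1 - t from below by 1/2, and (1 + t)(1 - t) <= 1 bounds the product of
    the 1 + t by 2. *)
Lemma prod_tail_ge : exists J, forall N,
  [/\ 2%:R^-1 <= \prod_(0 <= j < N) (1 - A * r ^+ (J + j)),
  \prod_(0 <= j < N) (1 + A * r ^+ (J + j)) <= 2%:R &
  forall j, A * r ^+ (J + j) <= 1].
Proof.
have [J hJ] := geo_tail; exists J => N.
have x01 j : 0 <= A * r ^+ (J + j) <= 1.
  by rewrite mulr_ge0 ?exprn_ge0 //=; have [_] := hJ N; apply.
have lower : 2%:R^-1 <= \prod_(0 <= j < N) (1 - A * r ^+ (J + j)).
  have [_] := prod_ge_sub_sum N x01; apply: le_trans.
  have [h _] := hJ N.
  by rewrite lerBrDr -[leRHS]addr_half lerD2l.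
split=> //; last by have [_] := hJ N.
have h : 0 <= (\prod_(0 <= j < N) (1 + A * r ^+ (J + j))) *
    \prod_(0 <= j < N) (1 - A * r ^+ (J + j)) <= 1.
  rewrite -big_split /=; elim/big_ind: _ => [|x y|i _].
  - by rewrite ler01 lexx.
  - by move=> /andP[x0 x1] /andP[y0 y1]; rewrite mulr_ge0 //= mulr_ile1.
  - have /andP[t0 t1] := x01 i.
    rewrite mulr_ge0 ?subr_ge0 ?addr_ge0 //= mulrC -subr_sqr expr1n.
    by rewrite gerBl exprn_ge0.
have p0 : 0 <= \prod_(0 <= j < N) (1 + A * r ^+ (J + j)).
  by apply: prodr_ge0 => j _; rewrite addr_ge0 // mulr_ge0 ?exprn_ge0.
have /andP[_ h1] := h.
have := le_trans (ler_wpM2l p0 lower) h1.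
by rewrite ler_pdivrMr ?ltr0n // mul1r.
Qed.

Lemma prod_upper : exists2 B : K, 0 < B &
  forall N, \prod_(0 <= j < N) (1 + A * r ^+ j) <= B.
Proof.
have [J hJ] := prod_tail_ge.
have x0 j : 0 <= A * r ^+ j by rewrite mulr_ge0 ?exprn_ge0.
have p1 N : 1 <= \prod_(0 <= j < N) (1 + A * r ^+ j).
  elim: N => [|N IH]; first by rewrite big_geq.
  rewrite big_nat_recr //=; apply: (le_trans IH).
  by rewrite ler_peMr ?lerDl // (le_trans ler01 IH).
exists ((\prod_(0 <= j < J) (1 + A * r ^+ j)) * 2%:R).
  by rewrite mulr_gt0 ?ltr0n // (lt_le_trans ltr01 (p1 _)).
move=> N.
apply: le_trans (_ : \prod_(0 <= j < J + N) (1 + A * r ^+ j) <= _).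
  rewrite addnC [leRHS](big_cat_nat (n := N)) ?leq_addr //= ler_peMr //.
    by rewrite (le_trans ler01 (p1 _)).
  elim/big_ind: _ => // [x y hx hy|i _]; last by rewrite lerDl.
  by rewrite -[1]mulr1 ler_pM.
rewrite (big_cat_nat (n := J)) ?leq_addr //= ler_pM2l; last first.
  by rewrite (lt_le_trans ltr01 (p1 _)).
have -> : \prod_(J <= j < J + N) (1 + A * r ^+ j) =
    \prod_(0 <= j < N) (1 + A * r ^+ (J + j)).
  by rewrite -{1}[J]add0n big_addn addKn; apply: eq_bigr => j _; rewrite addnC.
by have [] := hJ N.
Qed.

End Tail.

Definition pprod (f : nat -> K) (N : nat) : K := \prod_(0 <= j < N) (1 - f j).

Lemma pprodS f N : pprod f N.+1 = pprod f N * (1 - f N).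
Proof. by rewrite /pprod big_nat_recr. Qed.

Section GeometricProduct.
Variables (A r : K).
Hypotheses (A0 : 0 <= A) (r0 : 0 <= r) (r1 : r < 1).

Lemma pprod_le_majorant f N : (forall j, `|f j| <= A * r ^+ j) ->
  `|pprod f N| <= \prod_(0 <= j < N) (1 + A * r ^+ j).
Proof.
move=> hf; rewrite /pprod normr_prod; apply: ler_prod => j _.
rewrite normr_ge0 /=; apply: le_trans (ler_normB _ _) _.
by rewrite normr1 lerD2l.
Qed.

(** Keeps the limit of the products away from 0. Beyond J the remaining factors have product at
    least 1/2; before J at most a factor B separates a partial product from the one at J. Hence the
    constant |pprod f J| / (2 B). *)
Lemma pprod_lower f : (forall j, `|f j| <= A * r ^+ j) -> (forall j, 1 - f j != 0) ->
  exists2 c : K, 0 < c & forall N, c <= `|pprod f N|.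
Proof.
move=> hf f1; have [J hJ] := prod_tail_ge A0 r0 r1.
have [B B0 hB] := prod_upper A0 r0 r1.
have x0 j : 0 <= A * r ^+ j by rewrite mulr_ge0 ?exprn_ge0.
have B1 : 1 <= B by have := hB 0%N; rewrite big_geq.
have n0 N : 0 < `|pprod f N|.
  rewrite normr_gt0 /pprod; elim/big_ind: _ => // *; first exact: oner_neq0.
  exact: mulf_neq0.
exists (`|pprod f J| / (2%:R * B)).
  by rewrite divr_gt0 // mulr_gt0 ?ltr0n.
move=> N; rewrite ler_pdivrMr ?mulr_gt0 ?ltr0n //.
have [NJ|JN] := leqP N J.
  have -> : pprod f J = pprod f N * \prod_(N <= j < J) (1 - f j).
    by rewrite /pprod -(big_cat_nat (n := N)).
  rewrite normrM ler_wpM2l // normr_prod.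
  apply: le_trans (_ : \prod_(N <= j < J) (1 + A * r ^+ j) <= _).
    apply: ler_prod => j _; rewrite normr_ge0 /=; apply: le_trans (ler_normB _ _) _.
    by rewrite normr1 lerD2l.
  apply: le_trans (_ : \prod_(0 <= j < J) (1 + A * r ^+ j) <= _).
    rewrite [leRHS](big_cat_nat (n := N)) //= ler_peMl //.
      by apply: prodr_ge0 => j _; rewrite addr_ge0.
    elim/big_ind: _ => // [x y hx hy|i _]; last by rewrite lerDl.
    by rewrite -[1]mulr1 ler_pM.
  apply: le_trans (hB J) _; rewrite ler_peMl ?ler1n // ltW //.
have -> : pprod f N = pprod f J * \prod_(J <= j < N) (1 - f j).
  by rewrite /pprod -(big_cat_nat (n := J)) // ltnW.
rewrite normrM -mulrA ler_peMr ?normr_ge0 //.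
have [h2 _ h3] := hJ (N - J)%N.
have h4 : 2%:R^-1 <= `|\prod_(J <= j < N) (1 - f j)|.
  apply: le_trans h2 _; rewrite -[X in `|\prod_(X <= _ < _) _|]add0n big_addn normr_prod.
  apply: ler_prod => j _; rewrite subr_ge0 h3 /= addnC.
  apply: le_trans (lerB_normD _ _); rewrite normr1 normrN lerD2l lerN2.
  exact: hf.
apply: le_trans (_ : 2%:R^-1 * (2%:R * B) <= _).
  by rewrite mulrA mulVf ?mul1r // pnatr_eq0.
by rewrite ler_wpM2r // mulr_ge0 ?ler0n // ltW.
Qed.

Lemma pprod_cvg f : (forall j, `|f j| <= A * r ^+ j) ->
  exists l : K, pprod f @ \oo --> l.
Proof.
move=> hf; have [B B0 hB] := prod_upper A0 r0 r1.
apply: (@cvg_increments _ (B * A) r r0 r1) => n.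
rewrite pprodS; have -> : pprod f n * (1 - f n) - pprod f n = - (pprod f n * f n) by ring.
rewrite normrN normrM -mulrA ler_pM //.
exact: le_trans (pprod_le_majorant n hf) (hB n).
Qed.

(** The bound is uniform in N, since both the product and the sum on the right are bounded; this
    gives the continuity of theta. *)
Lemma pprod_lipschitz f g d N : 0 <= d ->
  (forall j, `|f j| <= A * r ^+ j) -> (forall j, `|g j| <= A * r ^+ j) ->
  (forall j, `|f j - g j| <= d * r ^+ j) ->
  `|pprod f N - pprod g N| <=
    d * (\prod_(0 <= j < N) (1 + A * r ^+ j)) * \sum_(0 <= j < N) r ^+ j.
Proof.
move=> d0 hf hg hfg; elim: N => [|N IH].
  by rewrite /pprod !big_geq // subrr normr0 mulr0.
rewrite !pprodS [X in _ <= _ * X * _]big_nat_recr //= [X in _ <= _ * X]big_nat_recr //=.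
have -> : pprod f N * (1 - f N) - pprod g N * (1 - g N) =
  (pprod f N - pprod g N) * (1 - f N) - pprod g N * (f N - g N) by ring.
set M := \prod_(_ <= _ < _) _ in IH *; set S := \sum_(_ <= _ < _) _ in IH *.
have rN : 0 <= r ^+ N by rewrite exprn_ge0.
have M0 : 0 <= M.
  by apply: prodr_ge0 => j _; rewrite addr_ge0 // mulr_ge0 ?exprn_ge0.
apply: le_trans (ler_normB _ _) _; rewrite !normrM.
have h1 : `|1 - f N| <= 1 + A * r ^+ N.
  by apply: le_trans (ler_normB _ _) _; rewrite normr1 lerD2l.
apply: le_trans (_ : d * M * S * (1 + A * r ^+ N) + M * (d * r ^+ N) <= _).
  apply: lerD; apply: ler_pM => //; exact: pprod_le_majorant.
have -> : d * (M * (1 + A * r ^+ N)) * (S + r ^+ N) =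
  d * M * S * (1 + A * r ^+ N) + (M * (d * r ^+ N) + M * (d * r ^+ N) * (A * r ^+ N)).
  by ring.
by rewrite lerD2l lerDl !mulr_ge0.
Qed.

End GeometricProduct.

(** * Theta: convergence, inversion, zeros and continuity *)

Section Theta.
Variable p : K.
Hypothesis p1 : `|p| < 1.

(** One minus the double factor (1 - p^j x)(1 - p^(j+1) / x), so that theta is the limit of a single
    [pprod]. *)
Definition theta_dev (x : K) (j : nat) : K :=
  p ^+ j * x + p ^+ j.+1 / x - p ^+ j * x * (p ^+ j.+1 / x).

Lemma theta_devE x : pprod (theta_dev x) =
  (fun N => \prod_(0 <= j < N) ((1 - p ^+ j * x) * (1 - p ^+ j.+1 / x))).
Proof.
by apply: funext => N; apply: eq_bigr => j _; rewrite /theta_dev; ring.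
Qed.

Lemma theta_dev_bound X Y x j : `|x| <= X -> `|x^-1| <= Y ->
  `|theta_dev x j| <= (X + Y + X * Y) * `|p| ^+ j.
Proof.
move=> xX xY; have X0 := le_trans (normr_ge0 _) xX; have Y0 := le_trans (normr_ge0 _) xY.
have pj : 0 <= `|p| ^+ j by rewrite exprn_ge0.
have pj1 : `|p| ^+ j.+1 <= `|p| ^+ j.
  by rewrite exprS ler_piMl // ltW.
have pj1' : `|p| ^+ j.+1 <= 1 by rewrite exprn_ile1 // ltW.
have e1 : `|p ^+ j * x| <= X * `|p| ^+ j by rewrite normrM normrX mulrC ler_wpM2r.
have e2 : `|p ^+ j.+1 / x| <= Y * `|p| ^+ j.
  by rewrite normrM normrX mulrC ler_pM // exprn_ge0.
have e3 : `|p ^+ j.+1 / x| <= Y.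
  by rewrite normrM normrX -[leRHS]mul1r ler_pM // exprn_ge0.
apply: le_trans (ler_normB _ _) _; rewrite [in leRHS]mulrDl; apply: lerD.
  by apply: le_trans (ler_normD _ _) _; rewrite mulrDl lerD.
by rewrite normrM -mulrA [Y * _]mulrC mulrA ler_pM.
Qed.

Lemma theta_cvg x : pprod (theta_dev x) @ \oo --> theta p x.
Proof.
have [l hl] := @pprod_cvg (`|x| + `|x^-1| + `|x| * `|x^-1|) `|p|
  (addr_ge0 (addr_ge0 (normr_ge0 _) (normr_ge0 _)) (mulr_ge0 (normr_ge0 _) (normr_ge0 _)))
  (normr_ge0 _) p1 (theta_dev x) (fun j => theta_dev_bound j (lexx _) (lexx _)).
suff -> : theta p x = l by [].
by rewrite /theta -theta_devE; apply: norm_cvg_lim.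
Qed.

Lemma theta_lim x l : pprod (theta_dev x) @ \oo --> l -> theta p x = l.
Proof. by move=> h; apply: norm_cvg_unique (@theta_cvg x) h. Qed.

Lemma theta_1 : theta p 1 = 0.
Proof.
apply: theta_lim; apply: (cvg_trans _ (@cvg_cst K (0 : K) nat \oo _)).
apply: near_eq_cvg; exists 1%N => // -[|N] //= _.
by rewrite /pprod big_nat_recl //= /theta_dev expr0 expr1 divr1; ring.
Qed.

Lemma theta_inv x : x != 0 -> theta p x^-1 = - (x^-1 * theta p x).
Proof.
move=> x0.
have cvgp : (fun n => p ^+ n) @ \oo --> (0 : K).
  apply/cvgr0Pnorm_lt => e e0.
  have /cvgr0Pnorm_lt /(_ e e0) := cvg_geo (normr_ge0 p) p1.
  by apply: filterS => n; rewrite !normrX normr_id.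
have c1 y : (fun n => 1 - p ^+ n * y) @ \oo --> (1 : K).
  rewrite -[X in _ --> X]subr0; apply: cvgB; first exact: cvg_cst.
  by rewrite -(mul0r y); apply: cvgM => //; exact: cvg_cst.
(* The partial products for x and 1/x share all factors but the extreme ones, and the correcting
   factors at p^N tend to 1. *)
have E N : pprod (theta_dev x^-1) N * (1 - p ^+ N * x^-1) =
    - (x^-1 * (pprod (theta_dev x) N * (1 - p ^+ N * x))).
  elim: N => [|N IH]; first by rewrite /pprod !big_geq // expr0; field.
  rewrite !pprodS.
  transitivity (pprod (theta_dev x^-1) N * (1 - p ^+ N * x^-1) *
     (1 - p ^+ N.+1 * x) * (1 - p ^+ N.+1 * x^-1)).
    by rewrite /theta_dev invrK; ring.
  by rewrite IH /theta_dev; ring.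
have h1 : (fun N => pprod (theta_dev x^-1) N * (1 - p ^+ N * x^-1)) @ \oo -->
    theta p x^-1 * 1 by apply: cvgM => //; exact: theta_cvg.
have h2 : (fun N => - (x^-1 * (pprod (theta_dev x) N * (1 - p ^+ N * x)))) @ \oo -->
    - (x^-1 * (theta p x * 1)).
  apply: cvgN; apply: cvgM; first exact: cvg_cst.
  by apply: cvgM => //; exact: theta_cvg.
rewrite !mulr1 in h1 h2; rewrite (funext E) in h1.
exact: norm_cvg_unique h1 h2.
Qed.

Lemma theta_neq0 x : (forall j, 1 - p ^+ j * x != 0) ->
  (forall j, 1 - p ^+ j.+1 * x^-1 != 0) -> theta p x != 0.
Proof.
move=> h1 h2.
have [||c c0 hc] := @pprod_lower (`|x| + `|x^-1| + `|x| * `|x^-1|) `|p|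
  (addr_ge0 (addr_ge0 (normr_ge0 _) (normr_ge0 _)) (mulr_ge0 (normr_ge0 _) (normr_ge0 _)))
  (normr_ge0 _) p1 (theta_dev x).
- by move=> j; apply: theta_dev_bound.
- move=> j; have -> : 1 - theta_dev x j = (1 - p ^+ j * x) * (1 - p ^+ j.+1 * x^-1).
    by rewrite /theta_dev; ring.
  exact: mulf_neq0.
apply: contraTneq isT => t0; have := @theta_cvg x; rewrite t0.
move=> /cvgr0Pnorm_lt /(_ c c0) [N _ hN].
have := hN N (leqnn N) => /= lt.
by have := le_lt_trans (hc N) lt; rewrite ltxx.
Qed.

Lemma theta_continuous (u : nat -> K) x : x != 0 -> u @ \oo --> x ->
  (fun n => theta p (u n)) @ \oo --> theta p x.
Proof.
move=> x0 ux.
have ux' : (fun n => (u n)^-1) @ \oo --> x^-1 by apply: cvgV.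
pose X := `|x| + 1; pose Y := `|x^-1| + 1; pose A := X + Y + X * Y.
have A0 : 0 <= A by rewrite /A /X /Y !(addr_ge0, mulr_ge0).
have [B B0 hB] := prod_upper A0 (normr_ge0 p) p1.
have r1 : 0 < 1 - `|p| by rewrite subr_gt0.
pose C := B * (1 - `|p|)^-1.
have C0 : 0 < C by rewrite mulr_gt0 ?invr_gt0.
apply/cvgrPdist_lt => e e0.
have e4 : 0 < e / 4%:R by rewrite divr_gt0 ?ltr0n.
have ed : 0 < e / 4%:R / C by rewrite divr_gt0.
move/cvgrPdist_lt : ux => ux; move/cvgrPdist_lt : ux' => ux'.
have a1 := ux _ ltr01; have a2 := ux' _ ltr01.
have a5 : \forall n \near \oo, `|x - u n| < `|x| by apply: ux; rewrite normr_gt0.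
have a3 := ux _ ed; have a4 := ux' _ ed.
near=> n.
have b1 : `|u n| <= X.
  have : `|x - u n| < 1 by near: n.
  move=> /ltW h; have -> : u n = x - (x - u n) by ring.
  by apply: le_trans (ler_normB _ _) _; rewrite lerD2l.
have b2 : `|(u n)^-1| <= Y.
  have : `|x^-1 - (u n)^-1| < 1 by near: n.
  move=> /ltW h; have -> : (u n)^-1 = x^-1 - (x^-1 - (u n)^-1) by ring.
  by apply: le_trans (ler_normB _ _) _; rewrite lerD2l.
have c1 : `|x| <= X by rewrite lerDl.
have c2 : `|x^-1| <= Y by rewrite lerDl.
have b3 : `|x - u n| < e / 4%:R / C by near: n.
have b4 : `|x^-1 - (u n)^-1| < e / 4%:R / C by near: n.
pose d := `|x - u n| + `|x^-1 - (u n)^-1|.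
have d0 : 0 <= d by rewrite addr_ge0.
have hd j : `|theta_dev x j - theta_dev (u n) j| <= d * `|p| ^+ j.
  have un0 : u n != 0.
    have : `|x - u n| < `|x| by near: n.
    by apply: contraTneq => ->; rewrite subr0 ltxx.
  (* The mixed term of [theta_dev] is p^j p^(j+1) for every nonzero argument, so it cancels. *)
  have -> : theta_dev x j - theta_dev (u n) j =
      p ^+ j * (x - u n) + p ^+ j.+1 * (x^-1 - (u n)^-1).
    by rewrite /theta_dev; field; rewrite x0 un0.
  apply: le_trans (ler_normD _ _) _; rewrite !normrM !normrX mulrDl.
  rewrite [`|x - u n| * _]mulrC [`|x^-1 - _| * _]mulrC lerD2l ler_wpM2r //.
  by rewrite exprS ler_piMl ?exprn_ge0 // ltW.
have lip N : `|pprod (theta_dev x) N - pprod (theta_dev (u n)) N| <= d * C.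
  apply: le_trans (@pprod_lipschitz A `|p| A0 (normr_ge0 p) (theta_dev x) (theta_dev (u n)) d N d0 _ _ hd) _.
  - by move=> j; apply: theta_dev_bound.
  - by move=> j; apply: theta_dev_bound.
  rewrite -mulrA ler_wpM2l // /C ler_pM //.
  - apply: prodr_ge0 => j _; rewrite addr_ge0 // mulr_ge0 ?exprn_ge0 //.
  - by apply: sumr_ge0 => j _; rewrite exprn_ge0.
  - exact: sum_geo_le.
have dC : d * C < e / 4%:R + e / 4%:R.
  by rewrite /d mulrDl ltrD // -ltr_pdivlMr.
have /cvgrPdist_lt /(_ _ e4) [N1 _ hN1] := @theta_cvg x.
have /cvgrPdist_lt /(_ _ e4) [N2 _ hN2] := @theta_cvg (u n).
have /= k1 := hN1 (maxn N1 N2) (leq_maxl _ _).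
have /= k2 := hN2 (maxn N1 N2) (leq_maxr _ _).
set P := pprod _ _ in k1; set Q := pprod _ _ in k2.
have -> : theta p x - theta p (u n) =
  (theta p x - P) + (P - Q) - (theta p (u n) - Q) by ring.
apply: le_lt_trans (ler_normB _ _) _.
have -> : e = (e / 4%:R + (e / 4%:R + e / 4%:R)) + e / 4%:R.
  by field.
apply: ltrD => //; apply: le_lt_trans (ler_normD _ _) _; apply: ltrD => //.
exact: le_lt_trans (lip _) dC.
Unshelve. all: by end_near. Qed.

(** From some J on |p^j u_n| <= 1/2, uniformly in n, so only finitely many factors can vanish and
    each is treated separately. *)
Lemma factors_isolated (u : nat -> K) x : u @ \oo --> x -> (forall n, u n != x) ->
  \forall n \near \oo, forall j, 1 - p ^+ j * u n != 0.
Proof.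
move=> cu un; move: (cu) => /cvgrPdist_lt ux.
have X0 : 0 <= `|x| + 1 by rewrite addr_ge0.
have h2 : 0 < (2%:R^-1 : K) by rewrite invr_gt0 ltr0n.
have [J hJ] := geo_small X0 (normr_ge0 p) p1 h2.
have small : \forall n \near \oo, forall j, (j < J)%N -> 1 - p ^+ j * u n != 0.
  elim: J {hJ} => [|J IH]; first by near=> n.
  suff hJ : \forall n \near \oo, 1 - p ^+ J * u n != 0.
    near=> n => j; rewrite ltnS leq_eqVlt => /predU1P[->|].
      by near: n.
    by move: j; near: n.
  (* If x is itself a zero of the factor then p^J != 0 and x is its only zero, which u avoids;
     otherwise continuity decides. *)
  have [e|ne] := eqVneq (1 - p ^+ J * x) 0.
    near=> n; apply: contra_neq (un n) => e'.
    have pJ : p ^+ J != 0.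
      by apply: contra_eqN e => /eqP->; rewrite mul0r subr0 oner_neq0.
    by apply: (mulfI pJ); apply: (@subrI _ 1); rewrite e e'.
  apply: (cvgr_neq0 (1 - p ^+ J * x)) => //.
  by apply: cvgB; [exact: cvg_cst|apply: cvgM => //; exact: cvg_cst].
have a1 := ux _ ltr01.
near=> n => j.
have [jJ|Jj] := ltnP j J.
  by move: j jJ; near: n.
have b1 : `|u n| <= `|x| + 1.
  have : `|x - u n| < 1 by near: n.
  move=> /ltW h; have -> : u n = x - (x - u n) by ring.
  by apply: le_trans (ler_normB _ _) _; rewrite lerD2l.
have lt : `|p ^+ j * u n| < 1.
  apply: le_lt_trans (_ : 2%:R^-1 < 1); last by rewrite invf_lt1 ?ltr0n // ltr1n.
  apply: le_trans hJ; rewrite normrM normrX mulrC ler_pM ?exprn_ge0 //.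
  by rewrite ler_wiXn2l // ltW.
apply: contraTneq lt => /eqP; rewrite subr_eq0 => /eqP <-.
by rewrite normr1 ltxx.
Unshelve. all: by end_near. Qed.

Lemma theta_isolated (u : nat -> K) x : x != 0 -> u @ \oo --> x ->
  (forall n, u n != x) -> \forall n \near \oo, theta p (u n) != 0.
Proof.
move=> x0 ux un.
have h1 := factors_isolated ux un.
have h2 : \forall n \near \oo, forall j, 1 - p ^+ j * (u n)^-1 != 0.
  apply: (@factors_isolated (fun n => (u n)^-1) x^-1).
    exact: cvgV.
  by move=> n; apply: contra_neq (un n) => /invr_inj.
near=> n; apply: theta_neq0; first by near: n.
by move=> j; move: j.+1; near: n.
Unshelve. all: by end_near. Qed.

End Theta.

(** * The Jacobi triple product *)

Section JacobiTripleProduct.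
Variable rho : K.
Hypotheses (rho0 : rho != 0) (rho1 : `|rho| < 1).
Let p := rho ^+ 2.

Lemma p_neq0 : p != 0. Proof. exact: expf_neq0. Qed.

Lemma norm_p_lt1 : `|p| < 1.
Proof. by rewrite normrX exprn_ilt1. Qed.

Definition qfact n : K := pprod (fun j => p ^+ j.+1) n.

(** The Gaussian binomial coefficient of base p, by its Pascal rule. The exponent n' - i' is
    truncated only where [qbin n' i'] is 0. *)
Fixpoint qbin n i : K :=
  match n, i with
  | _, 0 => 1
  | 0, _.+1 => 0
  | n'.+1, i'.+1 => qbin n' i'.+1 + p ^+ (n' - i') * qbin n' i'
  end.

Lemma qbin0 n : qbin n 0 = 1. Proof. by case: n. Qed.

Lemma qbin_small n i : (n < i)%N -> qbin n i = 0.
Proof.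
elim: n i => [|n IH] [|i] //=; rewrite ltnS => ni.
by rewrite !IH ?mulr0 ?addr0 // ltnS ltnW.
Qed.

Lemma qbin_theorem n X :
  \prod_(0 <= j < n) (1 + p ^+ j * X) =
  \sum_(0 <= i < n.+1) p ^+ 'C(i, 2) * qbin n i * X ^+ i.
Proof.
elim: n => [|n IH].
  by rewrite big_geq // big_nat1 expr0 !mulr1.
rewrite big_nat_recr //= IH [RHS]big_nat_recl //= !mulr1.
have -> : \sum_(0 <= i < n.+1) p ^+ 'C(i.+1, 2) *
      (qbin n i.+1 + p ^+ (n - i) * qbin n i) * X ^+ i.+1 =
  \sum_(0 <= i < n.+1) p ^+ 'C(i.+1, 2) * qbin n i.+1 * X ^+ i.+1 +
  p ^+ n * X * \sum_(0 <= i < n.+1) p ^+ 'C(i, 2) * qbin n i * X ^+ i.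
  rewrite big_distrr -big_split /= !big_nat; apply: eq_bigr => i /andP[_].
  rewrite ltnS => ni.
  have -> : p ^+ n = p ^+ (n - i) * p ^+ i by rewrite -exprD subnK.
  rewrite binS bin1 exprD [X ^+ i.+1]exprS; ring.
have -> : \sum_(0 <= i < n.+1) p ^+ 'C(i.+1, 2) * qbin n i.+1 * X ^+ i.+1 =
  (\sum_(0 <= i < n.+1) p ^+ 'C(i, 2) * qbin n i * X ^+ i) - 1.
  rewrite [X in _ = X - _]big_nat_recl //= qbin0 !mulr1 expr0 addrC addKr.
  by rewrite big_nat_recr //= qbin_small // mulr0 mul0r addr0.
by rewrite expr0; ring.
Qed.

Lemma qfactS n : qfact n.+1 = qfact n * (1 - p ^+ n.+1).
Proof. exact: pprodS. Qed.

Lemma qbin_fact n i : (i <= n)%N -> qbin n i * (qfact i * qfact (n - i)) = qfact n.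
Proof.
have q00 : qfact 0 = 1 by rewrite /qfact /pprod big_geq.
elim: n i => [|n IH] [|i] //=; rewrite ?q00 ?mul1r ?subn0 //.
rewrite ltnS subSS => ni; have [->|ne] := eqVneq i n.
  have := IH n (leqnn n); rewrite !subnn (@qbin_small n n.+1) // q00 expr0 add0r mul1r !mulr1.
  by rewrite qfactS mulrA => ->.
have ltn : (i < n)%N by rewrite ltn_neqAle ne.
have h1 := IH i.+1 ltn; have h2 := IH i ni.
have nE : (n - i = (n - i.+1).+1)%N by rewrite subnSK.
rewrite mulrDl {1}nE [qfact (n - i.+1).+1]qfactS.
have -> : qbin n i.+1 * (qfact i.+1 * (qfact (n - i.+1) * (1 - p ^+ (n - i.+1).+1))) =
   qfact n * (1 - p ^+ (n - i.+1).+1) by rewrite -h1; ring.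
rewrite -nE.
have -> : p ^+ (n - i) * qbin n i * (qfact i.+1 * qfact (n - i)) =
   qfact n * (p ^+ (n - i) * (1 - p ^+ i.+1)) by rewrite qfactS -h2; ring.
rewrite qfactS; have -> : p ^+ n.+1 = p ^+ (n - i) * p ^+ i.+1.
  by rewrite -exprD addnS subnK.
ring.
Qed.

Definition zrange (N : nat) : seq int := [seq (Posz i - Posz N) | i <- iota 0 (2 * N).+1].

(* Up to a constant factor, theta p x is the bilateral sum of these terms; writing
   p = rho ^+ 2 avoids halving the exponent k ^ 2 - k. *)
Definition jterm (x : K) (k : int) : K := (- x) ^ k * rho ^ (k * k - k).

Lemma rho_exprz_p (k : int) n : rho ^ (k + n%:Z *+ 2) = rho ^ k * p ^+ n.
Proof. by rewrite expfzDr // -mulr_natl -PoszM -exprnP exprM. Qed.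

Lemma rho_bin i : rho ^ (i%:Z * i%:Z - i%:Z) = p ^+ 'C(i, 2).
Proof.
elim: i => [|i IH]; first by rewrite mulr0 subr0 expr0z bin0n expr0.
rewrite binS bin1 exprD -IH -rho_exprz_p; congr (_ ^ _).
by rewrite -natz; ring.
Qed.

Lemma prod_rho_inv x N : x != 0 ->
  \prod_(0 <= j < N) - (p ^+ j.+1 / x) =
  rho ^ (N%:Z * N%:Z + N%:Z) * (- x) ^- N.
Proof.
move=> x0; elim: N => [|N IH].
  by rewrite big_geq // mulr0 addr0 expr0z expr0 mul1r invr1.
rewrite big_nat_recr //= IH.
have -> : N.+1%:Z * N.+1%:Z + N.+1%:Z = N%:Z * N%:Z + N%:Z + N.+1%:Z *+ 2 :> int.
  by ring.
rewrite rho_exprz_p [(- x) ^+ N.+1]exprS; field.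
by rewrite expf_neq0 ?oppr_eq0 // x0.
Qed.

Lemma jterm_shift x N i : x != 0 ->
  jterm x (Posz i - Posz N) =
  \prod_(0 <= j < N) - (p ^+ j.+1 / x) * (p ^+ 'C(i, 2) * (- x / p ^+ N) ^+ i).
Proof.
move=> x0; have nx0 : - x != 0 by rewrite oppr_eq0.
rewrite prod_rho_inv // -rho_bin /jterm expfzDr // exprnN.
have -> : (i%:Z - N%:Z) * (i%:Z - N%:Z) - (i%:Z - N%:Z) =
  (N%:Z * N%:Z + N%:Z) + (i%:Z * i%:Z - i%:Z) + - ((N * i)%:Z *+ 2).
  by rewrite PoszM; ring.
have pN0 : p ^+ (N * i) != 0 by rewrite expf_neq0 // p_neq0.
have -> (k : int) : rho ^ (k - (N * i)%:Z *+ 2) = rho ^ k / p ^+ (N * i).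
  by rewrite -[k in RHS](subrK ((N * i)%:Z *+ 2)) rho_exprz_p mulfK.
rewrite expfzDr // [X in _ = _ * (_ * X)]expr_div_n -[p ^+ N ^+ i]exprM -[(- x) ^+ i]/((- x) ^ i).
ring.
Qed.

(** The q-binomial theorem for 2 N factors at X = - x / p^N: the upper half of the product gives the
    1 - p^j x, and the lower half, reversed and rid of its monomials, the 1 - p^(j+1) / x. *)
Lemma finite_jacobi x N : x != 0 ->
  pprod (theta_dev p x) N =
  \sum_(k <- zrange N) qbin (2 * N) `|(k + Posz N)%R|%N * jterm x k.
Proof.
move=> x0; have p0 := p_neq0.
rewrite theta_devE /zrange big_map.
have -> : iota 0 (2 * N).+1 = index_iota 0 (2 * N).+1 by rewrite /index_iota subn0.
transitivity (\prod_(0 <= j < N) (- (p ^+ j.+1 / x)) *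
    \prod_(0 <= j < 2 * N) (1 + p ^+ j * (- x / p ^+ N))).
  rewrite mul2n -addnn [\prod_(0 <= j < N + N) _](big_cat_nat (n := N)) ?leq_addr //= mulrA.
  rewrite [X in _ = _ * X * _]big_nat_rev /= -big_split /=.
  rewrite -{5}[N]add0n big_addn addnK -big_split /=.
  rewrite !big_nat; apply: eq_bigr => j /andP[_ jN].
  rewrite add0n exprD -[in RHS](subnK jN) addnK exprD.
  by field; rewrite x0 !expf_neq0.
rewrite (qbin_theorem (2 * N) (- x / p ^+ N)) big_distrr /=.
apply: eq_bigr => i _.
by rewrite subrK absz_nat jterm_shift //; ring.
Qed.

Lemma zrange_uniq N : uniq (zrange N).
Proof.
rewrite map_inj_uniq ?iota_uniq // => i j /addIr; by case.
Qed.

Lemma mem_zrange N (k : int) : (k \in zrange N) = (`|k|%N <= N)%N.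
Proof.
apply/mapP/idP => [[j]|kN].
  by rewrite mem_iota add0n => /andP[_ jN] ->; move: jN; clear; lia.
exists `|(k + Posz N)%R|%N; last by move: kN; clear; lia.
by rewrite mem_iota add0n; move: kN; clear; lia.
Qed.

Lemma size_zrange N : size (zrange N) = (2 * N).+1.
Proof. by rewrite size_map size_iota. Qed.

(** The quadratic exponent beats every geometric rate: |rho|^n X <= e from n = J on, and the
    finitely many earlier terms are absorbed in (X / e)^J. *)
Lemma jterm_bound x e : x != 0 -> 0 < e -> e <= 1 ->
  exists2 C, 0 <= C & forall k : int, `|jterm x k| <= C * e ^+ `|k|%N.
Proof.
move=> x0 e0 e1.
pose s := `|rho|; have s0 : 0 < s by rewrite normr_gt0.
have s1 : s <= 1 by rewrite ltW.
pose X := `|x| + `|x^-1| + 1.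
have X1 : 1 <= X by rewrite /X lerDr addr_ge0.
have X0 : 0 <= X := le_trans ler01 X1.
have [J hJ] := geo_small X0 (ltW s0) rho1 e0.
have Xe : 1 <= X / e by rewrite ler_pdivlMr // mul1r; apply: le_trans X1.
have key n : s ^+ (n * n.-1) * X ^+ n <= (X / e) ^+ J * e ^+ n.
  case: n => [|n]; first by rewrite !expr0 !mulr1 exprn_ege1.
  rewrite /= mulnC exprM -exprMn.
  have [nJ|Jn] := ltnP n J.
    apply: le_trans (_ : X ^+ n.+1 <= _).
      rewrite lerXn2r ?nnegrE ?mulr_ge0 ?exprn_ge0 // ?(ltW s0) //.
      by rewrite ler_piMl // exprn_ile1 // ltW.
    apply: le_trans (_ : (X / e) ^+ n.+1 * e ^+ n.+1 <= _).
      by rewrite -exprMn divfK // gt_eqF.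
    by rewrite ler_wpM2r ?exprn_ge0 ?(ltW e0) // ler_weXn2l.
  apply: le_trans (_ : e ^+ n.+1 <= _).
    rewrite lerXn2r ?nnegrE ?mulr_ge0 ?exprn_ge0 ?(ltW s0) ?(ltW e0) //.
    apply: le_trans hJ; rewrite mulrC ler_wpM2l // ler_wiXn2l // ltW //.
  by rewrite ler_peMl ?exprn_ge0 ?(ltW e0) // exprn_ege1.
exists ((X / e) ^+ J); first by rewrite exprn_ge0 // (le_trans ler01).
move=> k; apply: le_trans (key `|k|%N); rewrite /jterm normrM mulrC.
have xk : `|(- x) ^ k| <= X ^+ `|k|%N.
  case: k => n /=.
    rewrite -exprnP normrX normrN lerXn2r ?nnegrE //.
    by rewrite /X -addrA lerDl addr_ge0.
  rewrite NegzE -exprnN normrV ?unitfE ?expf_neq0 ?oppr_eq0 // normrX normrN.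
  rewrite -exprVn -normfV /= lerXn2r ?nnegrE //.
  by rewrite /X addrAC lerDr addr_ge0.
have rk : `|rho ^ (k * k - k)| <= s ^+ (`|k| * `|k|.-1)%N.
  case: k {xk} => n.
    have -> : Posz n * Posz n - Posz n = Posz (n * n.-1)%N.
      by case: n => // n; rewrite PoszM /=; move: n; clear; nia.
    by rewrite -exprnP normrX.
  have -> : Negz n * Negz n - Negz n = Posz (n.+1 * n + 2 * n.+1)%N.
    by clear; nia.
  rewrite -exprnP normrX exprD /= ler_piMr ?exprn_ge0 ?(ltW s0) //.
  by rewrite exprn_ile1 // ltW.
by rewrite ler_pM.
Qed.

Lemma qfact_bounds : exists B c, [/\ 0 < B, 0 < c,
  forall n, c <= `|qfact n| <= B &
  forall n l, `|qfact (n + l) - qfact n| <= B * `|p| ^+ n].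
Proof.
have r0 := normr_ge0 p; have r1 := norm_p_lt1.
have hb j : `|p ^+ j.+1| <= 1 * `|p| ^+ j.
  by rewrite mul1r normrX exprS ler_piMl ?exprn_ge0 // ltW.
have hn j : 1 - p ^+ j.+1 != 0.
  rewrite subr_eq0 eq_sym; apply: contraTneq (norm_p_lt1) => e.
  have : `|p| ^+ j.+1 = 1 by rewrite -normrX e normr1.
  move/eqP; rewrite pexpr_eq1 // => /eqP ->; by rewrite ltxx.
have [c c0 hc] := pprod_lower ler01 r0 r1 hb hn.
have [B B0 hB] := prod_upper (ler01 : 0 <= 1 :> K) r0 r1.
have r1' : 0 < 1 - `|p| by rewrite subr_gt0.
have B1 : 1 <= (1 - `|p|)^-1 by rewrite invf_ge1 // gerBl.
have qB n : `|qfact n| <= B.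
  exact: le_trans (pprod_le_majorant n hb) (hB n).
exists (B * (1 - `|p|)^-1), c; split=> //.
- by rewrite mulr_gt0 ?invr_gt0.
- move=> n; rewrite hc /=; apply: le_trans (qB n) _.
  by rewrite ler_peMr // ltW.
move=> n l.
apply: le_trans (_ : B * `|p| ^+ n * \sum_(0 <= j < l) `|p| ^+ j <= _); last first.
  rewrite -mulrA [leRHS]mulrAC -mulrA ler_wpM2l ?(ltW B0) //.
  by rewrite ler_wpM2l ?exprn_ge0 // sum_geo_le.
elim: l => [|l IH]; first by rewrite addn0 subrr normr0 big_geq // mulr0.
rewrite addnS qfactS big_nat_recr //= [leRHS]mulrDr.
have -> : qfact (n + l) * (1 - p ^+ (n + l).+1) - qfact n =
  (qfact (n + l) - qfact n) - qfact (n + l) * p ^+ (n + l).+1 by ring.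
apply: le_trans (ler_normB _ _) _; apply: lerD => //.
rewrite normrM -mulrA -exprD; apply: ler_pM => //.
by have := hb (n + l)%N; rewrite mul1r.
Qed.

(** As |p|^N = |rho|^N |rho|^N, one factor absorbs N: N |rho|^N is at most the geometric sum. *)
Lemma cvg_linear_geo : (fun N => (2 * N).+1%:R * `|p| ^+ N) @ \oo --> (0 : K).
Proof.
pose s := `|rho|; have s0 : 0 <= s := normr_ge0 _.
have s1' : 0 < 1 - s by rewrite subr_gt0.
have bnd N : N%:R * s ^+ N <= (1 - s)^-1.
  apply: le_trans (sum_geo_le N s0 rho1).
  rewrite mulr_natl -[N in _ *+ N]subn0 -sumr_const_nat !big_nat.
  apply: ler_sum => j /andP[_ jN].
  by apply: ler_wiXn2l; [|exact: ltW rho1|exact: ltnW].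
pose C := 2%:R * (1 - s)^-1 + 1.
have h : (fun N => C * s ^+ N) @ \oo --> (0 : K).
  rewrite -(mulr0 C); apply: cvgM; [exact: cvg_cst|exact: cvg_geo].
apply/cvgr0Pnorm_lt => e e0.
have /cvgr0Pnorm_lt /(_ e e0) := h.
apply: filterS => N; apply: le_lt_trans.
rewrite [leLHS]ger0_norm ?mulr_ge0 ?exprn_ge0 ?ler0n //.
rewrite [leRHS]ger0_norm; last first.
  by rewrite /C mulr_ge0 ?exprn_ge0 // addr_ge0 // mulr_ge0 // invr_ge0 ltW.
have -> : `|p| ^+ N = s ^+ N * s ^+ N.
  by rewrite /p normrX -exprM mulnC exprM expr2.
rewrite mulrA ler_wpM2r ?exprn_ge0 // -addn1 natrD mulrDl natrM -mulrA /C lerD //.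
  by rewrite ler_wpM2l.
by rewrite mul1r exprn_ile1 // ltW.
Qed.

(** In the quotient qfact(2N) / (qfact(N+l) qfact(N-l)) each factor of the denominator differs from
    qfact(N) by a multiple of |p|^(N-l) at most. *)
Lemma qbin_near_center : exists2 D, 0 <= D & forall N (k : int), (`|k| <= N)%N ->
  `|qbin (2 * N) `|(k + Posz N)%R|%N - qbin (2 * N) N| <= D * `|p| ^+ (N - `|k|).
Proof.
have [B [c [B0 c0 hq hd]]] := qfact_bounds.
have r0 := normr_ge0 p; have r1 := norm_p_lt1.
have qn n : qfact n != 0.
  by have /andP[h _] := hq n; rewrite -normr_gt0 (lt_le_trans c0).
have qB n : `|qfact n| <= B by have /andP[] := hq n.
have qc n : `|(qfact n)^-1| <= c^-1.
  rewrite normfV lef_pV2 ?posrE ?normr_gt0 //; by have /andP[] := hq n.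
have binE n i : (i <= n)%N -> qbin n i = qfact n * ((qfact i)^-1 * (qfact (n - i))^-1).
  by move=> /qbin_fact <-; rewrite -invfM mulfK // mulf_neq0.
exists (B * (B * B + B * B) * (c^-1 * c^-1 * (c^-1 * c^-1))).
  have B0' := ltW B0; have c0' : 0 <= c^-1 by rewrite invr_ge0 ltW.
  by rewrite !(mulr_ge0, addr_ge0).
move=> N k kN; set l := `|k|%N in kN *.
have -> : qbin (2 * N) `|(k + Posz N)%R|%N =
    qfact (2 * N) * ((qfact (N + l))^-1 * (qfact (N - l))^-1).
  have iN : (`|(k + Posz N)%R|%N <= 2 * N)%N by move: kN; rewrite /l; clear; lia.
  rewrite binE //; congr (_ * _).
  have [kp|kn] := leP 0 k.
    have -> : `|(k + Posz N)%R|%N = (N + l)%N by rewrite /l; move: kp; clear; lia.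
    by congr (_ * (qfact _)^-1); move: kN; clear; lia.
  have -> : `|(k + Posz N)%R|%N = (N - l)%N by rewrite /l; move: kn kN; rewrite /l; clear; lia.
  by rewrite mulrC; congr ((qfact _)^-1 * _); move: kN; clear; lia.
rewrite binE; last by clear; lia.
have -> : (2 * N - N = N)%N by clear; lia.
have -> : qfact (2 * N) * ((qfact (N + l))^-1 * (qfact (N - l))^-1) -
    qfact (2 * N) * ((qfact N)^-1 * (qfact N)^-1) =
  qfact (2 * N) * (qfact N * (qfact (N - l + l) - qfact (N - l)) -
    qfact (N - l) * (qfact (N + l) - qfact N)) *
  (((qfact (N + l))^-1 * (qfact (N - l))^-1) * ((qfact N)^-1 * (qfact N)^-1)).
  by rewrite subnK //; field; rewrite !qn.
have pl : 0 <= `|p| ^+ (N - l) by rewrite exprn_ge0.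
have pN : `|p| ^+ N <= `|p| ^+ (N - l) by rewrite ler_wiXn2l ?leq_subr // ltW.
have hd1 := hd (N - l)%N l; have hd2 := le_trans (hd N l) (ler_wpM2l (ltW B0) pN).
move: (`|p| ^+ (N - l)) pl hd1 hd2 => Q Q0 hd1 hd2.
rewrite [leRHS]mulrAC !normrM; apply: ler_pM; rewrite ?mulr_ge0 //.
- rewrite -[leRHS]mulrA; apply: ler_pM => //.
  apply: le_trans (ler_normB _ _) _; rewrite mulrDl !normrM -!mulrA; apply: lerD.
    exact: ler_pM.
  exact: ler_pM.
- by apply: ler_pM; rewrite ?mulr_ge0 //; apply: ler_pM.
Qed.

(** [kappa] is the infinite product of the 1 - p^(j+1). The central coefficient tends to its
    inverse, and replacing all coefficients of the finite identity by the central one costs an error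
    that tends to 0. *)
Lemma theta_series : exists2 kappa, kappa != 0 & forall x, x != 0 ->
  (fun N => \sum_(k <- zrange N) jterm x k) @ \oo --> kappa * theta p x.
Proof.
have [B [c [B0 c0 hq hd]]] := qfact_bounds.
have [D D0 hD] := qbin_near_center.
have r0 := normr_ge0 p; have r1 := norm_p_lt1.
have qn n : qfact n != 0.
  by have /andP[h _] := hq n; rewrite -normr_gt0 (lt_le_trans c0).
have [P hP] : exists l : K, qfact @ \oo --> l.
  apply: (@pprod_cvg 1 `|p|) => // j.
  by rewrite mul1r normrX exprS ler_piMl ?exprn_ge0 // ltW.
have P0 : P != 0.
  apply: contraTneq isT => P0; move: hP; rewrite P0.
  move=> /cvgr0Pnorm_lt /(_ c c0) [N _ hN].
  have := hN N (leqnn N) => /= lt; have /andP[le _] := hq N.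
  by have := le_lt_trans le lt; rewrite ltxx.
have hP2 : (fun N => qfact (2 * N)) @ \oo --> P.
  move/cvgrPdist_lt : hP => hP; apply/cvgrPdist_lt => e /hP [N _ hN].
  exists N => // M /= NM; apply: hN => /=; move: NM; clear; lia.
have binc N : qbin (2 * N) N = qfact (2 * N) / (qfact N * qfact N).
  have -> : qfact (2 * N) = qbin (2 * N) N * (qfact N * qfact N).
    by rewrite -(@qbin_fact (2 * N) N) ?leq_pmull // mul2n -addnn addnK.
  by rewrite mulfK // mulf_neq0.
have hbin : (fun N => (qbin (2 * N) N)^-1) @ \oo --> P.
  have -> : (fun N => (qbin (2 * N) N)^-1) =
      (fun N => qfact N * qfact N * (qfact (2 * N))^-1).
    by apply: funext => N; rewrite binc invf_div.
  have -> : P = P * P * P^-1 by rewrite mulfK.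
  by apply: cvgM; [exact: cvgM|exact: cvgV].
exists P => // x x0.
have p0 : 0 < `|p| by rewrite normr_gt0 p_neq0.
(* The rate |p| is chosen so that |p|^|k| compensates |p|^(N-|k|) from [qbin_near_center]: each of
   the 2 N + 1 errors is at most D C |p|^N. *)
have [C C0 hC] := jterm_bound x0 p0 (ltW r1).
pose err N := pprod (theta_dev p x) N - qbin (2 * N) N * \sum_(k <- zrange N) jterm x k.
have herr : err @ \oo --> (0 : K).
  have h : (fun N => D * C * ((2 * N).+1%:R * `|p| ^+ N)) @ \oo --> (0 : K).
    rewrite -(mulr0 (D * C)); apply: cvgM; [exact: cvg_cst|exact: cvg_linear_geo].
  apply/cvgr0Pnorm_lt => e e0.
  have /cvgr0Pnorm_lt /(_ e e0) := h.
  apply: filterS => N; apply: le_lt_trans.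
  rewrite [leRHS]ger0_norm; last by rewrite !mulr_ge0 ?exprn_ge0 ?ler0n.
  rewrite /err finite_jacobi // big_distrr /= -sumrB.
  apply: le_trans (ler_norm_sum _ _ _) _.
  apply: le_trans (_ : \sum_(k <- zrange N) (D * C * `|p| ^+ N) <= _).
    rewrite big_seq [leRHS]big_seq; apply: ler_sum => k; rewrite mem_zrange => kN.
    rewrite -mulrBl normrM -[in leRHS](subnK kN) exprD mulrACA.
    by apply: ler_pM => //; exact: hD.
  by rewrite big_const_seq count_predT size_zrange iter_addr_0 -[X in X <= _]mulr_natl mulrCA.
have E : (fun N => \sum_(k <- zrange N) jterm x k) =
    (fun N => (qbin (2 * N) N)^-1 * (pprod (theta_dev p x) N - err N)).
  apply: funext => N; rewrite /err opprB addrC subrK mulKf //.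
  by rewrite binc mulf_neq0 // invr_eq0 mulf_neq0.
rewrite E -[theta p x]subr0; apply: cvgM => //; apply: cvgB => //.
exact: (@theta_cvg p r1 x).
Qed.

End JacobiTripleProduct.

(** * Parity splitting of a product of two theta series *)

Section AdditionFormula.
Variable rho : K.
Hypotheses (rho0 : rho != 0) (rho1 : `|rho| < 1).
Local Notation p := (rho ^+ 2).
Implicit Types (k l : int).

Lemma p_expz k : p ^ k = rho ^ (k *+ 2).
Proof. by rewrite -[rho ^+ 2]/(rho ^ Posz 2) exprz_exp; congr (_ ^ _); ring. Qed.

Section Split.
Variables (x y : K).
Hypotheses (x0 : x != 0) (y0 : y != 0).

Definition pterm (nm : int * int) : K :=
  jterm rho (x * y) nm.1 * jterm rho (x / y) nm.2.

Let xy0 : - (x * y) != 0. Proof. by rewrite oppr_eq0 mulf_neq0. Qed.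
Let xVy0 : - (x / y) != 0. Proof. by rewrite oppr_eq0 mulf_neq0 ?invr_eq0. Qed.

(** The substitution (n, m) = (k + l, k - l) separates the variables: n^2 - n + m^2 - m = 2 (k^2 -
    k) + 2 (l^2 - l) + 2 l, and the last summand produces the factor p in the second argument. In
    [pterm_odd] it is 2 k that is left over. *)
Lemma pterm_even k l : pterm (k + l, k - l) =
  jterm p (- x ^+ 2) k * jterm p (- (p * y ^+ 2)) l.
Proof.
rewrite /pterm /jterm /= !opprK !(expfzDr _ _ xy0) !(expfzDr _ _ xVy0).
rewrite -[(- (x / y)) ^ (- l)]invr_expz [(p * y ^+ 2) ^ l]expfzMl.
have e1 : (- (x * y)) ^ k * (- (x / y)) ^ k = (x ^+ 2) ^ k.
  by rewrite -expfzMl; congr (_ ^ _); field.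
have e2 : (- (x * y)) ^ l * ((- (x / y)) ^ l)^-1 = (y ^+ 2) ^ l.
  by rewrite invr_expz -exprz_inv -expfzMl; congr (_ ^ _); field; rewrite x0 y0.
have e3 : rho ^ ((k + l) * (k + l) - (k + l)) * rho ^ ((k - l) * (k - l) - (k - l)) =
    p ^ (k * k - k) * p ^ l * p ^ (l * l - l).
  rewrite !p_expz -!(expfzDr _ _ rho0); congr (_ ^ _); ring.
transitivity (((- (x * y)) ^ k * (- (x / y)) ^ k) *
   ((- (x * y)) ^ l * ((- (x / y)) ^ l)^-1) *
   (rho ^ ((k + l) * (k + l) - (k + l)) * rho ^ ((k - l) * (k - l) - (k - l)))).
  by ring.
by rewrite e1 e2 e3; ring.
Qed.

Lemma pterm_odd k l : pterm (k - l + 1, k + l) =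
  - (x * y) * (jterm p (- (p * x ^+ 2)) k * jterm p (- y ^- 2) l).
Proof.
rewrite /pterm /jterm /= !opprK !(expfzDr _ _ xy0) !(expfzDr _ _ xVy0) expr1z.
rewrite -[(- (x * y)) ^ (- l)]invr_expz [(p * x ^+ 2) ^ k]expfzMl.
have e1 : (- (x * y)) ^ k * (- (x / y)) ^ k = (x ^+ 2) ^ k.
  by rewrite -expfzMl; congr (_ ^ _); field.
have e2 : (- (x / y)) ^ l * ((- (x * y)) ^ l)^-1 = (y ^- 2) ^ l.
  by rewrite invr_expz -exprz_inv -expfzMl; congr (_ ^ _); field; rewrite x0 y0.
have e3 : rho ^ ((k - l + 1) * (k - l + 1) - (k - l + 1)) *
    rho ^ ((k + l) * (k + l) - (k + l)) = p ^ k * p ^ (k * k - k) * p ^ (l * l - l).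
  rewrite !p_expz -!(expfzDr _ _ rho0); congr (_ ^ _); ring.
transitivity (- (x * y) * ((- (x * y)) ^ k * (- (x / y)) ^ k) *
   ((- (x / y)) ^ l * ((- (x * y)) ^ l)^-1) *
   (rho ^ ((k - l + 1) * (k - l + 1) - (k - l + 1)) *
    rho ^ ((k + l) * (k + l) - (k + l)))).
  by ring.
by rewrite e1 e2 e3; ring.
Qed.

End Split.

Definition box N := [seq (n, m) | n <- zrange N, m <- zrange N].
Definition even_points N := [seq (k + l, k - l) | k <- zrange N, l <- zrange N].
Definition odd_points N := [seq (k - l + 1, k + l) | k <- zrange N, l <- zrange N].
Definition in_box N (nm : int * int) := (`|nm.1| <= N)%N && (`|nm.2| <= N)%N.

(** Each (n, m) in the box has exactly one preimage, under the even or the odd substitution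
    according to the parity of n + m, and its coordinates k, l are again at most N in absolute
    value. *)
Lemma perm_box N :
  perm_eq (box N) [seq nm <- even_points N ++ odd_points N | in_box N nm].
Proof.
have uz := zrange_uniq N.
apply: uniq_perm.
- by apply: allpairs_uniq => // -[? ?] [? ?] _ _ [-> ->].
- apply: filter_uniq; rewrite cat_uniq; apply/and3P; split.
  + apply: allpairs_uniq => // -[k l] [k' l'] _ _ /= [e1 e2].
    by congr (_, _); move: e1 e2; clear; lia.
  + apply/hasPn => _ /allpairsPdep[k [l [_ _ ->]]].
    apply/negP => /allpairsPdep[k' [l' [_ _ [e1 e2]]]].
    by move: e1 e2; clear; lia.
  + apply: allpairs_uniq => // -[k l] [k' l'] _ _ /= [e1 e2].
    by congr (_, _); move: e1 e2; clear; lia.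
move=> [n m]; rewrite mem_filter [_ \in even_points N ++ _]mem_cat.
rewrite -[in_box N (n, m)]/((`|n| <= N)%N && (`|m| <= N)%N).
rewrite /box /even_points /odd_points.
apply/idP/idP.
  move/allpairsPdep => [n' [m' [+ + [-> ->]]]]; rewrite !mem_zrange => nN mN.
  rewrite nN mN !andTb.
  have [k] : exists k : int, n' + m' = k *+ 2 \/ n' + m' = k *+ 2 + 1.
    exists ((n' + m') %/ 2)%Z; have := divz_eq (n' + m') 2.
    have := @ltz_pmod (n' + m') 2 isT; have := @modz_ge0 (n' + m') 2 isT.
    by clear; lia.
  case=> e; apply/orP; [left|right]; apply/allpairsPdep.
    exists k, (n' - k); rewrite !mem_zrange; split.
    - by move: e nN mN; clear; lia.
    - by move: e nN mN; clear; lia.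
    - by congr (_, _); move: e; clear; lia.
  exists k, (m' - k); rewrite !mem_zrange; split.
  - by move: e nN mN; clear; lia.
  - by move: e nN mN; clear; lia.
  - by congr (_, _); move: e; clear; lia.
move=> /andP[/andP[nN mN] _]; apply/allpairsPdep; exists n, m.
by rewrite !mem_zrange.
Qed.

Lemma sum_pairs (F G : int -> K) N :
  (\sum_(k <- zrange N) F k) * (\sum_(l <- zrange N) G l) =
  \sum_(nm <- box N) F nm.1 * G nm.2.
Proof.
rewrite big_distrl /= big_allpairs_dep /=; apply: eq_bigr => k _.
by rewrite big_distrr.
Qed.

(** From N < 2^N follows (2 N + 1)^2 <= 9 * 4^N; the ratio 1/8 then leaves 2^-N. *)
Lemma cvg_quadratic_geo C :
  (fun N => C * ((2 * N).+1%:R ^+ 2 * (8%:R^-1) ^+ N)) @ \oo --> (0 : K).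
Proof.
have h : (fun N => `|C| * 9%:R * (2%:R^-1) ^+ N) @ \oo --> (0 : K).
  rewrite -(mulr0 (`|C| * 9%:R)); apply: cvgM; first exact: cvg_cst.
  by apply: cvg_geo; rewrite ?invr_ge0 ?ler0n // invf_lt1 ?ltr0n // ltr1n.
apply/cvgr0Pnorm_lt => e e0.
have /cvgr0Pnorm_lt /(_ e e0) := h.
apply: filterS => N; apply: le_lt_trans.
rewrite normrM [leRHS]ger0_norm ?mulr_ge0 ?exprn_ge0 ?invr_ge0 ?ler0n //.
rewrite -mulrA ler_wpM2l // ger0_norm ?mulr_ge0 ?exprn_ge0 ?invr_ge0 ?ler0n //.
have -> : (2%:R^-1 : K) ^+ N = 4%:R ^+ N * 8%:R^-1 ^+ N.
  by rewrite -exprMn; congr (_ ^+ _); field.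
rewrite mulrA ler_wpM2r ?exprn_ge0 ?invr_ge0 ?ler0n //.
rewrite -natrX -[4%:R ^+ N]natrX -natrM ler_nat.
have : (N < 2 ^ N)%N by apply: ltn_expl.
have -> : (4 ^ N = 2 ^ N * 2 ^ N)%N by rewrite -expnMn.
by move: (2 ^ N)%N; clear; nia.
Qed.

(** The two rotated boxes contain the square box and 2 (2 N + 1)^2 points in all. A point outside
    the square has |n| + |m| > N, so its term is at most a constant times 8^-N. *)
Lemma pair_sum_split x y : x != 0 -> y != 0 ->
  (fun N => (\sum_(k <- zrange N) jterm rho (x * y) k) *
            (\sum_(k <- zrange N) jterm rho (x / y) k) -
   ((\sum_(k <- zrange N) jterm p (- x ^+ 2) k) *
    (\sum_(k <- zrange N) jterm p (- (p * y ^+ 2)) k) +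
    - (x * y) * ((\sum_(k <- zrange N) jterm p (- (p * x ^+ 2)) k) *
    (\sum_(k <- zrange N) jterm p (- y ^- 2) k)))) @ \oo --> (0 : K).
Proof.
move=> x0 y0.
have e0 : 0 < 8%:R^-1 :> K by rewrite invr_gt0 ltr0n.
have e1 : 8%:R^-1 <= 1 :> K by rewrite invf_le1 ?ltr0n // ler1n.
have xy0 : x * y != 0 by rewrite mulf_neq0.
have xVy0 : x / y != 0 by rewrite mulf_neq0 ?invr_eq0.
have [C1 C10 hC1] := jterm_bound rho0 rho1 xy0 e0 e1.
have [C2 C20 hC2] := jterm_bound rho0 rho1 xVy0 e0 e1.
have bound nm N : ~~ in_box N nm -> `|pterm x y nm| <= C1 * C2 * 8%:R^-1 ^+ N.
  case: nm => n m; rewrite /in_box /= => out; rewrite /pterm normrM /=.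
  apply: le_trans (ler_pM (normr_ge0 _) (normr_ge0 _) (hC1 n) (hC2 m)) _.
  rewrite mulrACA -exprD ler_wpM2l ?mulr_ge0 // ler_wiXn2l ?(ltW e0) //.
  by move: out; clear; lia.
have h := cvg_quadratic_geo (C1 * C2 * 2%:R).
apply/cvgr0Pnorm_lt => e e_gt0.
have /cvgr0Pnorm_lt /(_ e e_gt0) := h.
apply: filterS => N; apply: le_lt_trans.
rewrite [leRHS]ger0_norm ?mulr_ge0 ?exprn_ge0 ?invr_ge0 ?ler0n //.
have -> : (\sum_(k <- zrange N) jterm p (- x ^+ 2) k) *
    (\sum_(k <- zrange N) jterm p (- (p * y ^+ 2)) k) +
    - (x * y) * ((\sum_(k <- zrange N) jterm p (- (p * x ^+ 2)) k) *
    (\sum_(k <- zrange N) jterm p (- y ^- 2) k)) =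
    \sum_(nm <- even_points N ++ odd_points N) pterm x y nm.
  rewrite big_cat !sum_pairs big_distrr /=; congr (_ + _).
    rewrite !big_allpairs_dep /=; apply: eq_bigr => k _; apply: eq_bigr => l _.
    by rewrite pterm_even.
  rewrite !big_allpairs_dep /=; apply: eq_bigr => k _; apply: eq_bigr => l _.
  by rewrite pterm_odd.
rewrite sum_pairs (perm_big _ (perm_box N)) big_filter.
have : size (even_points N ++ odd_points N) = ((2 * N).+1 * (2 * N).+1 * 2)%N.
  by rewrite size_cat !size_allpairs size_zrange muln2 addnn.
move: (even_points N ++ odd_points N) => s sz.
rewrite (bigID (in_box N) predT (pterm x y)) /= opprD addrA.
rewrite -[X in X - _ - _]/(\sum_(nm <- s | in_box N nm) pterm x y nm) subrr sub0r normrN.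
apply: le_trans (ler_norm_sum _ _ _) _.
apply: le_trans (_ : \sum_(nm <- s) (C1 * C2 * 8%:R^-1 ^+ N) <= _).
  rewrite big_mkcond /=; apply: ler_sum => nm _; case: ifP => [|_].
    exact: bound.
  by rewrite !mulr_ge0 ?exprn_ge0 ?invr_ge0 ?ler0n.
rewrite big_const_seq count_predT sz iter_addr_0.
rewrite -[X in X <= _]mulr_natl !natrM.
by rewrite le_eqVlt; apply/orP; left; apply/eqP; ring.
Qed.

End AdditionFormula.

(* The bilinear expansion of theta p (x y) theta p (x / y): splitting the double
   Laurent series according to the parity of the exponents of x leaves two
   products of theta functions of nome p ^ 2. *)
Lemma theta_addition (rho : K) : rho != 0 -> `|rho| < 1 ->
  exists kappa : K, forall x y : K, x != 0 -> y != 0 ->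
  theta (rho ^+ 2) (x * y) * theta (rho ^+ 2) (x / y) =
  kappa * (theta ((rho ^+ 2) ^+ 2) (- x ^+ 2) *
           theta ((rho ^+ 2) ^+ 2) (- (rho ^+ 2 * y ^+ 2)) -
    x * y * (theta ((rho ^+ 2) ^+ 2) (- (rho ^+ 2 * x ^+ 2)) *
             theta ((rho ^+ 2) ^+ 2) (- y ^- 2))).
Proof.
move=> rho0 rho1.
have p0 : rho ^+ 2 != 0 by rewrite expf_neq0.
have p1 : `|rho ^+ 2| < 1 by rewrite normrX exprn_ilt1.
have [k1 k10 h1] := theta_series rho0 rho1.
have [k2 k20 h2] := theta_series p0 p1.
exists (k2 ^+ 2 / k1 ^+ 2) => x y x0 y0.
have hx : - x ^+ 2 != 0 by rewrite oppr_eq0 expf_neq0.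
have hpx : - (rho ^+ 2 * x ^+ 2) != 0 by rewrite oppr_eq0 mulf_neq0 // expf_neq0.
have hpy : - (rho ^+ 2 * y ^+ 2) != 0 by rewrite oppr_eq0 mulf_neq0 // expf_neq0.
have hy : - y ^- 2 != 0 by rewrite oppr_eq0 invr_eq0 expf_neq0.
have xy0 : x * y != 0 by rewrite mulf_neq0.
have xVy0 : x / y != 0 by rewrite mulf_neq0 ?invr_eq0.
have lim := pair_sum_split rho0 rho1 x0 y0.
have lim' : (fun N => (\sum_(k <- zrange N) jterm rho (x * y) k) *
            (\sum_(k <- zrange N) jterm rho (x / y) k) -
   ((\sum_(k <- zrange N) jterm (rho ^+ 2) (- x ^+ 2) k) *
    (\sum_(k <- zrange N) jterm (rho ^+ 2) (- (rho ^+ 2 * y ^+ 2)) k) +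
    - (x * y) * ((\sum_(k <- zrange N) jterm (rho ^+ 2) (- (rho ^+ 2 * x ^+ 2)) k) *
    (\sum_(k <- zrange N) jterm (rho ^+ 2) (- y ^- 2) k)))) @ \oo -->
  (k1 * theta (rho ^+ 2) (x * y)) * (k1 * theta (rho ^+ 2) (x / y)) -
  ((k2 * theta ((rho ^+ 2) ^+ 2) (- x ^+ 2)) *
   (k2 * theta ((rho ^+ 2) ^+ 2) (- (rho ^+ 2 * y ^+ 2))) +
   - (x * y) * ((k2 * theta ((rho ^+ 2) ^+ 2) (- (rho ^+ 2 * x ^+ 2))) *
   (k2 * theta ((rho ^+ 2) ^+ 2) (- y ^- 2)))).
  apply: cvgB; first by apply: cvgM; [exact: h1|exact: h1].
  apply: cvgD; first by apply: cvgM; [exact: h2|exact: h2].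
  by apply: cvgM; [exact: cvg_cst|apply: cvgM; [exact: h2|exact: h2]].
have e := subr0_eq (esym (norm_cvg_unique lim lim')).
transitivity ((k1 * theta (rho ^+ 2) (x * y)) * (k1 * theta (rho ^+ 2) (x / y)) / k1 ^+ 2).
  by field.
by rewrite e; field.
Qed.

Lemma theta_nome0 (x : K) : theta 0 x = 1 - x.
Proof.
have p1 : `|0 : K| < 1 by rewrite normr0 ltr01.
apply: (theta_lim p1); apply: (cvg_trans _ (@cvg_cst K (1 - x) nat \oo _)).
apply: near_eq_cvg; exists 1%N => // -[|N] //= _.
rewrite /pprod big_nat_recl //= big1 ?mulr1.
  by rewrite /theta_dev expr0 expr1; ring.
by move=> j _; rewrite /theta_dev !exprS; ring.
Qed.

(** The addition formula at x = s X, y = b / s, where each product is a function of X times a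
    function of b. The case p = 0 is the expansion of (1 - b X)(1 - sg X / b). *)
Lemma theta_rank2 (p sg s : K) : `|p| < 1 -> (exists rho, p = rho ^+ 2) ->
  sg != 0 -> sg = s ^+ 2 ->
  exists E O al be : K -> K, forall X b : K, X != 0 -> b != 0 ->
    theta p (b * X) * theta p (sg * X / b) = al X * E b + be X * O b.
Proof.
move=> p1 [rho pE] sg0 sE.
have [p0|p0] := eqVneq p 0.
  exists (fun=> 1), (fun b => b + sg / b), (fun X => 1 + sg * X ^+ 2), (fun X => - X).
  by move=> X b X0 b0; rewrite p0 !theta_nome0; field.
have rho0 : rho != 0 by apply: contra_neq p0 => r0; rewrite pE r0 expr0n.
have rho1 : `|rho| < 1.
  by move: p1; rewrite pE normrX expr_lt1.
have s0 : s != 0 by apply: contra_neq sg0 => r0; rewrite sE r0 expr0n.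
have [k hk] := theta_addition rho0 rho1; rewrite -pE in hk.
exists (fun b => theta (p ^+ 2) (- (p * (b / s) ^+ 2))),
  (fun b => b / s * theta (p ^+ 2) (- (b / s) ^- 2)),
  (fun X => k * theta (p ^+ 2) (- (s * X) ^+ 2)),
  (fun X => - (k * (s * X) * theta (p ^+ 2) (- (p * (s * X) ^+ 2)))).
move=> X b X0 b0.
have -> : b * X = s * X * (b / s) by field.
have -> : sg * X / b = s * X / (b / s) by rewrite sE; field; rewrite b0 s0.
rewrite hk ?mulf_neq0 ?invr_eq0 //; ring.
Qed.

End InfiniteProducts.

(** * Removal of the genericity conditions *)

Section JacksonSum.
Variable K : numFieldType.
Hypothesis cvg_geo : forall r : K, 0 <= r -> r < 1 ->
  (fun n => r ^+ n) @ \oo --> (0 : K).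
Hypothesis cvg_increments : forall (u : nat -> K) (A r : K), 0 <= r -> r < 1 ->
  (forall n, `|u n.+1 - u n| <= A * r ^+ n) -> exists l : K, u @ \oo --> l.
Hypothesis has_sqrt : forall x : K, exists s, x = s ^+ 2.
Variables (p q : K).
Hypotheses (p1 : `|p| < 1) (q0 : q != 0).

Local Notation th := (theta p).
Local Notation ep := (ep th q).

Lemma th1 : th 1 = 0. Proof. exact: (theta_1 cvg_geo cvg_increments p1). Qed.

Lemma thV (x : K) : x != 0 -> th x^-1 = - (x^-1 * th x).
Proof. exact: (theta_inv cvg_geo cvg_increments p1). Qed.

Lemma th_rank2 (sg : K) : sg != 0 -> exists E O al be : K -> K,
  forall X b : K, X != 0 -> b != 0 -> th (b * X) * th (sg * X / b) = al X * E b + be X * O b.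
Proof.
move=> sg0; have [s sE] := has_sqrt sg.
exact: (theta_rank2 cvg_geo cvg_increments p1 (has_sqrt p) sg0 sE).
Qed.

Lemma cvg_th (f : nat -> K) (l : K) : l != 0 -> f @ \oo --> l ->
  (fun N => th (f N)) @ \oo --> th l.
Proof. exact: (theta_continuous cvg_geo cvg_increments p1). Qed.

Lemma cvg_prod_seq (I : Type) (r : seq I) (P : pred I) (f : I -> nat -> K) (l : I -> K) :
  (forall i, P i -> f i @ \oo --> l i) ->
  (fun N => \prod_(i <- r | P i) f i N) @ \oo --> \prod_(i <- r | P i) l i.
Proof.
move=> h; elim: r => [|i r IH].
  rewrite big_nil (_ : (fun N => _) = cst 1); first exact: cvg_cst.
  by apply: funext => N; rewrite big_nil.
rewrite big_cons; case: ifPn => Pi.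
  rewrite (_ : (fun N => _) = (fun N => f i N * \prod_(j <- r | P j) f j N)).
    by apply: cvgM => //; exact: h.
  by apply: funext => N; rewrite big_cons Pi.
rewrite (_ : (fun N => _) = (fun N => \prod_(j <- r | P j) f j N)) //.
by apply: funext => N; rewrite big_cons (negbTE Pi).
Qed.

Lemma cvg_ep (f : nat -> K) (l : K) k : l != 0 -> f @ \oo --> l ->
  (fun N => ep (f N) k) @ \oo --> ep l k.
Proof.
move=> l0 h; apply: cvg_prod_seq => i _; apply: cvg_th; first by nz.
by apply: cvgM => //; exact: cvg_cst.
Qed.

Lemma cvg_poch_ratio (A r : nat -> K) (a s x : K) y : a != 0 -> s != 0 -> x != 0 ->
  A @ \oo --> a -> r @ \oo --> s -> ep (a * q * x / s) y != 0 ->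
  (fun N => poch_ratio th q (A N) (r N) x y) @ \oo --> poch_ratio th q a s x y.
Proof.
move=> a0 s0 x0 hA hr h; apply: cvgM.
  by apply: cvg_ep; [nz|apply: cvgM => //; exact: cvg_cst].
apply: cvgV => //; apply: cvg_ep; first by nz.
by apply: cvgM; [apply: cvgM; [apply: cvgM => //|]; exact: cvg_cst|exact: cvgV].
Qed.

(** * Continuity of the summand and of the closed form in the parameters *)

Section Limits.
Variables (n : nat) (z : 'I_n -> K).
Hypothesis z0 : forall k, z k != 0.
Variables (A B C D E : nat -> K) (a b c d e : K).
Hypotheses (a0 : a != 0) (b0 : b != 0) (c0 : c != 0) (d0 : d != 0) (e0 : e != 0).
Hypotheses (hA : A @ \oo --> a) (hB : B @ \oo --> b) (hC : C @ \oo --> c)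
  (hD : D @ \oo --> d) (hE : E @ \oo --> e).

Lemma cvg_base_term (y : 'I_n -> nat) :
  (forall j k : 'I_n, (j <= k)%N -> th (a * z j * z k) != 0) ->
  (fun N => base_term th q (A N) z y) @ \oo --> base_term th q a z y.
Proof.
move=> h.
apply: cvgM; last exact: cvg_cst.
apply: cvgM.
  apply: cvgM; first exact: cvg_cst.
  apply: cvg_prod_seq => j _; apply: cvg_prod_seq => k jk.
  apply: cvgM; last apply: cvgV; first 1 last.
  - exact: h.
  - by apply: cvg_th; [nz|do !(apply: cvgM; last exact: cvg_cst)].
  - by apply: cvg_th; [nz|do !(apply: cvgM; last exact: cvg_cst)].
apply: cvg_prod_seq => j _; apply: cvg_prod_seq => k jk.
apply: cvgM; last exact: cvg_cst.
by apply: cvg_ep; [nz|do !(apply: cvgM; last exact: cvg_cst)].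
Qed.

Lemma cvg_poch_ratios (r : nat -> K) (s : K) (y : 'I_n -> nat) : s != 0 -> r @ \oo --> s ->
  (forall k, ep (a * q * z k / s) (y k) != 0) ->
  (fun N => poch_ratios th q (A N) z (r N) y) @ \oo --> poch_ratios th q a z s y.
Proof. by move=> s0 hr h; apply: cvg_prod_seq => k _; apply: cvg_poch_ratio. Qed.

Lemma cvg_term m (y : 'I_n -> nat) :
  (forall j k : 'I_n, (j <= k)%N -> th (a * z j * z k) != 0) ->
  (forall j k, ep (a * q * z k / (q ^- m j / z j)) (y k) != 0) ->
  (forall k, ep (a * q * z k / b) (y k) != 0) ->
  (forall k, ep (a * q * z k / c) (y k) != 0) ->
  (forall k, ep (a * q * z k / d) (y k) != 0) ->
  (forall k, ep (a * q * z k / e) (y k) != 0) ->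
  (fun N => term th q (A N) z m (B N) (C N) (D N) (E N) y) @ \oo -->
  term th q a z m b c d e y.
Proof.
move=> h1 h2 h3 h4 h5 h6; do !(apply: cvgM; last exact: cvg_poch_ratios).
apply: cvgM; first exact: cvg_base_term.
apply: cvg_prod_seq => j _; apply: cvg_poch_ratios => //; first by nz.
exact: cvg_cst.
Qed.

Lemma cvg_closed_form m :
  (forall j k : 'I_n, (j < k)%N -> ep (a * q * z j * z k) (m j + m k) != 0) ->
  (forall k, [/\ ep (a * q * z k / b) (m k) != 0, ep (a * q * z k / c) (m k) != 0,
    ep (a * q * z k / d) (m k) != 0 & ep (q ^- m k * e / (a * z k)) (m k) != 0]) ->
  (fun N => closed_form th q (A N) z m (B N) (C N) (D N) (E N)) @ \oo -->
  closed_form th q a z m b c d e.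
Proof.
move=> h1 h2.
have hq x : (fun N => A N * q * x) @ \oo --> a * q * x.
  by do !(apply: cvgM; last exact: cvg_cst).
have hqq : (fun N => A N * q) @ \oo --> a * q by apply: cvgM => //; exact: cvg_cst.
apply: cvgM; [apply: cvgM|].
- apply: cvg_prod_seq => k _; have [k1 k2 k3 k4] := h2 k.
  apply: cvgM; first by apply: cvg_ep; [nz|apply: cvgM => //; exact: cvg_cst].
  apply: cvgV; first by nz.
  do !apply: cvgM; apply: cvg_ep; try by nz.
  + by apply: cvgM => //; apply: cvgV.
  + by apply: cvgM => //; apply: cvgV.
  + by apply: cvgM => //; apply: cvgV.
  + apply: cvgM; first by apply: cvgM => //; exact: cvg_cst.
    by apply: cvgV; [nz|apply: cvgM => //; exact: cvg_cst].
- apply: cvg_prod_seq => j _; apply: cvg_prod_seq => k jk.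
  have hjk : (fun N => A N * q * z j * z k) @ \oo --> a * q * z j * z k.
    by apply: cvgM => //; exact: cvg_cst.
  apply: cvgM; last by apply: cvgV; [exact: h1|apply: cvg_ep => //; nz].
  by apply: cvgM; apply: cvg_ep => //; nz.
- do !apply: cvgM; apply: cvg_ep; try by nz.
  + by apply: cvgM => //; apply: cvgV; [nz|apply: cvgM].
  + by apply: cvgM => //; apply: cvgV; [nz|apply: cvgM].
  + by apply: cvgM => //; apply: cvgV; [nz|apply: cvgM].
Qed.

End Limits.
Lemma cvg_sum_seq (I : Type) (r : seq I) (P : pred I) (f : I -> nat -> K) (l : I -> K) :
  (forall i, P i -> f i @ \oo --> l i) ->
  (fun N => \sum_(i <- r | P i) f i N) @ \oo --> \sum_(i <- r | P i) l i.
Proof.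
move=> h; elim: r => [|i r IH].
  rewrite big_nil (_ : (fun N => _) = cst 0); first exact: cvg_cst.
  by apply: funext => N; rewrite big_nil.
rewrite big_cons; case: ifPn => Pi.
  rewrite (_ : (fun N => _) = (fun N => f i N + \sum_(j <- r | P j) f j N)).
    by apply: cvgD => //; exact: h.
  by apply: funext => N; rewrite big_cons Pi.
rewrite (_ : (fun N => _) = (fun N => \sum_(j <- r | P j) f j N)) //.
by apply: funext => N; rewrite big_cons (negbTE Pi).
Qed.

Lemma near_ord n (P : 'I_n -> nat -> Prop) :
  (forall j, \forall N \near \oo, P j N) -> \forall N \near \oo, forall j, P j N.
Proof. by move=> h; apply: filter_forall. Qed.

Lemma near_leq B (P : nat -> nat -> Prop) :
  (forall s, \forall N \near \oo, P s N) ->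
  \forall N \near \oo, forall s, (s <= B)%N -> P s N.
Proof.
move=> h; have := @near_ord B.+1 (fun j => P j) (fun j => h j).
apply: filterS => N hN s sB; exact: (hN (Ordinal (sB : (s < B.+1)%N))).
Qed.

(** Being greater than 1, it has no positive power equal to 1: a perturbed argument never coincides
    with its limit, as [theta_isolated] demands. *)
Definition perturb (N : nat) : K := 1 + 2%:R^-1 ^+ N.

Lemma perturb_gt1 N : 1 < perturb N.
Proof. by rewrite /perturb ltrDl exprn_gt0 // invr_gt0 ltr0n. Qed.

Lemma perturb_neq0 N : perturb N != 0.
Proof. by rewrite gt_eqF // (lt_trans ltr01) // perturb_gt1. Qed.

Lemma cvg_perturb : perturb @ \oo --> (1 : K).
Proof.
have h : perturb @ \oo --> (1 : K) + 0.
  apply: cvgD; first exact: cvg_cst.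
  by apply: cvg_geo; rewrite ?invr_ge0 ?ler0n // invf_lt1 ?ltr0n // ltr1n.
by rewrite addr0 in h.
Qed.

Lemma cvg_perturbX j : (fun N => perturb N ^+ j) @ \oo --> (1 : K).
Proof.
have h : (fun N => perturb N ^+ j) @ \oo --> (1 : K) ^+ j.
  elim: j => [|j IH]; first exact: cvg_cst.
  rewrite exprS (_ : (fun N => _) = (fun N => perturb N * perturb N ^+ j)).
    by apply: cvgM => //; exact: cvg_perturb.
  by apply: funext => N; rewrite exprS.
by rewrite expr1n in h.
Qed.

Lemma cvg_mul_perturb (x : K) j : (fun N => x * perturb N ^+ j) @ \oo --> x.
Proof.
have h : (fun N => x * perturb N ^+ j) @ \oo --> x * 1.
  by apply: cvgM; [exact: cvg_cst|exact: cvg_perturbX].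
by rewrite mulr1 in h.
Qed.

Lemma cvg_div_perturb (x : K) j : (fun N => x / perturb N ^+ j) @ \oo --> x.
Proof.
have h : (fun N => x / perturb N ^+ j) @ \oo --> x / 1.
  apply: cvgM; first exact: cvg_cst.
  by apply: cvgV; [exact: oner_neq0|exact: cvg_perturbX].
by rewrite divr1 in h.
Qed.

Lemma near_perturb x j : (0 < j)%N -> x != 0 ->
  \forall N \near \oo, th (x * perturb N ^+ j) != 0.
Proof.
move=> j0 x0; apply: (theta_isolated cvg_geo cvg_increments p1 x0).
  exact: cvg_mul_perturb.
move=> N; rewrite -[X in _ != X]mulr1 (inj_eq (mulfI x0)).
by rewrite gt_eqF // exprn_egt1 // ?perturb_gt1 // -lt0n.
Qed.

Lemma near_perturbV x j : (0 < j)%N -> x != 0 ->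
  \forall N \near \oo, th (x / perturb N ^+ j) != 0.
Proof.
move=> j0 x0; apply: (theta_isolated cvg_geo cvg_increments p1 x0).
  exact: cvg_div_perturb.
move=> N; rewrite -[X in _ != X]mulr1 (inj_eq (mulfI x0)) invr_eq1.
by rewrite gt_eqF // exprn_egt1 // ?perturb_gt1 // -lt0n.
Qed.

Lemma near_ep (g : nat -> K) l :
  (forall i, \forall N \near \oo, th (g N * q ^+ i) != 0) ->
  \forall N \near \oo, ep (g N) l != 0.
Proof.
move=> h; have := @near_leq l (fun i N => th (g N * q ^+ i) != 0) h.
apply: filterS => N hN; apply/ep_neq0P => i il; apply: hN; exact: ltnW.
Qed.

Theorem jackson_closed_form n L (m : 'I_n -> nat) (z : 'I_n -> K) (a b c d e : K) :
  (forall k, z k != 0) -> a != 0 -> b != 0 -> c != 0 -> d != 0 -> e != 0 ->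
  (forall k, (m k <= L)%N) ->
  a ^+ 2 * q ^+ (\sum_(j < n) m j).+1 = b * c * d * e ->
  (forall j k s t, j != k -> (s <= m j)%N -> (t <= m k)%N ->
    th (z j / z k * q ^+ s / q ^+ t) != 0) ->
  (forall k, ep q (m k) != 0) ->
  (forall j k : 'I_n, (j <= k)%N -> th (a * z j * z k) != 0) ->
  (forall j k, ep (a * q * z k / (q ^- m j / z j)) (m k) != 0) ->
  (forall j k : 'I_n, (j < k)%N -> ep (a * q * z j * z k) (m j + m k) != 0) ->
  (forall k, [/\ ep (a * q * z k / b) (m k) != 0, ep (a * q * z k / c) (m k) != 0,
    ep (a * q * z k / d) (m k) != 0 & ep (a * q * z k / e) (m k) != 0]) ->
  jackson_sum th q a z L m b c d e = closed_form th q a z m b c d e.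
Proof.
move=> z0 a0 b0 c0 d0 e0 mL bal hz hq ha hr hp hd.
(* The exponents 1, 3, -1 preserve the balancing condition and make every
   genericity condition depend on the perturbation. *)
pose A N := a * perturb N; pose B N := b * perturb N ^+ 3; pose E N := e / perturb N.
have u0 := perturb_neq0.
have A0 N : A N != 0 by rewrite /A; nz.
have B0 N : B N != 0 by rewrite /B; nz.
have E0 N : E N != 0 by rewrite /E; nz.
have cA : A @ \oo --> a by have := @cvg_mul_perturb a 1.
have cB : B @ \oo --> b by exact: cvg_mul_perturb.
have cE : E @ \oo --> e by have := @cvg_div_perturb e 1.
have cC : (fun _ : nat => c) @ \oo --> c by apply: cvg_cst.
have cD : (fun _ : nat => d) @ \oo --> d by apply: cvg_cst.
have eq_near : \forall N \near \oo,
    jackson_sum th q (A N) z L m (B N) c d (E N) =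
    closed_form th q (A N) z m (B N) c d (E N).
  have near_th (f : nat -> K) x j : (0 < j)%N -> x != 0 ->
      (forall N, f N = x * perturb N ^+ j) -> \forall N \near \oo, th (f N) != 0.
    move=> j0 x0 fE; have := near_perturb j0 x0; apply: filterS => N; by rewrite fE.
  have near_thV (f : nat -> K) x j : (0 < j)%N -> x != 0 ->
      (forall N, f N = x / perturb N ^+ j) -> \forall N \near \oo, th (f N) != 0.
    move=> j0 x0 fE; have := near_perturbV j0 x0; apply: filterS => N; by rewrite fE.
  have n1 : \forall N \near \oo, forall j k, th (A N * z j * z k) != 0.
    apply: near_ord => j; apply: near_ord => k.
    apply: (near_th _ (a * z j * z k) 1%N) => //; first by nz.
    by move=> N; rewrite /A expr1; ring.
  have n2 : \forall N \near \oo, forall j k, ep (A N * q * z j * z k) (m j + m k) != 0.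
    apply: near_ord => j; apply: near_ord => k; apply: near_ep => i.
    apply: (near_th (fun N => A N * q * z j * z k * q ^+ i) (a * q * z j * z k * q ^+ i) 1%N) => //; first by nz.
    by move=> N; rewrite /A expr1; ring.
  have n3 : \forall N \near \oo, forall k, ep (A N * q * z k / B N) (m k) != 0.
    apply: near_ord => k; apply: near_ep => i.
    apply: (near_thV (fun N => A N * q * z k / B N * q ^+ i) (a * q * z k / b * q ^+ i) 2%N) => //; first by nz.
    by move=> N; rewrite /A /B; field; nz.
  have n4 x : x != 0 -> \forall N \near \oo, forall k, ep (A N * q * z k / x) (m k) != 0.
    move=> x0; apply: near_ord => k; apply: near_ep => i.
    apply: (near_th (fun N => A N * q * z k / x * q ^+ i) (a * q * z k / x * q ^+ i) 1%N) => //; first by nz.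
    by move=> N; rewrite /A expr1; field; nz.
  have n4c := n4 c c0; have n4d := n4 d d0.
  have n5 : \forall N \near \oo, forall k, ep (A N * q * z k / E N) (m k) != 0.
    apply: near_ord => k; apply: near_ep => i.
    apply: (near_th (fun N => A N * q * z k / E N * q ^+ i) (a * q * z k / e * q ^+ i) 2%N) => //; first by nz.
    by move=> N; rewrite /A /E; field; nz.
  have n6 : \forall N \near \oo,
      sigma_generic th q (A N) z (2 * \sum_(j < n) m j + 2) (B N * c).
    have s1 : \forall N \near \oo, forall j k s, (s <= 2 * \sum_(j < n) m j + 2)%N ->
       forall t, (t <= 2 * \sum_(j < n) m j + 2)%N ->
       th (B N * c * z j * z k * q ^+ s / q ^+ t) != 0.
      apply: near_ord => j; apply: near_ord => k; apply: near_leq => s; apply: near_leq => t.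
      apply: (near_th _ (b * c * z j * z k * q ^+ s / q ^+ t) 3%N) => //; first by nz.
      by move=> N; rewrite /B; ring.
    have s2 : \forall N \near \oo, forall j k s, (s <= 2 * \sum_(j < n) m j + 2)%N ->
       forall t, (t <= 2 * \sum_(j < n) m j + 2)%N ->
       th (B N * c * z j * q ^+ s / q ^+ t / (A N * z k)) != 0.
      apply: near_ord => j; apply: near_ord => k; apply: near_leq => s; apply: near_leq => t.
      apply: (near_th _ (b * c * z j * q ^+ s / q ^+ t / (a * z k)) 2%N) => //; first by nz.
      by move=> N; rewrite /B /A; field; nz.
    have s3 : \forall N \near \oo, forall j k s, (s <= 2 * \sum_(j < n) m j + 2)%N ->
       forall t, (t <= 2 * \sum_(j < n) m j + 2)%N ->
       th (A N ^+ 2 * z j * z k * q ^+ s / q ^+ t / (B N * c)) != 0.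
      apply: near_ord => j; apply: near_ord => k; apply: near_leq => s; apply: near_leq => t.
      apply: (near_thV _ (a ^+ 2 * z j * z k * q ^+ s / q ^+ t / (b * c)) 1%N) => //; first by nz.
      by move=> N; rewrite /B /A; field; nz.
    near=> N => j k s t sB tB; split.
    - by move: t tB; move: s sB; move: k; move: j; near: N.
    - by move: t tB; move: s sB; move: k; move: j; near: N.
    - by move: t tB; move: s sB; move: k; move: j; near: N.
  near=> N.
  apply: (jackson_generic th1 thV q0 (A0 N) z0 th_rank2 mL) => //.
  - by split=> //; near: N.
  - transitivity (a ^+ 2 * q ^+ (\sum_(j < n) m j).+1 * perturb N ^+ 2).
      by rewrite /A; ring.
    by rewrite bal /B /E; field; nz.
  - by apply/denom_neq0P; near: N.
  - by apply/denom_neq0P; near: N.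
  - by apply/denom_neq0P; near: N.
  - by apply/denom_neq0P; near: N.
  - by near: N.
have le_ep x k l : (l <= m k)%N -> ep x (m k) != 0 -> ep x l != 0 by move=> ?; apply: ep_neq0_le.
have cL : (fun N => jackson_sum th q (A N) z L m (B N) c d (E N)) @ \oo -->
    jackson_sum th q a z L m b c d e.
  (* Only inside the box of m are the limit denominators known to be nonzero; the other terms are
     identically 0 and are dropped before passing to the limit. *)
  rewrite (jackson_sum_bounded th1 q0 _ z0) /=.
  rewrite (_ : (fun N => _) = (fun N => \sum_(u : {ffun 'I_n -> 'I_L.+1} | bounded m u)
     term th q (A N) z m (B N) c d (E N) (fun k => u k))); last first.
    by apply: funext => N; rewrite (jackson_sum_bounded th1 q0 _ z0).
  apply: cvg_sum_seq => u /forallP bu.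
  apply: (cvg_term z0 a0 b0 c0 d0 e0) => //.
  - by move=> j k; apply: le_ep (bu k) (hr j k).
  - by move=> k; have [h _ _ _] := hd k; apply: le_ep (bu k) h.
  - by move=> k; have [_ h _ _] := hd k; apply: le_ep (bu k) h.
  - by move=> k; have [_ _ h _] := hd k; apply: le_ep (bu k) h.
  - by move=> k; have [_ _ _ h] := hd k; apply: le_ep (bu k) h.
have cR : (fun N => closed_form th q (A N) z m (B N) c d (E N)) @ \oo -->
    closed_form th q a z m b c d e.
  apply: (cvg_closed_form z0 a0 b0 c0 d0 e0) => // k.
  have [k1 k2 k3 k4] := hd k; split=> //.
  exact: (ep_rev_neq0 thV q0 a0 z0 e0 k4).
apply: (norm_cvg_unique cL).
apply: cvg_trans cR; apply: near_eq_cvg.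
by apply: filterS eq_near => N ->.
Unshelve. all: by end_near. Qed.

(** The statement sums over a type that depends on m, whereas the induction changes m and needs one
    fixed index type. *)
Lemma sum_dffun (n L : nat) (m : 'I_n -> nat) (F : ('I_n -> nat) -> K) :
  (forall k, (m k <= L)%N) ->
  \sum_(y : {dffun forall k : 'I_n, 'I_(m k).+1}) F (fun k => y k) =
  \sum_(u : {ffun 'I_n -> 'I_L.+1} | bounded m u) F (fun k => u k).
Proof.
move=> mL.
pose h (y : {dffun forall k : 'I_n, 'I_(m k).+1}) : {ffun 'I_n -> 'I_L.+1} :=
  [ffun k => inord (y k)].
pose h' (u : {ffun 'I_n -> 'I_L.+1}) : {dffun forall k : 'I_n, 'I_(m k).+1} :=
  finfun (fun k => inord (u k) : 'I_(m k).+1).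
have hE y k : h y k = y k :> nat.
  by rewrite ffunE inordK // ltnS (leq_trans _ (mL k)) // -ltnS ltn_ord.
rewrite [RHS](reindex_onto h h') /=; last first.
  move=> u /forallP bu; apply/ffunP => k; apply: val_inj => /=.
  by rewrite hE ffunE inordK // ltnS.
apply: eq_big => [y|y _]; last by congr F; apply: funext => k; rewrite hE.
apply/esym/andP; split; first by apply/forallP => k; rewrite hE -ltnS ltn_ord.
apply/eqP/ffunP => k; rewrite ffunE; apply: val_inj => /=.
by rewrite hE inordK.
Qed.

Lemma epochs2 x1 x2 l : epochs p q [:: x1; x2] l = ep x1 l * ep x2 l.
Proof. by rewrite /epochs !big_cons big_nil mulr1. Qed.

Lemma epochs4 x1 x2 x3 x4 l :
  epochs p q [:: x1; x2; x3; x4] l = ep x1 l * ep x2 l * ep x3 l * ep x4 l.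
Proof. by rewrite /epochs !big_cons big_nil mulr1 !mulrA. Qed.

(** * From the notation of the statement to [term] and [closed_form] *)

Section Translation.
Variables (n : nat) (m : 'I_n -> nat) (a b c d e : K) (z : 'I_n -> K).
Hypotheses (a0 : a != 0) (z0 : forall k, z k != 0).

Lemma termE (y : 'I_n -> nat) :
  evandermonde p (fun k => z k * q ^+ y k) / evandermonde p z
     * (\prod_(j < n) \prod_(k < n | (j <= k)%N)
          (theta p (a * z j * z k * q ^+ (y j + y k))
             / theta p (a * z j * z k)))
     * (\prod_(j < n) \prod_(k < n)
          (epochs p q [:: q ^- m j * z k / z j; a * z j * z k] (y k)
             / epochs p q [:: q * z k / z j; a * q ^+ (1 + m j) * z j * z k]
                 (y k)))
     * (\prod_(k < n)
          (epochs p q [:: b * z k; c * z k; d * z k; e * z k] (y k)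
             / epochs p q [:: a * q * z k / b; a * q * z k / c;
                              a * q * z k / d; a * q * z k / e] (y k)))
     * q ^+ (\sum_(k < n) y k) = term th q a z m b c d e y.
Proof.
rewrite /term /base_term.
have -> : evandermonde p (fun k => z k * q ^+ y k) / evandermonde p z =
    \prod_(j < n) \prod_(k < n | (j < k)%N)
     (z j * q ^+ y j * th (z k * q ^+ y k / (z j * q ^+ y j)) /
        (z j * th (z k / z j))).
  by rewrite /evandermonde -prodf_div; apply: eq_bigr => j _; rewrite prodf_div.
have -> : \prod_(j < n) \prod_(k < n)
          (epochs p q [:: q ^- m j * z k / z j; a * z j * z k] (y k)
             / epochs p q [:: q * z k / z j; a * q ^+ (1 + m j) * z j * z k]
                 (y k)) =
   (\prod_(j < n) \prod_(k < n)
     (ep (a * z j * z k) (y k) / ep (q * z k / z j) (y k))) *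
   \prod_(j < n) poch_ratios th q a z (q ^- m j / z j) y.
  rewrite -big_split /=; apply: eq_bigr => j _.
  rewrite /poch_ratios -big_split /=; apply: eq_bigr => k _; rewrite !epochs2 /poch_ratio.
  have -> : q ^- m j / z j * z k = q ^- m j * z k / z j by ring.
  have -> : a * q * z k / (q ^- m j / z j) = a * q ^+ (1 + m j) * z j * z k.
    by rewrite exprD expr1; field; nz.
  by rewrite !invfM; ring.
have -> : \prod_(k < n)
          (epochs p q [:: b * z k; c * z k; d * z k; e * z k] (y k)
             / epochs p q [:: a * q * z k / b; a * q * z k / c;
                              a * q * z k / d; a * q * z k / e] (y k)) =
   poch_ratios th q a z b y * poch_ratios th q a z c y * poch_ratios th q a z d y * poch_ratios th q a z e y.
  rewrite /poch_ratios -!big_split /=; apply: eq_bigr => k _; rewrite !epochs4 /poch_ratio.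
  by rewrite ![(_ * ep _ _)^-1]invfM; ring.
ring.
Qed.

Lemma closed_formE :
  closed_form th q a z m b c d e =
  (\prod_(j < n) \prod_(k < n) epoch p q (a * q * z j * z k) (m k))
      / (\prod_(j < n) \prod_(k < n | (j < k)%N)
           epoch p q (a * q * z j * z k) (m j + m k))
    * (epochs p q [:: a * q / (b * c); a * q / (b * d); a * q / (c * d)]
         (\sum_(k < n) m k)
       / \prod_(k < n)
           epochs p q [:: a * q * z k / b; a * q * z k / c; a * q * z k / d;
                          q ^- m k * e / (a * z k)] (m k)).
Proof.
rewrite /closed_form /closed_string /closed_pair /closed_total prod_square_triangle.
have -> : epochs p q [:: a * q / (b * c); a * q / (b * d); a * q / (c * d)]
     (\sum_(k < n) m k) = ep (a * q / (b * c)) (\sum_(k < n) m k) *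
     ep (a * q / (b * d)) (\sum_(k < n) m k) * ep (a * q / (c * d)) (\sum_(k < n) m k).
  by rewrite /epochs !big_cons big_nil mulr1 !mulrA.
rewrite prodf_div.
have -> : \prod_(k < n) epochs p q [:: a * q * z k / b; a * q * z k / c; a * q * z k / d;
       q ^- m k * e / (a * z k)] (m k) =
   \prod_(k < n) (ep (a * q * z k / b) (m k) * ep (a * q * z k / c) (m k) *
       ep (a * q * z k / d) (m k) * ep (q ^- m k * e / (a * z k)) (m k)).
  by apply: eq_bigr => k _; rewrite epochs4.
have -> : \prod_(j < n) \prod_(k < n | (j < k)%N)
    (ep (a * q * z j * z k) (m j) * ep (a * q * z j * z k) (m k) /
      ep (a * q * z j * z k) (m j + m k)) =
   (\prod_(j < n) \prod_(k < n | (j < k)%N)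
     (epoch p q (a * q * z j * z k) (m k) * epoch p q (a * q * z k * z j) (m j))) /
   \prod_(j < n) \prod_(k < n | (j < k)%N) ep (a * q * z j * z k) (m j + m k).
  rewrite -prodf_div; apply: eq_bigr => j _; rewrite -prodf_div.
  apply: eq_bigr => k _; rewrite [a * q * z k * z j]mulrAC.
  by rewrite [ep _ (m j) * _]mulrC.
ring.
Qed.

(** The case s > t is a factor of (q z_j / z_k)_{m_j}, s < t follows by inversion after exchanging j
    and k, and s = t is a factor of the Vandermonde determinant, again up to inversion. *)
Lemma string_ratios :
  evandermonde p z != 0 -> (forall j k, ep (q * z k / z j) (m k) != 0) ->
  forall j k s t, j != k -> (s <= m j)%N -> (t <= m k)%N ->
    th (z j / z k * q ^+ s / q ^+ t) != 0.
Proof.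
move=> hV hq.
have hlt (j k : 'I_n) : (j < k)%N -> th (z k / z j) != 0.
  move=> jk; move: hV; rewrite /evandermonde => /prodf_neq0 /(_ j isT).
  by move=> /prodf_neq0 /(_ k jk); rewrite mulf_eq0 negb_or => /andP[].
have hpos (j k : 'I_n) s t : (t < s)%N -> (s <= m j)%N ->
    th (z j / z k * q ^+ s / q ^+ t) != 0.
  move=> ts sm; have /ep_neq0P /(_ (s - t).-1) := hq k j.
  have -> : q * z j / z k * q ^+ (s - t).-1 = z j / z k * q ^+ s / q ^+ t.
    have -> : q ^+ s = q * q ^+ (s - t).-1 * q ^+ t.
      by rewrite -exprS -exprD; congr (_ ^+ _); move: ts; clear; lia.
    by field; nz.
  by apply; move: ts sm; clear; lia.
have flip (j k : 'I_n) s t : th (z k / z j * q ^+ t / q ^+ s) != 0 ->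
    th (z j / z k * q ^+ s / q ^+ t) != 0.
  have -> : z j / z k * q ^+ s / q ^+ t = (z k / z j * q ^+ t / q ^+ s)^-1.
    by field; nz.
  by rewrite thV_eq0 //; [exact: thV|nz].
move=> j k s t jk sm tm; case: (ltngtP s t) => [st|ts|->].
- by apply: flip; apply: hpos.
- exact: hpos.
- rewrite mulfK ?qX0 //.
  move: jk; rewrite -val_eqE /= neq_ltn => /orP[jk|kj]; last exact: hlt.
  by rewrite -[z j / z k]invrK invf_div thV_eq0; [exact: hlt|exact: thV|nz].
Qed.

End Translation.
End JacksonSum.

Theorem theorem7p1 (R : realType) (p q : R[i]) (n : nat) (m : 'I_n -> nat)
    (a b c d e : R[i]) (z : 'I_n -> R[i])
    (hp : `|p| < 1) (hq : q != 0) (hn : (1 <= n)%N)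
    (ha : a != 0) (hb : b != 0) (hc : c != 0) (hd : d != 0) (he : e != 0)
    (hz : forall k, z k != 0)
    (hbal : a ^+ 2 * q ^+ (1 + \sum_(i < n) m i) = b * c * d * e)
    (* no denominator on the left-hand side vanishes *)
    (hL1 : evandermonde p z != 0)
    (hL2 : forall j k : 'I_n, (j <= k)%N -> theta p (a * z j * z k) != 0)
    (hL3 : forall (j k : 'I_n) (l : nat), (l <= m k)%N ->
       epochs p q [:: q * z k / z j; a * q ^+ (1 + m j) * z j * z k] l != 0)
    (hL4 : forall (k : 'I_n) (l : nat), (l <= m k)%N ->
       epochs p q [:: a * q * z k / b; a * q * z k / c;
                      a * q * z k / d; a * q * z k / e] l != 0)
    (* no denominator on the right-hand side vanishes *)
    (hR1 : forall j k : 'I_n, (j < k)%N ->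
       epoch p q (a * q * z j * z k) (m j + m k) != 0)
    (hR2 : forall k : 'I_n,
       epochs p q [:: a * q * z k / b; a * q * z k / c; a * q * z k / d;
                      q ^- m k * e / (a * z k)] (m k) != 0) :
  \sum_(y : {dffun forall k : 'I_n, 'I_(m k).+1})
    (evandermonde p (fun k => z k * q ^+ y k) / evandermonde p z
     * (\prod_(j < n) \prod_(k < n | (j <= k)%N)
          (theta p (a * z j * z k * q ^+ (y j + y k))
             / theta p (a * z j * z k)))
     * (\prod_(j < n) \prod_(k < n)
          (epochs p q [:: q ^- m j * z k / z j; a * z j * z k] (y k)
             / epochs p q [:: q * z k / z j; a * q ^+ (1 + m j) * z j * z k]
                 (y k)))
     * (\prod_(k < n)
          (epochs p q [:: b * z k; c * z k; d * z k; e * z k] (y k)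
             / epochs p q [:: a * q * z k / b; a * q * z k / c;
                              a * q * z k / d; a * q * z k / e] (y k)))
     * q ^+ (\sum_(k < n) y k))
  = (\prod_(j < n) \prod_(k < n) epoch p q (a * q * z j * z k) (m k))
      / (\prod_(j < n) \prod_(k < n | (j < k)%N)
           epoch p q (a * q * z j * z k) (m j + m k))
    * (epochs p q [:: a * q / (b * c); a * q / (b * d); a * q / (c * d)]
         (\sum_(k < n) m k)
       / \prod_(k < n)
           epochs p q [:: a * q * z k / b; a * q * z k / c; a * q * z k / d;
                          q ^- m k * e / (a * z k)] (m k)).
Proof.
have geo := @cvg_expr_complex R; have incr := @cvg_geometric_increments R.
have sq (x : R[i]) : exists s, x = s ^+ 2 by exists (sqrtc x); rewrite sqr_sqrtc.
have hL3q j k : epoch p q (q * z k / z j) (m k) != 0.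
  have := hL3 j k (m k) (leqnn _); rewrite epochs2 mulf_eq0 negb_or => /andP[h1 _].
  exact: h1.
have hL3a j k : epoch p q (a * q ^+ (1 + m j) * z j * z k) (m k) != 0.
  have := hL3 j k (m k) (leqnn _); rewrite epochs2 mulf_eq0 negb_or => /andP[_ h2].
  exact: h2.
rewrite -closed_formE.
transitivity (\sum_(y : {dffun forall k : 'I_n, 'I_(m k).+1})
    term (theta p) q a z m b c d e (fun k => y k)).
  by apply: eq_bigr => y _; exact: termE.
have mL k : (m k <= \sum_(j < n) m j)%N by rewrite (bigD1 k) //= leq_addr.
rewrite (@sum_dffun _ n (\sum_(j < n) m j) m (fun y => term (theta p) q a z m b c d e y) mL).
have t1 := th1 geo incr hp.
rewrite -(jackson_sum_bounded t1 hq a hz).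
have hr j k : epoch p q (a * q * z k / (q ^- m j / z j)) (m k) != 0.
  have := hL3a j k.
  suff -> : a * q * z k / (q ^- m j / z j) = a * q ^+ (1 + m j) * z j * z k by [].
  by rewrite exprD expr1; field; rewrite hz expf_neq0 ?oner_neq0.
have hd4 k : [/\ epoch p q (a * q * z k / b) (m k) != 0,
    epoch p q (a * q * z k / c) (m k) != 0, epoch p q (a * q * z k / d) (m k) != 0 &
    epoch p q (a * q * z k / e) (m k) != 0].
  have := hL4 k (m k) (leqnn _).
  rewrite epochs4 !mulf_eq0 !negb_or => /andP[/andP[/andP[h1 h2] h3] h4].
  exact: And4 h1 h2 h3 h4.
(* The diagonal entry j = k of the square product has denominator (q)_{m_k}. *)
have hqq k : epoch p q q (m k) != 0 by have := hL3q k k; rewrite mulfK.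
have hrat := string_ratios geo incr hp hq hz hL1 hL3q.
exact: (jackson_closed_form geo incr sq hp hq hz ha hb hc hd he mL hbal hrat hqq hL2 hr hR1 hd4).
Qed.
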